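(* Let $K$ be an algebraically closed field with a nontrivial valuation $\operatorname{val}:K\to\mathbb T$. Let $\mathbf r=(r_1,\dots,r_k)$ with $0\le r_1\le\dots\le r_k\le n$, let $\mathbf S=(S_1,\dots,S_{k-1})$ with $S_i\subseteq[n]$, and let $\boldsymbol\mu=(\mu_1,\dots,\mu_k)$ be a sequence of valuated matroids on $[n]$, realizable over $K$, with $\mu_i$ of rank $r_i$. The following are equivalent: (a) $\boldsymbol\mu\in\overline{\operatorname{trop}}(\operatorname{LFl}(\mathbf r,\mathbf S;n))$; (b) $\boldsymbol\mu$ is a realizable linear degenerate valuated flag matroid of type $\mathbf S$: there exist linear subspaces $L_i\subseteq K^n$ realizing $\mu_i$ (the same $L_i$ used for every occurrence of $\mu_i$) such that $\mathrm{pr}_{S_i}(L_i)$, which realizes $(\mu_i)_{S_i}$, is contained in $L_{i+1}$ for all $i$, so that the quotients $(\mu_i)_{S_i}\twoheadleftarrow\mu_{i+1}$ hold and are simultaneously realized; (c) there exist realizations $L_1,\dots,L_k\subseteq K^n$ of $\mu_1,\dots,\mu_k$ with $\mathrm{pr}_{S_i}(L_i)\subseteq L_{i+1}$ for all $i\in\{1,\dots,k-1\}$; (d) every projection $\mathrm{pr}_{S_i}:\mu_{i+1}\to\mu_i$ is a realizable morphism of valuated matroids, and all the valuated matroids and morphisms can be realized simultaneously, i.e. there exist realizations $L_i$ of $\mu_i$ such that for each $i$ the pair $\mathrm{pr}_{S_i}(L_i)\times\{0\}\subseteq L_{i+1}\times\{0\}$ in $K^{[n]\cup\{o\}}$ realizes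 the quotient $\mathrm{pr}_{S_i}^{-1}((\mu_i)_o)\twoheadleftarrow(\mu_{i+1})_o$.
   Context: $\mathbb T=\mathbb R\cup\{\infty\}$ (min-plus), $\mathbb P(\mathbb T^N)=(\mathbb T^N\setminus\{(\infty,\dots,\infty)\})/\mathbb R\mathbf 1$. A valuated matroid of rank $r$ on $[n]$ is $\nu:\binom{[n]}r\to\mathbb T$, not identically $\infty$, such that for all $I,J\in\binom{[n]}r$, $i\in I\setminus J$ there is $j\in J\setminus I$ with $\nu(I)+\nu(J)\ge\nu(I\setminus i\cup j)+\nu(J\setminus j\cup i)$; valuated matroids are taken up to adding a real constant, i.e. as points of $\mathbb P(\mathbb T^{\binom nr})$. For $\mu,\nu$ of ranks $r\le s$, $\mu\twoheadleftarrow\nu$ means: for all $I\in\binom{[n]}r$, $J\in\binom{[n]}s$, $i\in I\setminus J$ there is $j\in J\setminus I$ with $\mu(I)+\nu(J)\ge\mu(I\cup j\setminus i)+\nu(J\cup i\setminus j)$. Realizability: an $r$-dimensional subspace $L\subseteq K^n$, the row span of an $r\times n$ matrix $A$, has valuated matroid $I\mapsto\operatorname{val}(p_I)$ where $p_I$ is the maximal minor of $A$ on columns $I$; $L$ realizes $\mu$ if this equals $\mu$ up to equivalence. A quotient $\mu\twoheadleftarrow\nu$ is realized by subspaces $L\subseteq L'$ realizing $\mu$ and $\nu$. For $S\subseteq[n]$, $\mathrm{pr}_S:K^n\to K^n$ is the linear map with $e_i\mapsto0$ for $i\in S$, $e_i\mapsto e_i$ otherwise. $\mu_S$: if $\mu$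 has rank $r$ and underlying matroid $M$ (bases = $B$ with $\mu(B)\neq\infty$), $k=\operatorname{rk}(M\setminus S)$, choose $I\subseteq S$, $|I|=r-k$, with $([n]\setminus S)\cup I$ of rank $r$; then $\mu_S(B)=\mu(B\cup I)$ for $B\in\binom{[n]}k$ with $B\cap S=\emptyset$, and $\mu_S(B)=\infty$ otherwise (well defined up to equivalence). Morphisms: $\mu_o$ denotes $\mu$ on $[n]\cup\{o\}$ with $o$ a loop. For $f:[m]\to[n]$ surjective and $\nu$ of rank $r$ with underlying matroid $N$, $f^{-1}(\nu)(I)=\nu(f(I))$ if $f(I)$ is a basis of $N$ with $|f(I)|=|I|$, else $\infty$; for general $f$, $f^{-1}(\nu)=f^{-1}(\nu|_{f([m])})$ with $\nu|_T$ the deletion of the complement of $T$. $\mathrm{pr}_S:[n]\cup\{o\}\to[n]\cup\{o\}$ fixes $x\notin S$ and sends $S\cup\{o\}$ to $o$. $\mathrm{pr}_S:\nu\to\mu$ is a morphism of valuated matroids if $\mathrm{pr}_S^{-1}(\mu_o)\twoheadleftarrow\nu_o$, and realizable if this quotient is realizable. Linear degenerate flag variety: the (incidence) linear degenerate Plücker relations $\mathscr P_{r,s;S;n}$ are the polynomials $\sum_{j\in J\setminus(I\cup S)}\operatorname{sgn}(j;I,J)p_{I\cup j}p_{J\setminus j}$ for $I\in\binom{[n]}{r-1}$, $J\in\binom{[n]}{s+1}$, with $\operatorname{sgn}(j;I,J)=(-1)^{\#\{j'\in J:j<j'\}+\#\{i\in I:i>j\}}$; $\mathscr P_{r;n}=\mathscr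 P_{r,r;\emptyset;n}$. With $S_{ij}=S_i\cup\dots\cup S_{j-1}$, $\operatorname{LFl}(\mathbf r,\mathbf S;n)\subseteq\prod_i\mathbb P^{\binom n{r_i}-1}$ is the zero set of $\mathscr P_{r_i;n}$ ($1\le i\le k$) and $\mathscr P_{r_i,r_j;S_{ij};n}$ ($i<j$). $\overline{\operatorname{trop}}(X)$ is the closure (Euclidean topology) in $\prod_i\mathbb P(\mathbb T^{\binom n{r_i}})$ of the set of coordinatewise valuations of points of $X$. *)

(* Defs.v *)
From HB Require Import structures.
From mathcomp Require Export all_boot all_order all_algebra.
From mathcomp Require Export all_classical all_reals all_analysis.

Set Implicit Arguments.
Unset Strict Implicit.
Unset Printing Implicit Defensive.

Import Order.TTheory GRing.Theory Num.Theory.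

Local Open Scope ring_scope.
Local Open Scope quotient_scope.

(* T = R u {oo} is represented inside [\bar R], [-oo] being excluded from the
   values of every object below. *)

(** Tropical projective space *)

Section TropicalProjectiveSpace.
Variables (R : realType) (N : Type).

Definition trop_cone : set {ptws N -> \bar R} :=
  [set v | (forall x, v x != -oo%E) /\ exists x, v x != +oo%E]%classic.

(* The coercion of a set to the type of its elements carries the subspace
   topology. *)
Definition trop_vec : Type := trop_cone.

Definition same_line (v w : trop_vec) : bool :=
  `[< exists c : R, forall x, val w x = (val v x + c%:E)%E >].

Lemma same_line_equiv : equiv_class_of same_line.
Proof.
split=> [v|v w|w v u].
- by apply/asboolP; exists 0 => x; rewrite adde0.
- by apply/asboolP/asboolP => -[c Hc]; exists (- c) => x;
    rewrite Hc EFinN addeK.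
- move=> /asboolP[c Hc] /asboolP[d Hd]; apply/asboolP; exists (c + d) => x.
  by rewrite Hd Hc EFinD addeA.
Qed.

Canonical same_line_equivRel := EquivRelPack same_line_equiv.

(* P(T^N), with the quotient topology. *)
Definition trop_proj := quotient_topology {eq_quot same_line_equivRel}.

End TropicalProjectiveSpace.

(** Valuations and valuated matroids *)

Record valuation (R : realType) (K : fieldType) := Valuation {
  vfun :> K -> \bar R;
  valuation_neqNy : forall x, vfun x != -oo%E;
  valuation_eqy : forall x, (vfun x == +oo%E) = (x == 0);
  valuationM : forall x y, vfun (x * y) = (vfun x + vfun y)%E;
  valuationD : forall x y, (Order.min (vfun x) (vfun y) <= vfun (x + y))%E
}.

Definition nontrivial_valuation R K (v : valuation R K) : Prop :=
  exists2 x : K, x != 0 & v x != 0%E.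

(* A function on the r-subsets of E is encoded as a function on all subsets of E
   with value +oo on the subsets of another cardinality. *)
Record valuated_matroid (R : realType) (E : finType) (r : nat) := ValMatroid {
  vmfun :> {set E} -> \bar R;
  valmat_neqNy : forall I : {set E}, vmfun I != -oo%E;
  valmat_card : forall I : {set E}, #|I| != r -> vmfun I = +oo%E;
  valmat_finite : exists I : {set E}, vmfun I != +oo%E;
  valmat_exchange : forall (I J : {set E}) (i : E),
    #|I| = r -> #|J| = r -> i \in I :\: J ->
    exists2 j, j \in J :\: I &
      (vmfun (j |: I :\ i) + vmfun (i |: J :\ j) <= vmfun I + vmfun J)%E
}.

Section ValuatedMatroids.
Variable R : realType.

Definition vquotient (E : finType) (r s : nat) (mu nu : {set E} -> \bar R) :
    Prop :=
  (r <= s)%N /\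
  forall (I J : {set E}) (i : E),
    #|I| = r -> #|J| = s -> i \in I :\: J ->
    exists2 j, j \in J :\: I &
      (mu (j |: I :\ i) + nu (i |: J :\ j) <= mu I + nu J)%E.

Definition vequiv (E : finType) (mu nu : {set E} -> \bar R) : Prop :=
  exists c : R, forall I, nu I = (mu I + c%:E)%E.

(* Rank of X in the underlying matroid of mu. *)
Definition vrank (E : finType) (mu : {set E} -> \bar R) (X : {set E}) : nat :=
  \max_(B : {set E} | mu B != +oo%E) #|B :&: X|.

Definition deletion_set (E : finType) (r : nat) (mu : {set E} -> \bar R)
    (S : {set E}) : {set E} :=
  odflt finset.set0
    [pick I : {set E} | [&& I \subset S, #|I| == (r - vrank mu (~: S))%N
                          & vrank mu (~: S :|: I) == r]].

(* mu_S, of rank [vrank mu (~: S)], for mu of rank r.  It is also the deletion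
   of S from mu: since mu_S has value +oo on the sets that meet S, the deletion,
   whose ground set is ~: S, needs no separate type. *)
Definition vdelete (E : finType) (r : nat) (mu : {set E} -> \bar R)
    (S : {set E}) : {set E} -> \bar R :=
  fun B => if (#|B| == vrank mu (~: S)) && [disjoint B & S]
           then mu (B :|: deletion_set r mu S) else +oo%E.

(* mu_o, the new element o being [None]. *)
Definition add_loop (E : finType) (mu : {set E} -> \bar R) :
    {set option E} -> \bar R :=
  fun B => if None \in B then +oo%E else mu [set x | Some x \in B]%SET.

Definition vpreimage_onto (E F : finType) (f : E -> F)
    (nu : {set F} -> \bar R) : {set E} -> \bar R :=
  fun I => if (nu (f @: I)%SET != +oo%E) && (#|(f @: I)%SET| == #|I|)
           then nu (f @: I)%SET else +oo%E.

(* f^-1(nu), of rank [vrank nu (f @: setT)], for nu of rank r. *)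
Definition vpreimage (E F : finType) (f : E -> F) (r : nat)
    (nu : {set F} -> \bar R) : {set E} -> \bar R :=
  vpreimage_onto f (vdelete r nu (~: (f @: finset.setT)%SET)).

(* The map pr_S on E u {o}. *)
Definition pr_map (E : finType) (S : {set E}) (x : option E) : option E :=
  if x is Some i then (if i \in S then None else Some i) else None.

(* pr_S^-1(mu_o) for mu of rank r; its rank is [pr_pullback_rank S mu]. *)
Definition pr_pullback (E : finType) (S : {set E}) (r : nat)
    (mu : {set E} -> \bar R) : {set option E} -> \bar R :=
  vpreimage (pr_map S) r (add_loop mu).

Definition pr_pullback_rank (E : finType) (S : {set E})
    (mu : {set E} -> \bar R) : nat :=
  vrank (add_loop mu) (pr_map S @: finset.setT)%SET.

(* pr_S : nu -> mu is a morphism. *)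
Definition pr_morphism (E : finType) (S : {set E}) (r s : nat)
    (mu nu : {set E} -> \bar R) : Prop :=
  vquotient (pr_pullback_rank S mu) s (pr_pullback S r mu) (add_loop nu).

End ValuatedMatroids.

(** Realizability *)

Notation coord_space K E := {ffun E -> K^o}.

Section LinearMaps.
Variables (K : fieldType) (E : finType).

Definition pr_fun (S : {set E}) (u : coord_space K E) : coord_space K E :=
  [ffun x => if x \in S then 0 else u x].

Lemma pr_fun_is_linear S : linear (pr_fun S).
Proof.
by move=> a u w; apply/ffunP => x; rewrite !ffunE; case: ifP => // _;
  rewrite scaler0 addr0.
Qed.

HB.instance Definition _ S := GRing.isLinear.Build K (coord_space K E)
  (coord_space K E) _ (pr_fun S) (pr_fun_is_linear S).

Definition ext0_fun (u : coord_space K E) : coord_space K (option E) :=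
  [ffun x => if x is Some i then u i else 0].

Lemma ext0_fun_is_linear : linear ext0_fun.
Proof.
by move=> a u w; apply/ffunP => -[x|]; rewrite !ffunE // scaler0 addr0.
Qed.

HB.instance Definition _ := GRing.isLinear.Build K (coord_space K E)
  (coord_space K (option E)) _ ext0_fun ext0_fun_is_linear.

Definition pr_space (S : {set E}) (L : {vspace coord_space K E}) :
    {vspace coord_space K E} :=
  (linfun (pr_fun S) @: L)%VS.

(* L x {0}, the extra coordinate being [None]. *)
Definition ext0_space (L : {vspace coord_space K E}) :
    {vspace coord_space K (option E)} :=
  (linfun ext0_fun @: L)%VS.

End LinearMaps.

Section Realizability.
Variables (R : realType) (K : fieldType) (v : valuation R K).

(* Maximal minor on the columns I, in the order of [enum I], of the matrix with
   rows A; meaningful when #|I| = r. *)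
Definition minor (E : finType) (r : nat) (A : r.-tuple (coord_space K E))
    (I : {set E}) : K :=
  \det (\matrix_(i < r, j < r) nth 0 [seq tnth A i x | x <- enum I] j).

Definition minor_valuation (E : finType) (r : nat)
    (A : r.-tuple (coord_space K E)) : {set E} -> \bar R :=
  fun I => if #|I| == r then v (minor A I) else +oo%E.

Definition realizes (E : finType) (r : nat) (L : {vspace coord_space K E})
    (mu : {set E} -> \bar R) : Prop :=
  \dim L = r /\
  exists2 A : r.-tuple (coord_space K E),
    <<A>>%VS = L & vequiv (minor_valuation A) mu.

Definition realizes_quotient (E : finType) (r s : nat)
    (L L' : {vspace coord_space K E}) (mu nu : {set E} -> \bar R) : Prop :=
  [/\ vquotient r s mu nu, realizes r L mu, realizes s L' nu & (L <= L')%VS].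

Definition realizable_pr_morphism (E : finType) (S : {set E}) (r s : nat)
    (mu nu : {set E} -> \bar R) : Prop :=
  pr_morphism S r s mu nu /\
  exists L L' : {vspace coord_space K (option E)},
    realizes_quotient (pr_pullback_rank S mu) s L L'
      (pr_pullback S r mu) (add_loop nu).

End Realizability.

(** Linear degenerate flag varieties *)

(* A point of the projective space with coordinates indexed by the r-subsets of
   [n], given by homogeneous coordinates extended by 0 to all subsets. *)
Record proj_point (K : fieldType) (n r : nat) := ProjPoint {
  coord :> {set 'I_n} -> K;
  coord_card : forall I : {set 'I_n}, #|I| != r -> coord I = 0;
  coord_neq0 : exists I : {set 'I_n}, coord I != 0
}.

Definition sgn_exponent n (j : 'I_n) (I J : {set 'I_n}) : nat :=
  (#|[set j' in J | (j < j')%N]%SET| + #|[set i in I | (j < i)%N]%SET|)%N.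

Definition plucker_rel (K : fieldType) n (S I J : {set 'I_n})
    (p q : {set 'I_n} -> K) : K :=
  \sum_(j in J :\: (I :|: S))
    (-1) ^+ sgn_exponent j I J * p (j |: I) * q (J :\ j).

(* The condition #|I|.+1 = r leaves no relation when r = 0. *)
Definition plucker_vanish (K : fieldType) n (r s : nat) (S : {set 'I_n})
    (p q : {set 'I_n} -> K) : Prop :=
  forall I J : {set 'I_n}, #|I|.+1 = r -> #|J| = s.+1 ->
    plucker_rel S I J p q = 0.

(* Flags have k.+1 constituents, indexed from 0; the i-th of the k degeneration
   sets relates the constituents [src i] and [tgt i]. *)
Definition src k (i : 'I_k) : 'I_k.+1 := widen_ord (leqnSn k) i.
Definition tgt k (i : 'I_k) : 'I_k.+1 := lift ord0 i.

Definition degeneration_union n k (S : 'I_k -> {set 'I_n}) (i j : 'I_k.+1) :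
    {set 'I_n} :=
  (\bigcup_(l < k | (i <= l < j)%N) S l)%SET.

Definition LFl (K : fieldType) n k (r : 'I_k.+1 -> nat)
    (S : 'I_k -> {set 'I_n}) (p : forall i, proj_point K n (r i)) : Prop :=
  (forall i, plucker_vanish (r i) (r i) finset.set0 (p i) (p i)) /\
  (forall i j : 'I_k.+1, (i < j)%N ->
     plucker_vanish (r i) (r j) (degeneration_union S i j) (p i) (p j)).

(** Tropicalization *)

Definition subsets_of_card n r : Type := {I : {set 'I_n} | #|I| == r}.

Section Tropicalization.
Variables (R : realType) (n r : nat).

Lemma restrict_in_trop_cone (f : {set 'I_n} -> \bar R) :
  (forall I, f I != -oo%E) -> (forall I : {set 'I_n}, #|I| != r -> f I = +oo%E) ->
  (exists I, f I != +oo%E) ->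
  (fun I : subsets_of_card n r => f (val I)) \in @trop_cone R _.
Proof.
move=> fNy fr [I fI]; apply/mem_set; split=> [J|]; first exact: fNy.
have rI : #|I| == r by apply: contraNT fI => /fr ->.
by exists (exist _ I rI).
Qed.

Definition trop_class (f : {set 'I_n} -> \bar R)
    (fNy : forall I, f I != -oo%E) (fr : forall I : {set 'I_n}, #|I| != r -> f I = +oo%E)
    (fy : exists I, f I != +oo%E) : trop_proj R (subsets_of_card n r) :=
  \pi_(trop_proj R (subsets_of_card n r))
    (exist (fun w => w \in @trop_cone R _) _ (restrict_in_trop_cone fNy fr fy)).

Definition valmat_class (mu : valuated_matroid R 'I_n r) :=
  trop_class (valmat_neqNy mu) (@valmat_card _ _ _ mu) (valmat_finite mu).

Variables (K : fieldType) (v : valuation R K) (p : proj_point K n r).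

Lemma proj_point_card (I : {set 'I_n}) : #|I| != r -> v (p I) = +oo%E.
Proof. by move=> /(@coord_card _ _ _ p) ->; apply/eqP; rewrite valuation_eqy. Qed.

Lemma proj_point_finite : exists I, v (p I) != +oo%E.
Proof. by have [I pI] := coord_neq0 p; exists I; rewrite valuation_eqy. Qed.

Definition trop_point : trop_proj R (subsets_of_card n r) :=
  trop_class (fun I => valuation_neqNy v (p I)) proj_point_card
    proj_point_finite.

End Tropicalization.

(* The product of the P(T^(n choose r_i)), with the product topology. *)
Definition trop_proj_prod (R : realType) n k (r : 'I_k.+1 -> nat) :=
  prod_topology (fun i => trop_proj R (subsets_of_card n (r i))).

Section TropicalizedVarieties.
Variables (R : realType) (K : fieldType) (v : valuation R K) (n k : nat).
Variables (r : 'I_k.+1 -> nat) (X : (forall i, proj_point K n (r i)) -> Prop).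

Definition trop : set (trop_proj_prod R n r) :=
  [set q | exists2 p, X p & q = fun i => trop_point v (p i)]%classic.

Definition trop_closure : set (trop_proj_prod R n r) := closure trop.

End TropicalizedVarieties.

(** Flags of valuated matroids *)

Section Flags.
Variables (R : realType) (K : fieldType) (v : valuation R K) (n k : nat).
Variables (r : 'I_k.+1 -> nat) (S : 'I_k -> {set 'I_n}).
Variable mu : forall i, valuated_matroid R 'I_n (r i).

Definition realizations (L : 'I_k.+1 -> {vspace coord_space K 'I_n}) : Prop :=
  forall i, realizes v (r i) (L i) (mu i).

Definition ld_flag_matroid : Prop :=
  forall i : 'I_k,
    vquotient (vrank (mu (src i)) (~: S i)) (r (tgt i))
      (vdelete (r (src i)) (mu (src i)) (S i)) (mu (tgt i)).

Definition realizable_ld_flag_matroid : Prop :=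
  ld_flag_matroid /\
  exists2 L, realizations L &
    forall i : 'I_k,
      realizes_quotient v (vrank (mu (src i)) (~: S i)) (r (tgt i))
        (pr_space (S i) (L (src i))) (L (tgt i))
        (vdelete (r (src i)) (mu (src i)) (S i)) (mu (tgt i)).

Definition realizable_pr_morphisms : Prop :=
  (forall i : 'I_k,
     realizable_pr_morphism v (S i) (r (src i)) (r (tgt i))
       (mu (src i)) (mu (tgt i))) /\
  exists2 L, realizations L &
    forall i : 'I_k,
      realizes_quotient v (pr_pullback_rank (S i) (mu (src i))) (r (tgt i))
        (ext0_space (pr_space (S i) (L (src i)))) (ext0_space (L (tgt i)))
        (pr_pullback (S i) (r (src i)) (mu (src i)))
        (add_loop (mu (tgt i))).

End Flags.

(* Main.v *)
Require Import Defs.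
From HB Require Import structures.
From mathcomp Require Import all_boot all_order all_algebra.
From mathcomp Require Import all_fingroup closed_field ring_quotient.
From mathcomp Require Import all_classical all_reals all_analysis.
From mathcomp Require Import ring lra zify.

(* The hard implication is (a) => (c).  A point of the closure gives an ultrafilter
   on the degenerate flag variety along which the valuations of the coordinates
   converge.  Functions bounded along it, modulo those of valuation tending to
   infinity, form an algebraically closed field Omega with a valuation ring over
   that of K, and the coordinates define an Omega-point of the variety whose
   coordinates vanish or have the prescribed values exactly.  A K-point with the
   same property exists because K is existentially closed in Omega (Robinson).
   This is proved by eliminating one variable b at a time, while keeping only weak
   conditions g / h in the valuation ring.
   - If b is algebraic, let rho range over the conjugates of b.  The inequality
     between the coefficients of prod_rho (H(rho) X - G(rho)) that expresses that
     G(b) / H(b) is integral forces G(rho) / H(rho) to be integral for some rho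
     after specialization; several conditions are combined into one by taking
     sum_j G_j t^j for many t with distinct residues.
   - If b is transcendental, adjoin the roots of the polynomials involved.  The
     conditions on b then become inequalities between the value of b - a, for a
     root a nearest to b, and values of elements not involving b, and they are
     solved by Fourier-Motzkin elimination.
   The other implications are linear algebra.  The Pluecker relations cut out the
   pairs of subspaces with pr_S L inside L', and Cramer's rule gives the exchange
   property of a realized quotient.  Since pr_S sends S to the loop o, the matroid
   pr_S^-1(mu_o) is the deletion of S from mu_o, so that (d) is (b) on the ground
   set [n] u {o}. *)

Set Implicit Arguments.
Unset Strict Implicit.
Unset Printing Implicit Defensive.

Import Order.TTheory GRing.Theory Num.Theory.

Local Open Scope ring_scope.

(** * Valuation rings *)

(** The obstacle in (a) => (c) is that near a point of the closure the coordinates have values that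
    are only close to the prescribed ones, and large instead of infinite, while correcting
    coordinates one by one would destroy the Pluecker relations. Omega makes both approximations
    exact: a coordinate of value tending to infinity is 0 there, and its valuation ring consists of
    the classes with v >= -e along the ultrafilter for every e > 0, so that a value correct in the
    limit is correct. Since the mu_i are realizable, the prescribed values are values of elements c
    of K, and v(x) = v(c) is the pair of weak conditions that x / c and c / x are integral. Hence no
    strict inequality ever has to be transferred. Valuation rings are given by membership predicates
    alone: for y != 0, [W (x / y)] says v(y) <= v(x), and no value group of Omega has to be
    built. *)

Record valring (F : fieldType) (W : F -> Prop) : Prop := Valring {
  valring1 : W 1;
  valringB : forall x y, W x -> W y -> W (x - y);
  valringM : forall x y, W x -> W y -> W (x * y);
  valringV : forall x, W x \/ W x^-1
}.

Section ValuationRings.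
Variables (F : fieldType) (W : F -> Prop) (vW : valring W).

Lemma valring0 : W 0.
Proof. by rewrite -(subrr 1); apply: valringB vW _ _ _ _; exact: valring1. Qed.

Lemma valringN x : W x -> W (- x).
Proof. by rewrite -sub0r; apply: valringB vW _ _ valring0. Qed.

Lemma valringD x y : W x -> W y -> W (x + y).
Proof. by move=> Wx Wy; rewrite -[y]opprK; apply: valringB => //; exact: valringN. Qed.

Lemma valringX x n : W x -> W (x ^+ n).
Proof.
move=> Wx; elim: n => [|n IHn]; first exact: valring1.
by rewrite exprS; exact: valringM.
Qed.

Lemma valring_sum (I : Type) (s : seq I) (P : pred I) (f : I -> F) :
  (forall i, P i -> W (f i)) -> W (\sum_(i <- s | P i) f i).
Proof. by move=> Wf; elim/big_ind: _ => //; [exact: valring0 | exact: valringD]. Qed.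

Lemma valring_prod (I : Type) (s : seq I) (P : pred I) (f : I -> F) :
  (forall i, P i -> W (f i)) -> W (\prod_(i <- s | P i) f i).
Proof. by move=> Wf; elim/big_ind: _ => //; [exact: valring1 | exact: valringM]. Qed.

Lemma valring_root x n : W (x ^+ n.+1) -> W x.
Proof.
move=> Wxn; have [//|Wx] := valringV vW x.
have [->|x0] := eqVneq x 0; first exact: valring0.
rewrite (_ : x = x ^+ n.+1 * x^-1 ^+ n); first by apply: valringM => //; exact: valringX.
by rewrite exprVn exprS mulfK ?expf_neq0.
Qed.

Lemma valring_min (s : seq F) : (exists2 x, x \in s & x != 0) ->
  exists x, [/\ x \in s, x != 0 & forall y, y \in s -> W (y / x)].
Proof.
elim: s => [[]//|a s IHs] [x]; have [xs0|] := pselect (exists2 x, x \in s & x != 0).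
- have [y [ys y0 Hy]] := IHs xs0 => _ _.
  have [a0|a0] := eqVneq a 0.
    exists y; split=> [||z]; rewrite ?inE ?ys ?orbT //.
    by case/orP => [/eqP ->|]; [rewrite a0 mul0r; exact: valring0 | exact: Hy].
  have [Way|] := valringV vW (a / y).
    exists y; split=> [||z]; rewrite ?inE ?ys ?orbT //.
    by case/orP => [/eqP ->|] //; exact: Hy.
  rewrite invf_div => Wya; exists a; split=> [||z]; rewrite ?inE ?eqxx //.
  case/orP => [/eqP ->|zs]; first by rewrite divff //; exact: valring1.
  rewrite (_ : z / a = (z / y) * (y / a)); last by rewrite mulrA divfK.
  by apply: valringM => //; exact: Hy.
- move=> xs0; rewrite inE => /orP[/eqP -> a0|]; last by move=> xs x0; case: xs0; exists x.
  exists a; split=> [||z]; rewrite ?inE ?eqxx //.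
  case/orP => [/eqP ->|zs]; first by rewrite divff //; exact: valring1.
  have [->|z0] := eqVneq z 0; first by rewrite mul0r; exact: valring0.
  by case: xs0; exists z.
Qed.

Definition vunit x := [/\ x != 0, W x & W x^-1].

Lemma vunit1 : vunit 1.
Proof. by rewrite /vunit invr1 oner_eq0; split=> //; exact: valring1. Qed.

Lemma vunitM x y : vunit x -> vunit y -> vunit (x * y).
Proof.
move=> [x0 Wx WVx] [y0 Wy WVy]; split; rewrite ?mulf_neq0 //; first exact: valringM.
by rewrite invfM; exact: valringM.
Qed.

Lemma vunit_prod (I : Type) (s : seq I) (P : pred I) (f : I -> F) :
  (forall i, P i -> vunit (f i)) -> vunit (\prod_(i <- s | P i) f i).
Proof. by move=> Wf; elim/big_ind: _ => //; [exact: vunit1 | exact: vunitM]. Qed.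

Lemma notvalringM x y : ~ W x -> ~ W y -> ~ W (x * y).
Proof.
move=> nWx nWy Wxy; apply: nWx; have [//|Wy] := valringV vW y.
have y0 : y != 0 by apply/eqP => y0; apply: nWy; rewrite y0; exact: valring0.
by rewrite -(mulfK y0 x); exact: valringM.
Qed.

Lemma notvalring_prod (s : seq F) x : ~ W x -> (forall y, y \in s -> ~ W y) ->
  ~ W (x * \prod_(y <- s) y).
Proof.
elim: s x => [|a s IHs] x nWx nWs; first by rewrite big_nil mulr1.
rewrite big_cons mulrA; apply: IHs => [|y ys]; last by apply: nWs; rewrite inE ys orbT.
by apply: notvalringM => //; apply: nWs; rewrite inE eqxx.
Qed.

(** The value of [d] is strictly smaller than that of [z], so [z + d] has the value of [d]. *)
Lemma vunit_dominant z d : z != 0 -> d != 0 -> W (z / d) -> ~ W (d / z) ->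
  vunit ((z + d) / d).
Proof.
move=> z0 d0 Wzd nWdz.
have zd0 : z + d != 0.
  apply/eqP => /eqP; rewrite addr_eq0 => /eqP zE; apply: nWdz.
  by rewrite zE invrN mulrN divff //; apply: valringN; exact: valring1.
split; first by rewrite mulf_neq0 ?invr_eq0.
- by rewrite mulrDl divff //; apply: valringD => //; exact: valring1.
- rewrite invf_div; have [|] := valringV vW (z / (z + d)).
    move=> Wz; rewrite (_ : d / _ = 1 - z / (z + d)); last by field.
    by apply: valringB => //; exact: valring1.
  rewrite invf_div mulrDl divff // => Wz; case: nWdz.
  by rewrite -(addKr 1 (d / z)) addrC; apply: valringB => //; exact: valring1.
Qed.

End ValuationRings.

(** Take a root u of X * prod (X - c) - 1. The elements u and u - c multiply to 1; if u were not
    integral, none of them would be, and neither would their product. In terms of residues: the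
    residue field of K is infinite. *)
Lemma valring_avoid (K : closedFieldType) (O : K -> Prop) (vO : valring O) (s : seq K) :
  (forall c, c \in s -> O c) ->
  exists u, vunit O u /\ forall c, c \in s -> vunit O (u - c).
Proof.
move=> Os; pose p : {poly K} := 'X * \prod_(c <- s) ('X - c%:P) - 1.
have szp : size p = (size s).+2.
  have sz : size ('X * \prod_(c <- s) ('X - c%:P)) = (size s).+2.
    by rewrite size_Mmonic ?polyX_eq0 ?monic_prod_XsubC // size_polyX size_prod_XsubC.
  by rewrite size_polyDl ?sz // size_polyN size_poly1.
have /closed_rootP[u] : size p != 1%N by rewrite szp.
rewrite /root !hornerE horner_prod subr_eq0 => /eqP uE.
have {}uE : u * \prod_(c <- s) (u - c) = 1.
  by rewrite -[RHS]uE; congr (_ * _); apply: eq_bigr => c _; rewrite !hornerE.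
have [Ou|nOu] := pselect (O u); last first.
  have /(_ _)[] // := notvalring_prod vO nOu (s := [seq u - c | c <- s]).
    move=> y /mapP[c cs ->] Ouc; apply: nOu; rewrite -(subrK c u).
    by apply: valringD => //; exact: Os.
  by rewrite big_map uE; exact: valring1.
have unit_of x y : O x -> O y -> x * y = 1 -> vunit O x.
  move=> Ox Oy xy1; have x0 : x != 0 by apply: contra_eq_neq xy1 => ->; rewrite mul0r eq_sym oner_eq0.
  by split=> //; rewrite -[x^-1]mulr1 -xy1 mulKf.
have Ouc c : c \in s -> O (u - c) by move=> cs; apply: valringB => //; exact: Os.
exists u; split=> [|c cs].
  apply: unit_of uE => //; rewrite big_seq; apply: valring_prod => // c; exact: Ouc.
apply: (unit_of _ (u * \prod_(y <- rem c s) (u - y))) => //; first exact: Ouc.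
  apply: valringM => //; rewrite big_seq; apply: valring_prod => // y /mem_rem; exact: Ouc.
by rewrite mulrCA -[RHS]uE [in RHS](big_rem c).
Qed.

Lemma valring_separated (K : closedFieldType) (O : K -> Prop) (vO : valring O) n :
  exists s : seq K, [/\ size s = n, forall x, x \in s -> O x &
    pairwise (fun x y => `[< vunit O (y - x) >]) s].
Proof.
elim: n => [|n [s [szs Os ps]]]; first by exists [::].
have [u [[_ Ou _] us]] := valring_avoid vO Os.
exists (u :: s); split=> /= [|x|]; first by rewrite szs.
  by rewrite inE => /orP[/eqP ->|/Os].
rewrite ps andbT; apply/allP => x xs; apply/asboolP; case: (us x xs) => u1 u2 u3.
rewrite -opprB; split; first by rewrite oppr_eq0.
  exact: valringN.
by rewrite invrN; exact: valringN.
Qed.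

(* Newton interpolation with unit denominators. *)
Lemma valring_interpolation (F : fieldType) (W : F -> Prop) (vW : valring W)
    (s : seq F) (p : {poly F}) :
  (size p <= size s)%N -> (forall x, x \in s -> W x) ->
  pairwise (fun x y => `[< vunit W (y - x) >]) s ->
  (forall x, x \in s -> W p.[x]) -> forall i, W p`_i.
Proof.
elim: s p => [|x s IHs] p /= szp Ws ps Wp i.
  by move: szp; rewrite leqn0 size_poly_eq0 => /eqP ->; rewrite coef0; exact: valring0.
have /andP[/allP px pws] := ps.
have Wx : W x by apply: Ws; rewrite inE eqxx.
have Wpx : W p.[x] by apply: Wp; rewrite inE eqxx.
have /factor_theorem[q qE] : root (p - p.[x]%:P) x by rewrite /root !hornerE subrr.
have pE : p = q * ('X - x%:P) + p.[x]%:P by rewrite -qE subrK.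
have szq : (size q <= size s)%N.
  have [->|q0] := eqVneq q 0; first by rewrite size_poly0.
  have: (size (q * ('X - x%:P))%R <= (size s).+1)%N.
    by rewrite -qE (leq_trans (size_polyD _ _)) // geq_max szp size_polyN (leq_trans (size_polyC_leq1 _)).
    by rewrite size_Mmonic ?monicXsubC // size_XsubC addn2.
have Wq : forall j, W q`_j.
  apply: IHs => // [y ys|y ys]; first by apply: Ws; rewrite inE ys orbT.
  have /asboolP[yx0 _ Wyx] := px y ys.
  rewrite (_ : q.[y] = (p.[y] - p.[x]) * (y - x)^-1); last first.
    by rewrite {1}pE !hornerE addrK mulfK.
  by apply: valringM => //; apply: valringB => //; apply: Wp; rewrite inE ys orbT.
rewrite pE mulrBr coefD coefB coefMX coefMC coefC.
apply: valringD => //; last by case: ifP => // _; exact: valring0.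
by apply: valringB => //; [case: ifP => // _; exact: valring0|exact: valringM].
Qed.

(** * Elimination of one variable over a valued field *)

Section Pencil.
Variables (A : comNzRingType) (d : nat).
Implicit Types (M : 'M[A]_d.+1) (G H : {poly A}).

(** When [p] is the characteristic polynomial of [M], this is prod (H(rho) X - G(rho)) over the
    roots rho of [p]. The determinant has its coefficients in [A], where [p] need not split, and it
    commutes with ring morphisms. *)
Definition pencil M G H : {poly A} :=
  \det ('X *: map_mx polyC (horner_mx M H) - map_mx polyC (horner_mx M G)).

Lemma horner_pencil M G H x :
  (pencil M G H).[x] = \det (horner_mx M (x *: H - G)).
Proof.
rewrite /pencil -horner_evalE -det_map_mx; congr (\det _).
rewrite [RHS]rmorphB /= horner_mxZ; apply/matrixP => i j.
move: (horner_mx M H) (horner_mx M G) => P Q.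
by rewrite !mxE /horner_eval !hornerE.
Qed.

End Pencil.

Lemma map_pencil (A B : comNzRingType) (f : {rmorphism A -> B}) d (M : 'M[A]_d.+1) G H :
  map_poly f (pencil M G H) = pencil (map_mx f M) (map_poly f G) (map_poly f H).
Proof.
rewrite /pencil -det_map_mx; congr (\det _).
rewrite -!map_horner_mx; apply/matrixP => i j.
by rewrite !mxE rmorphB rmorphM /= map_polyX !map_polyC.
Qed.

Section PencilRoots.
Variables (F : closedFieldType) (d : nat) (M : 'M[F]_d.+1) (r : seq F).
Hypothesis Mr : char_poly M = \prod_(z <- r) ('X - z%:P).

Lemma det_sub_char s : \det (M - s%:M) = \prod_(z <- r) (z - s).
Proof.
have szr : size r = d.+1.
  by apply: succn_inj; rewrite -(size_char_poly M) Mr size_prod_XsubC.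
have -> : M - s%:M = - (s%:M - M) by rewrite opprB.
rewrite -scaleN1r detZ.
have -> : \det (s%:M - M) = (char_poly M).[s].
  rewrite /char_poly -horner_evalE -det_map_mx; congr (\det _).
  by apply/matrixP => i j; rewrite !mxE /= horner_evalE hornerD hornerN hornerC hornerMn hornerX.
rewrite Mr horner_prod -szr -[size r]count_predT -iter_mulr_1 -big_const_seq -big_split /=.
by apply: eq_bigr => z _; rewrite !hornerE; ring.
Qed.

Lemma det_horner_mx q : \det (horner_mx M q) = \prod_(z <- r) q.[z].
Proof.
have szr : size r = d.+1.
  by apply: succn_inj; rewrite -(size_char_poly M) Mr size_prod_XsubC.
have [s ->] := closed_field_poly_normal q.
rewrite horner_mxZ detZ; under [RHS]eq_bigr do rewrite hornerZ.
rewrite big_split /= big_const_seq count_predT szr iter_mulr mulr1; congr (_ * _).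
under [RHS]eq_bigr do rewrite horner_prod.
rewrite exchange_big /= rmorph_prod /=.
rewrite (big_morph _ (@det_mulmx _ _) (det1 _ _)); apply: eq_bigr => y _.
rewrite rmorphB /= horner_mx_X horner_mx_C det_sub_char.
by apply: eq_bigr => z _; rewrite !hornerE.
Qed.

(** Both sides agree at every point, and over an algebraically closed field a nonzero polynomial has
    a non-root. *)
Lemma pencil_prod G H :
  pencil M G H = \prod_(z <- r) (H.[z] *: 'X - G.[z]%:P).
Proof.
apply/eqP; rewrite -subr_eq0; apply: contraT => /closed_nonrootP[x].
rewrite /root hornerD hornerN horner_pencil det_horner_mx horner_prod.
rewrite (eq_bigr (fun z => (H.[z] *: 'X - G.[z]%:P).[x])) ?subrr ?eqxx //.
by move=> z _; rewrite !hornerE; ring.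
Qed.

End PencilRoots.

(** * Newton slopes of a product of linear factors *)

Section MaximalIdeal.
Variables (F : fieldType) (W : F -> Prop) (vW : valring W).

(** The case x = 0 is listed apart because [0^-1] is 0, which lies in [W]. *)
Definition vmax x := x = 0 \/ ~ W x^-1.

Lemma vmaxMl w x : W w -> vmax x -> vmax (w * x).
Proof.
move=> Ww [->|nWx]; first by left; rewrite mulr0.
have [->|w0] := eqVneq w 0; first by left; rewrite mul0r.
right=> Wwx; apply: nWx; rewrite (_ : x^-1 = w * (w * x)^-1); first exact: valringM.
by rewrite invfM mulrA divff ?mul1r.
Qed.

Lemma vmax1 : ~ vmax 1.
Proof. by case=> [/eqP|]; [rewrite oner_eq0 | rewrite invr1 => /(_ (valring1 vW))]. Qed.

Lemma vmaxW x : vmax x -> W x.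
Proof. by case=> [->|nWx]; [exact: valring0 | have [] := valringV vW x]. Qed.

Lemma vmaxD x y : vmax x -> vmax y -> vmax (x + y).
Proof.
move=> mx my; have [|xy0] := eqVneq (x + y) 0; first by left.
right=> Wxy; have {mx} := vmaxMl Wxy mx; have {my} := vmaxMl Wxy my.
have : (x + y)^-1 * x + (x + y)^-1 * y = 1 by rewrite -mulrDr mulVf.
move: (_ * x) (_ * y) => a b ab.
wlog Wab : a b ab / W (b / a).
  move=> wl mb ma; have [Wba|] := valringV vW (b / a); first exact: (wl a b).
  by rewrite invf_div => Wba; apply: (wl b a) => //; rewrite addrC.
move=> mb [a0|nWa].
  by case: vmax1; rewrite -ab a0 add0r.
have a0 : a != 0.
  by apply/eqP => a0; apply: nWa; rewrite a0 invr0; exact: valring0.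
apply: nWa; rewrite (_ : a^-1 = 1 + b / a); first by apply: valringD => //; exact: valring1.
by apply: (mulfI a0); rewrite mulrDr mulrCA divff // !mulr1 ab.
Qed.

End MaximalIdeal.

Section Slopes.
Variables (F : fieldType) (W : F -> Prop) (vW : valring W).

(** P_0 is minus the sum of the P_k x^k with k > 0, and x is integral, so the value of P_0 is at
    least the least value of the other coefficients. *)
Lemma valring_coef_root (P : {poly F}) x : P != 0 -> root P x -> W x ->
  exists k, P`_k.+1 != 0 /\ W (P`_0 / P`_k.+1).
Proof.
move=> P0 /eqP Px Wx; pose s := behead P.
have Ps k : s`_k = P`_k.+1 by rewrite /s nth_behead.
have P0E : P`_0 = - \sum_(i < size s) s`_i * x ^+ i.+1.
  apply/eqP; rewrite -addr_eq0; apply/eqP; rewrite -[RHS]Px horner_coef size_behead.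
  move: P0; rewrite -size_poly_gt0; case: (size P) => // m _.
  rewrite big_ord_recl /= expr0 mulr1; congr (_ + _).
  by apply: eq_bigr => i _; rewrite Ps.
have [ks|sk] := pselect (exists2 c, c \in s & c != 0); last first.
  have s0 k : s`_k = 0.
    apply/eqP; apply: contra_notT sk => sk0; exists s`_k => //.
    by apply: mem_nth; rewrite ltnNge; apply: contra sk0 => /(nth_default 0) ->.
  case/eqP: P0; apply/polyP => -[|k]; last by rewrite -Ps s0 coef0.
  by rewrite P0E big1 ?oppr0 ?coef0 // => i _; rewrite s0 mul0r.
have [c [cs c0 Hc]] := valring_min vW ks.
exists (index c s); rewrite -Ps nth_index //; split=> //.
rewrite P0E mulNr; apply: valringN => //; rewrite mulr_suml.
apply: valring_sum => // i _; rewrite mulrAC; apply: valringM => //; last exact: valringX.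
by apply: Hc; apply: mem_nth.
Qed.

(** Suppose no g / h is integral. Dividing each factor by its g turns it into (h / g) X - 1 with h /
    g in the maximal ideal, so the product is 1 or -1 modulo the maximal ideal. The constant
    coefficient of P then has strictly smaller value than all others. *)
Lemma valring_slope (I : eqType) (r : seq I) (g h : I -> F) k :
  let P := \prod_(z <- r) (h z *: 'X - (g z)%:P) in
  P`_k.+1 != 0 -> W (P`_0 / P`_k.+1) ->
  exists z, [/\ z \in r, h z != 0 & W (g z / h z)].
Proof.
move=> P Pk WP; apply: contrapT => nz.
have P0 : P != 0 by apply: contra_neq Pk => ->; rewrite coef0.
have gt z : z \in r -> g z != 0 /\ vmax W (h z / g z).
  move=> zr; have [hz|hz] := eqVneq (h z) 0.
    rewrite hz mul0r; split; last by left.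
    apply: contra_neq P0 => gz; rewrite /P (big_rem z) //= hz gz scale0r.
    by rewrite polyC0 subr0 mul0r.
  have nW : ~ W (g z / h z) by move=> Wz; apply: nz; exists z.
  split; last by right; rewrite invf_div.
  by apply/eqP => gz; apply: nW; rewrite gz mul0r; exact: valring0.
pose Q := \prod_(z <- r) ((h z / g z) *: 'X - 1%:P).
have PE : P = (\prod_(z <- r) g z) *: Q.
  rewrite /P /Q -!mul_polyC rmorph_prod /= -big_split /=.
  rewrite [LHS]big_seq [RHS]big_seq; apply: eq_bigr => z /gt[gz _].
  by rewrite mulrBr -polyCM mulr1 mul_polyC scalerA mulrCA divff // mulr1.
(* The constant coefficient is a sign depending on the number of factors; its square makes the
   induction independent of this number. *)
have [Q0 Qm] : Q`_0 ^+ 2 = 1 /\ forall j, vmax W Q`_j.+1.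
  rewrite /Q big_seq; elim/big_ind: _ => [|p q [p0 pm] [q0 qm]|z /gt[gz zm]].
  - by rewrite coef1 expr1n; split=> // j; rewrite coef1; left.
  - have Wp j : W p`_j.
      case: j => [|j]; last exact: vmaxW.
      by apply: (@valring_root _ _ vW _ 1); rewrite p0; exact: valring1.
    have Wq : W q`_0.
      by apply: (@valring_root _ _ vW _ 1); rewrite q0; exact: valring1.
    split=> [|j]; first by rewrite coefM big_ord1 exprMn p0 q0 mulr1.
    rewrite coefM; elim/big_ind: _ => [||i _]; [by left|exact: vmaxD|].
    case: (ltnP i j.+1) => ij; first by rewrite subSn //; exact: vmaxMl.
    have -> : nat_of_ord i = j.+1 by apply/eqP; rewrite eqn_leq ij -ltnS ltn_ord.
    by rewrite subnn mulrC; apply: vmaxMl.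
  - by rewrite !coefE /= mulr0 sub0r sqrrN expr1n; split=> // j; rewrite !coefE /= subr0;
     case: j => [|j]; [rewrite mulr1 | rewrite mulr0; left].
have G0 : \prod_(z <- r) g z != 0.
  by apply: contra_neq P0 => G0; rewrite PE G0 scale0r.
move: Pk WP; rewrite PE !coefZ mulf_eq0 negb_or => /andP[_ Qk].
rewrite -mulf_div divff // mul1r => WQ; have := vmaxMl vW WQ (Qm k).
rewrite divfK // => Qm0; apply: (vmax1 vW); rewrite -Q0 expr2; apply: vmaxMl => //.
exact: vmaxW.
Qed.

End Slopes.

Lemma pigeonhole_filter (Z K : eqType) (good : Z -> K -> bool) (r : seq Z) (Th : seq K) N :
  (size r * N < size Th)%N ->
  (forall t, t \in Th -> exists2 z, z \in r & good z t) ->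
  exists2 z, z \in r & (N <= size (seq.filter (good z) Th))%N.
Proof.
elim: r Th => [|z r IHr] Th.
  by case: Th => // t Th _ /(_ t); rewrite inE eqxx => /(_ isT)[].
move=> szT goodT; have [zN|zN] := leqP N (size (seq.filter (good z) Th)).
  by exists z; rewrite // inE eqxx.
have szE : size Th = (size (seq.filter (good z) Th) + size (seq.filter (predC (good z)) Th))%N.
  by rewrite !size_filter count_predC.
have [|t|y yr Ny] := IHr (seq.filter (predC (good z)) Th).
- by move: szT; rewrite szE /= mulSn; move: zN; move: (size _) (size _) (_ * _)%N => a b c; lia.
- rewrite mem_filter => /andP[/= ngt tT]; have [y] := goodT t tT.
  by rewrite inE => /orP[/eqP -> gt|yr gt]; [rewrite gt in ngt | exists y].
- exists y; first by rewrite inE yr orbT.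
  rewrite (leq_trans Ny) // -filter_predI !size_filter; apply: sub_count => t /=.
  by case/andP.
Qed.

Definition ev (A F : comNzRingType) (f : {rmorphism A -> F}) (b : F) :
  {poly A} -> F := horner_eval b \o map_poly f.

HB.instance Definition _ A F f b := GRing.RMorphism.on (@ev A F f b).

Lemma evE (A F : comNzRingType) (f : {rmorphism A -> F}) b p :
  ev f b p = (map_poly f p).[b].
Proof. by []. Qed.

(* A pair (E, Q) stands for the conditions e = 0 for e in E and h != 0, g / h in
   the valuation ring, for (g, h) in Q. *)
Definition conditions (A : Type) : Type := seq A * seq (A * A).

Section Satisfaction.
Variables (F : fieldType) (W : F -> Prop).

Definition admissible (g h : F) := h != 0 /\ W (g / h).

Definition sat (A : eqType) (f : A -> F) (D : conditions A) :=
  (forall e, e \in D.1 -> f e = 0) /\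
  (forall q, q \in D.2 -> admissible (f q.1) (f q.2)).

Definition join_conditions (A : Type) (D D' : conditions A) : conditions A :=
  (D.1 ++ D'.1, D.2 ++ D'.2).

Lemma sat_join (A : eqType) (f : A -> F) D D' :
  sat f (join_conditions D D') <-> sat f D /\ sat f D'.
Proof.
split=> [[H1 H2]|[[H1 H2] [H1' H2']]].
  by split; split=> x xD; (apply: H1 || apply: H2); rewrite mem_cat xD ?orbT.
by split=> x; rewrite mem_cat => /orP[]; [apply: H1 | apply: H1' | apply: H2 | apply: H2'].
Qed.

End Satisfaction.

(** [H] and [G] are chosen before the field and the morphism, so the same ones serve over Omega and
    after specialization to K. *)
Lemma common_denominator (A : comNzRingType) (Q : seq (A * A)) :
  exists (H : A) (G : seq A), forall (F : fieldType) (W : F -> Prop),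
    valring W -> forall f : {rmorphism A -> F},
    (forall q, q \in Q -> admissible W (f q.1) (f q.2)) <->
    f H != 0 /\ forall g, g \in G -> W (f g / f H).
Proof.
elim: Q => [|[g h] Q [H [G HG]]].
  by exists 1, [::] => F W vW f; split=> // _; rewrite rmorph1 oner_eq0.
exists (h * H), (g * H :: [seq h * x | x <- G]) => F W vW f.
have [HG1 HG2] := HG F W vW f; split=> [Hq|[]].
  have [|fH WG] := HG1; first by move=> q qQ; apply: Hq; rewrite inE qQ orbT.
  have [/= fh Wgh] := Hq (g, h) (mem_head _ _).
  rewrite rmorphM mulf_neq0 //; split=> // x; rewrite inE => /orP[/eqP ->|/mapP[y yG ->]].
    by rewrite rmorphM -mulf_div divff // mulr1.
  by rewrite rmorphM -mulf_div divff // mul1r; apply: WG.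
rewrite rmorphM mulf_eq0 negb_or => /andP[fh fH] WG q; rewrite inE => /orP[/eqP ->|].
  split=> //=; have := WG (g * H); rewrite mem_head rmorphM -mulf_div divff // mulr1.
  exact.
apply: HG2; split=> // x xG; have := WG (h * x).
rewrite inE map_f ?orbT // rmorphM -mulf_div divff // mul1r; exact.
Qed.

Section Elimination.
Variables (K Om : closedFieldType) (O : K -> Prop) (W : Om -> Prop).
Variables (vO : valring O) (vW : valring W) (iota : {rmorphism K -> Om}).
Hypothesis iotaW : forall x, O x -> W (iota x).

(** The conditions [D'] must hold at [psi] and suffice for the existence of a value [tau] in K; they
    may be stronger than solvability. As [A] need not be a field nor [psi] injective, algebraic
    relations over [A] are always read after applying [psi]. *)
Definition eliminable (A : comNzRingType) (k : {rmorphism K -> A})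
    (psi : {rmorphism A -> Om}) (b : Om) :=
  forall D, sat W (ev psi b) D ->
  exists2 D', sat W psi D' & forall phi : {rmorphism A -> K},
    (forall x, phi (k x) = x) -> sat O phi D' -> exists tau, sat O (ev phi tau) D.

Lemma exists_char_poly (A : comNzRingType) (p : {poly A}) :
  p \is monic -> (1 < size p)%N -> exists d (M : 'M[A]_d.+1), char_poly M = p.
Proof.
move=> pm szp; have := companionmxK pm; move: (companionmx p).
by case E: (size p).-1 szp => [|d] szp M MC; [case: (size p) szp E => [|[]] | exists d, M].
Qed.

Lemma monic_closed_roots (F : closedFieldType) (p : {poly F}) :
  p \is monic -> exists r : seq F, p = \prod_(z <- r) ('X - z%:P).
Proof.
move=> /monicP pm; have [r rE] := closed_field_poly_normal p.
by exists r; rewrite {1}rE pm scale1r.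
Qed.

(** * Elimination of an element with a monic minimal polynomial *)

Section MonicStep.
Variables (A : comNzRingType) (k : {rmorphism K -> A}) (psi : {rmorphism A -> Om}).
Hypothesis psik : forall x, psi (k x) = iota x.
Variables (b : Om) (p : {poly A}).
Hypotheses (pm : p \is monic) (pb : ev psi b p = 0).
Hypothesis p_min : forall q, ev psi b q = 0 -> (size q < size p)%N -> map_poly psi q = 0.

Lemma minimal_rmodp q : ev psi b q = 0 -> map_poly psi (Pdiv.Ring.rmodp q p) = 0.
Proof.
move=> qb; apply: p_min; last by rewrite Pdiv.Ring.ltn_rmodpN0 ?monic_neq0.
have := congr1 (ev psi b) (Pdiv.RingMonic.rdivp_eq pm q).
by rewrite rmorphD rmorphM /= pb mulr0 add0r qb.
Qed.

Lemma minimal_conjugate (r : seq Om) q z : map_poly psi p = \prod_(y <- r) ('X - y%:P) ->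
  ev psi b q = 0 -> z \in r -> (map_poly psi q).[z] = 0.
Proof.
move=> pE /minimal_rmodp q0 zr.
rewrite (Pdiv.RingMonic.rdivp_eq pm q) rmorphD rmorphM /= q0 addr0 pE.
by rewrite hornerM [X in _ * X](rootP _) ?mulr0 // root_prod_XsubC.
Qed.

(* The conjugates of [H(b)] are nonzero: the lowest nonzero coefficient of the
   characteristic polynomial of [H(b)] makes [H] invertible modulo [p]. *)
Lemma conjugate_neq0 d (M : 'M[A]_d.+1) (r : seq Om) H z : char_poly M = p ->
  map_poly psi p = \prod_(y <- r) ('X - y%:P) ->
  ev psi b H != 0 -> z \in r -> (map_poly psi H).[z] != 0.
Proof.
move=> ME pE Hb zr; pose P := pencil M H 1.
have br : b \in r by rewrite -root_prod_XsubC -pE; apply/rootP.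
have PE : map_poly psi P = \prod_(y <- r) ('X - (map_poly psi H).[y]%:P).
  rewrite map_pencil rmorph1 (@pencil_prod _ _ _ r) -?map_char_poly ?ME //.
  by apply: eq_bigr => y _; rewrite hornerC scale1r.
have P0 : exists j, psi P`_j != 0.
  exists (size (map_poly psi P)).-1; rewrite -coef_map -lead_coefE.
  by rewrite PE (monicP (monic_prod_XsubC _ _ _)) oner_eq0.
case: (ex_minnP P0) => j Pj jmin; pose Q := drop_poly j P.
have PQ : map_poly psi P = map_poly psi Q * 'X^j.
  rewrite -{1}(poly_take_drop j P) rmorphD rmorphM /= map_polyXn.
  suff -> : map_poly psi (take_poly j P) = 0 by rewrite add0r.
  apply/polyP => i; rewrite coef_map coef_take_poly coef0.
  case: ltnP => ij; last exact: raddf0.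
  by apply/eqP; apply: contraTT ij => /jmin; rewrite -leqNgt.
have Q0 : (map_poly psi Q).[0] != 0.
  by rewrite horner_coef0 coef_map coef_drop_poly add0n.
have QH y : (map_poly psi (Q \Po H)).[y] = (map_poly psi Q).[(map_poly psi H).[y]].
  by rewrite map_comp_poly horner_comp.
have QHb : ev psi b (Q \Po H) = 0.
  rewrite evE QH; have /rootP : root (map_poly psi P) (map_poly psi H).[b].
    rewrite PE -(big_map (fun y => (map_poly psi H).[y]) predT (fun y => 'X - y%:P)).
    by rewrite root_prod_XsubC map_f.
  rewrite PQ hornerM hornerXn => /eqP; rewrite mulf_eq0 => /orP[/eqP //|].
  by rewrite expf_eq0 => /andP[_ /eqP Hb0]; rewrite evE Hb0 eqxx in Hb.
have := minimal_conjugate pE QHb zr; rewrite QH => Qz.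
by apply: contra Q0 => /eqP Hz; rewrite -[in X in _ == X]Qz Hz.
Qed.

(** Each parameter t yields some root of [p], but one root has to serve all numerators. By the
    pigeonhole principle one root is good for many t, and interpolation then recovers the
    integrality of each G_j / H there. Equations are replaced by their remainders modulo [p], whose
    coefficients vanish under [psi] by minimality. *)
Lemma monic_eliminable : eliminable k psi b.
Proof.
move=> [E Q] [/= Eb Qb].
have szp : (1 < size p)%N.
  rewrite ltnNge; apply/negP => /size1_polyC pC; move: pb pm.
  by rewrite pC evE map_polyC hornerC monicE lead_coefC /= => p0 /eqP p1;
     move: p0; rewrite p1 rmorph1 => /eqP; rewrite oner_eq0.
have [d [M ME]] := exists_char_poly pm szp.
have [r rE] := monic_closed_roots (monic_map psi pm).
have br : b \in r by rewrite -root_prod_XsubC -rE; apply/rootP.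
have [H [G HG]] := common_denominator Q.
have [/(_ Qb)[Hb Gb] _] := HG _ _ vW (ev psi b).
pose N := size G; pose Gt t := \sum_(j < N) (k t ^+ j) *: G`_j.
pose P t := pencil M (Gt t) H.
have Pmap (F : closedFieldType) (f : {rmorphism A -> F}) (s : seq F) t :
    map_poly f p = \prod_(z <- s) ('X - z%:P) ->
    map_poly f (P t) = \prod_(z <- s) ((map_poly f H).[z] *: 'X - ((map_poly f (Gt t)).[z])%:P).
  by move=> sE; rewrite map_pencil (@pencil_prod _ _ _ s) // -map_char_poly ME.
have GtE (F : closedFieldType) (f : {rmorphism A -> F}) t z :
    (map_poly f (Gt t)).[z] = \sum_(j < N) f (k t) ^+ j * (map_poly f G`_j).[z].
  rewrite rmorph_sum horner_sum; apply: eq_bigr => j _.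
  by rewrite /= map_polyZ hornerZ rmorphXn.
have /choice[c Hc] t : exists i, O t ->
    psi (P t)`_i.+1 != 0 /\ W (psi (P t)`_0 / psi (P t)`_i.+1).
  have [Ot|nOt] := pselect (O t); last by exists 0%N.
  have Hz z : z \in r -> (map_poly psi H).[z] != 0 by apply: conjugate_neq0 ME rE Hb.
  have P0 : map_poly psi (P t) != 0.
    rewrite (Pmap _ _ _ _ rE) prodf_seq_neq0; apply/allP => z zr; apply/implyP => _.
    apply: contraTneq (Hz z zr) => /(congr1 (fun q : {poly Om} => q`_1)).
    by rewrite coefB coefZ coefX coefC coef0 /= subr0 mulr1 => ->; rewrite eqxx.
  have Px : root (map_poly psi (P t)) ((map_poly psi (Gt t)).[b] / (map_poly psi H).[b]).
    apply/rootP; rewrite (Pmap _ _ _ _ rE) horner_prod (big_rem b) //= hornerD hornerN hornerZ hornerX hornerC mulrCA.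
    by rewrite divff ?mulr1 ?subrr ?mul0r //; exact: Hb.
  have [|i] := valring_coef_root vW P0 Px; last by rewrite !coef_map; exists i.
  rewrite GtE mulr_suml; apply: valring_sum => // j _; rewrite -mulrA psik.
  apply: valringM => //; first by apply: valringX => //; exact: iotaW.
  by apply: Gb; rewrite mem_nth.
(* With [d.+1] roots, this many parameters leave some root with at least [N.+1] good ones.
   Interpolation takes [N]; the additional one keeps the list nonempty for [N = 0], when it still
   has to show that [H] does not vanish at the root. *)
have [Th [szTh OTh pTh]] := valring_separated vO (d.+1 * N.+1).+1.
exists (flatten [seq Pdiv.Ring.rmodp e p : seq A | e <- E],
  [seq ((P t)`_0, (P t)`_(c t).+1) | t <- Th]).
  split=> /= [a|_ /mapP[t tTh ->]].
    case/flatten_mapP => e eE ae; have := minimal_rmodp (Eb e eE).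
    move/(congr1 (fun q : {poly Om} => q`_(index a (Pdiv.Ring.rmodp e p)))).
    by rewrite coef_map coef0 nth_index.
  by case: (Hc t (OTh t tTh)).
move=> phi phik [/= EA QA].
have [s sE] := monic_closed_roots (monic_map phi pm).
have szs : size s = d.+1.
  by apply: succn_inj; rewrite -(size_prod_XsubC s id) -sE -ME map_char_poly size_char_poly.
pose good z t := `[< admissible O (map_poly phi (Gt t)).[z] (map_poly phi H).[z] >].
have [||z zs zN] := @pigeonhole_filter _ _ good s Th N.+1; first by rewrite szs szTh.
  move=> t tTh; have [P1 P2] := QA _ (map_f _ tTh).
  move: P1 P2; rewrite -!coef_map !(Pmap _ _ _ _ sE) => P1 P2.
  have [z [zs Hz Wz]] := valring_slope vO P1 P2.
  by exists z => //; apply/asboolP.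
exists z; split=> /=.
  move=> e eE; rewrite evE (Pdiv.RingMonic.rdivp_eq pm e) rmorphD rmorphM /= sE.
  rewrite hornerD hornerM [X in _ * X](rootP _) ?root_prod_XsubC // mulr0 add0r.
  suff -> : map_poly phi (Pdiv.Ring.rmodp e p) = 0 by rewrite horner0.
  apply/polyP => i; rewrite coef_map coef0.
  have [ie|ie] := ltnP i (size (Pdiv.Ring.rmodp e p)); last by rewrite nth_default // raddf0.
  by apply: EA; apply/flatten_mapP; exists e => //; rewrite mem_nth.
have [_ HGphi] := HG _ _ vO (ev phi z); apply: HGphi.
set Th' := seq.filter (good z) Th in zN.
have goodTh t : t \in Th' -> t \in Th /\ admissible O (map_poly phi (Gt t)).[z] (map_poly phi H).[z].
  by rewrite mem_filter => /andP[/asboolP].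
have Hz : (map_poly phi H).[z] != 0.
  by case: Th' zN goodTh => // t Th' _ /(_ t (mem_head _ _))[_ []].
split=> // g gG; pose Y := \poly_(j < N) ((map_poly phi G`_j).[z] / (map_poly phi H).[z]).
have OY : forall i, O Y`_i.
  apply: (valring_interpolation vO (s := Th')).
  - by rewrite (leq_trans (size_poly _ _)) // ltnW.
  - by move=> t /goodTh[/OTh].
  - exact: pairwise_filter.
  - move=> t /goodTh[_ [_]]; rewrite GtE [Y.[t]]horner_poly mulr_suml.
    by under eq_bigr do rewrite phik -mulrA mulrC.
have := OY (index g G); rewrite coef_poly index_mem gG nth_index //.
Qed.

End MonicStep.
End Elimination.

Definition map_conditions (A B : Type) (t : A -> B) (D : conditions A) : conditions B :=
  (map t D.1, [seq (t q.1, t q.2) | q <- D.2]).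

Definition terms (A : Type) (D : conditions A) : seq A :=
  D.1 ++ [seq q.1 | q <- D.2] ++ [seq q.2 | q <- D.2].

(** A common nonzero factor affects neither vanishing nor quotients. *)
Lemma sat_map (A B : eqType) (F : fieldType) (W : F -> Prop) (t : A -> B)
    (f : A -> F) (g : B -> F) (c : F) (D : conditions A) : c != 0 ->
  (forall x, x \in terms D -> g (t x) = c * f x) ->
  sat W g (map_conditions t D) <-> sat W f D.
Proof.
case: D => E Q c0 /= gt; have adm q : q \in Q ->
    admissible W (g (t q.1)) (g (t q.2)) <-> admissible W (f q.1) (f q.2).
  move=> qQ; rewrite !gt ?mem_cat ?(map_f fst qQ) ?(map_f snd qQ) ?orbT //.
  by rewrite /admissible mulf_eq0 negb_or c0 -mulf_div divff // mul1r.
split=> -[/= H1 H2]; split=> /=.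
- move=> e eE; apply: (mulfI c0); rewrite mulr0 -gt ?mem_cat ?eE //.
  by apply: H1; rewrite map_f.
- by move=> q qQ; apply/(adm q qQ)/(H2 (t q.1, t q.2))/mapP; exists q.
- by move=> _ /mapP[e eE ->]; rewrite gt ?mem_cat ?eE // H1 ?mulr0.
- by move=> _ /mapP[q qQ ->]; apply/adm => //; exact: H2.
Qed.

(** Variable 0 is the innermost one. The recursion changes the base ring, which lets an induction on
    [n] eliminate the outer variables over [{poly A}]. *)
Fixpoint mvpoly (n : nat) (A : comNzRingType) : comNzRingType :=
  if n is m.+1 then mvpoly m {poly A} else A.

Fixpoint mvconst (n : nat) : forall A : comNzRingType, {rmorphism A -> mvpoly n A} :=
  if n is m.+1 return forall A : comNzRingType, {rmorphism A -> mvpoly n A}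
  then fun A => (mvconst m {poly A} \o polyC) : {rmorphism A -> mvpoly m {poly A}}
  else fun A => idfun : {rmorphism A -> A}.

Fixpoint mvvar (n : nat) : forall A : comNzRingType, nat -> mvpoly n A :=
  if n is m.+1 return forall A : comNzRingType, nat -> mvpoly n A
  then fun A i => if i is j.+1 then mvvar m {poly A} j else mvconst m {poly A} 'X
  else fun A i => 0.

Fixpoint mvev (F : comNzRingType) (n : nat) :
    forall A : comNzRingType, {rmorphism A -> F} -> (nat -> F) -> {rmorphism mvpoly n A -> F} :=
  if n is m.+1 return forall A : comNzRingType,
    {rmorphism A -> F} -> (nat -> F) -> {rmorphism mvpoly n A -> F}
  then fun A f b => mvev m (ev f (b 0%N)) (b \o succn)
  else fun A f b => f.

Lemma mvev_const (F : comNzRingType) n (A : comNzRingType) (f : {rmorphism A -> F}) b a :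
  mvev n f b (mvconst n A a) = f a.
Proof.
elim: n A f b a => [|n IHn] A f b a //=.
by rewrite IHn /= evE map_polyC hornerC.
Qed.

Lemma mvev_var (F : comNzRingType) n (A : comNzRingType) (f : {rmorphism A -> F}) b i :
  (i < n)%N -> mvev n f b (mvvar n A i) = b i.
Proof.
elim: n A f b i => [|n IHn] A f b [|i] //= ilt; last by rewrite IHn.
by rewrite mvev_const /= evE map_polyX hornerX.
Qed.

Lemma mvev_ext (F : comNzRingType) n (A : comNzRingType) (f f' : {rmorphism A -> F}) b b' :
  f =1 f' -> b =1 b' -> mvev n f b =1 mvev n f' b'.
Proof.
elim: n A f f' b b' => [|n IHn] A f f' b b' ff' bb' //=.
by apply: IHn => [p|i] /=; rewrite ?evE ?bb' // (eq_map_poly ff').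
Qed.

Lemma rmorph_mvev (F G : comNzRingType) (g : {rmorphism F -> G}) n (A : comNzRingType)
    (f : {rmorphism A -> F}) b p :
  g (mvev n f b p) = mvev n (g \o f) (g \o b) p.
Proof.
elim: n A f b p => [|n IHn] A f b p //=; rewrite IHn.
by apply: mvev_ext => // q /=; rewrite !evE map_poly_comp horner_map.
Qed.

Lemma size_map_le (A B : nzRingType) (f : {rmorphism A -> B}) (p : {poly A}) m :
  (size p <= m)%N -> (size (map_poly f p) <= m)%N.
Proof. exact/leq_trans/size_poly. Qed.

(** * Algebraic elements in general, and several variables *)

Section AlgebraicStep.
Variables (K Om : closedFieldType) (O : K -> Prop) (W : Om -> Prop).
Variables (vO : valring O) (vW : valring W) (iota : {rmorphism K -> Om}).
Hypothesis iotaW : forall x, O x -> W (iota x).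

(** [t f] is a^m f(X / a), where m bounds the sizes of all terms: its value at a b is a^m f(b), with
    the same factor a^m for every term. *)
Lemma scale_eliminable (A : comNzRingType) (k : {rmorphism K -> A})
    (psi : {rmorphism A -> Om}) a b : psi a != 0 ->
  eliminable O W k psi (psi a * b) -> eliminable O W k psi b.
Proof.
move=> a0 elim_ab D Db; pose m := \max_(f <- terms D) size f.
pose t (f : {poly A}) := \poly_(i < m) (f`_i * a ^+ (m - i)).
have tE (F : fieldType) (f : {rmorphism A -> F}) c p : p \in terms D ->
    ev f (f a * c) (t p) = f a ^+ m * ev f c p.
  move=> pD; have szp : (size p <= m)%N by rewrite /m; exact: leq_bigmax_seq.
  rewrite !evE (@horner_coef_wide _ m) ?size_map_le ?size_poly //.
  rewrite (@horner_coef_wide _ m (map_poly f p)) ?size_map_le //.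
  rewrite mulr_sumr; apply: eq_bigr => i _.
  rewrite !coef_map coef_poly ltn_ord /= rmorphM rmorphXn exprMn.
  rewrite (_ : f a ^+ m = f a ^+ (m - i) * f a ^+ i); first by ring.
  by rewrite -exprD subnK // ltnW.
have [|D' D'psi HD'] := elim_ab (map_conditions t D).
  apply/(@sat_map _ _ _ _ t (ev psi b) _ (psi a ^+ m) D) => //; first by rewrite expf_neq0.
  by move=> p; exact: tE.
(* The pair [(0, a)] expresses a != 0, since 0 / a is integral. It permits the division of [tau] by
   [phi a]. *)
exists (join_conditions D' ([::], [:: (0, a)])).
  apply/sat_join; split=> //; split=> // q; rewrite inE => /eqP -> /=.
  by split=> //; rewrite rmorph0 mul0r; exact: valring0.
move=> phi phik /sat_join[/HD'[//|tau Htau] [_ /(_ (0, a) (mem_head _ _))[/= fa0 _]]].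
exists (tau / phi a); move: Htau.
rewrite -{1}(divfK fa0 tau) [_ / _ * _]mulrC.
have [|//] := @sat_map _ _ _ O t (ev phi (tau / phi a)) (ev phi (phi a * (tau / phi a)))
  (phi a ^+ m) D (expf_neq0 _ fa0).
by move=> p; exact: tE.
Qed.

Definition algebraic (A : comNzRingType) (psi : {rmorphism A -> Om}) (b : Om) :=
  exists q : {poly A}, map_poly psi q != 0 /\ ev psi b q = 0.

(** If a is the leading coefficient of a minimal relation for b, then a b has a monic minimal
    relation. *)
Lemma algebraic_eliminable (A : comNzRingType) (k : {rmorphism K -> A})
    (psi : {rmorphism A -> Om}) b : (forall x, psi (k x) = iota x) ->
  algebraic psi b -> eliminable O W k psi b.
Proof.
move=> psik [q0 [q0N0 q0b]].
have exq : exists n, `[< exists2 q, map_poly psi q != 0 /\ ev psi b q = 0 &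
    size (map_poly psi q) = n >].
  by exists (size (map_poly psi q0)); apply/asboolP; exists q0.
case: (ex_minnP exq) => n /asboolP[q [qN0 qb] szq] n_min.
have {}n_min q' : ev psi b q' = 0 -> (size (map_poly psi q') < n)%N -> map_poly psi q' = 0.
  move=> q'b; apply: contraTeq => q'0; rewrite -leqNgt; apply: n_min.
  by apply/asboolP; exists q'.
have n0 : (1 < n)%N.
  rewrite -szq ltnNge; apply/negP => /size1_polyC qC; case/eqP: qN0.
  by move: qb; rewrite evE qC hornerC => ->.
pose d := n.-1; have dE : n = d.+1 by rewrite /d prednK // ltnW.
have d0 : (0 < d)%N by rewrite -ltnS -dE.
pose a := q`_d; have a0 : psi a != 0.
  by rewrite -coef_map -[d]/(d.+1.-1) -dE -szq -lead_coefE lead_coef_eq0.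
apply: (scale_eliminable a0).
(* This is a^(d-1) q(X / a), without the coefficients of [q] of degree greater than d, which are in
   the kernel of [psi]. *)
pose p : {poly A} := 'X^d + \poly_(i < d) (q`_i * a ^+ (d.-1 - i)).
have szp : size p = d.+1.
  by rewrite size_polyDl size_polyXn // ltnS size_poly.
have pm : p \is monic.
  by rewrite monicE lead_coefDl ?lead_coefXn // size_polyXn ltnS size_poly.
apply: (monic_eliminable vO vW iotaW psik pm).
- have qE : ev psi b q = \sum_(i < d.+1) psi q`_i * b ^+ i.
    rewrite evE (@horner_coef_wide _ d.+1) ?szq ?dE //.
    by apply: eq_bigr => i _; rewrite coef_map.
  have := congr1 ( *%R (psi a ^+ d.-1)) qb; rewrite mulr0 => <-.
  rewrite qE big_ord_recr /= mulrDr addrC rmorphD /=; congr (_ + _).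
    by rewrite evE map_polyXn hornerXn exprMn -{1}(prednK d0) exprSr mulrA.
  rewrite evE (@horner_coef_wide _ d) ?size_map_le ?size_poly //.
  rewrite mulr_sumr; apply: eq_bigr => i _.
  rewrite coef_map coef_poly ltn_ord /= rmorphM rmorphXn exprMn.
  have id1 : (i <= d.-1)%N by rewrite -ltnS prednK.
  rewrite (_ : psi a ^+ d.-1 = psi a ^+ (d.-1 - i) * psi a ^+ i); first by ring.
  by rewrite -exprD subnK.
- move=> q' q'b szq'; pose q'' := \poly_(i < d) (q'`_i * a ^+ i).
  have q''0 : map_poly psi q'' = 0.
    apply: n_min; last by rewrite dE ltnS size_map_le ?size_poly.
    rewrite -q'b !evE (@horner_coef_wide _ d) ?size_map_le ?size_poly //.
    rewrite szp ltnS in szq'.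
    rewrite (@horner_coef_wide _ d (map_poly psi q')) ?size_map_le //.
    apply: eq_bigr => i _.
    by rewrite !coef_map coef_poly ltn_ord /= rmorphM rmorphXn exprMn mulrA.
  apply/polyP => i; rewrite coef_map coef0 /=.
  have [id|di] := ltnP i d; last first.
    by rewrite nth_default ?raddf0 //; rewrite szp ltnS in szq'; apply: leq_trans di.
  move/(congr1 (fun r : {poly Om} => r`_i)): q''0.
  rewrite coef_map coef_poly id coef0 /= rmorphM rmorphXn => /eqP.
  by rewrite mulf_eq0 expf_eq0 (negPf a0) andbF orbF => /eqP.
Qed.

(** The outer variables are eliminated while the inner ones are still in the coefficient ring,
    whence the assumption over every ring [B] through which [psi] factors. *)
Lemma mv_eliminable n (A : comNzRingType) (k : {rmorphism K -> A})
    (psi : {rmorphism A -> Om}) (b : nat -> Om) :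
  (forall x, psi (k x) = iota x) ->
  (forall (B : comNzRingType) (j : {rmorphism A -> B}) (kB : {rmorphism K -> B})
     (psiB : {rmorphism B -> Om}), (forall x, psiB (j x) = psi x) ->
     (forall x, psiB (kB x) = iota x) ->
     forall i, (i < n)%N -> eliminable O W kB psiB (b i)) ->
  forall D, sat W (mvev n psi b) D ->
  exists2 D', sat W psi D' & forall phi : {rmorphism A -> K},
    (forall x, phi (k x) = x) -> sat O phi D' ->
    exists c : nat -> K, sat O (mvev n phi c) D.
Proof.
elim: n A k psi b => [|n IHn] A k psi b psik elimb D Db.
  by exists D => // phi _ Dphi; exists (fun _ => 0).
pose kB : {rmorphism K -> {poly A}} := polyC \o k.
pose psiB : {rmorphism {poly A} -> Om} := ev psi (b 0%N).
have kBE x : psiB (kB x) = iota x by rewrite /= evE map_polyC hornerC /= psik.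
have [|D' D'b HD'] := IHn {poly A} kB psiB (b \o succn) kBE _ D Db.
  move=> B j kB' psiB' psiB'E psik' i ilt.
  apply: (elimb B (j \o polyC) kB' psiB') => //.
  by move=> x; rewrite /= psiB'E /= evE map_polyC hornerC.
have [||D'' D''b HD''] := elimb A idfun k psi _ psik 0%N _ D' D'b => //.
exists D'' => // phi phik /HD''[//|tau tauP].
have [||c cP] := HD' (ev phi tau).
- by move=> x; rewrite /= evE map_polyC hornerC /= phik.
- exact: tauP.
- by exists (fun i => if i is j.+1 then c j else tau).
Qed.

End AlgebraicStep.

(* A tuple [(u, w, m, n)] stands for the monomial [(u / w) z^(m - n)]. *)
Definition integral_at (A : Type) (F : fieldType) (W : F -> Prop) (f : A -> F) z
    (M : A * A * nat * nat) :=
  f M.1.1.2 != 0 /\ W (f M.1.1.1 / f M.1.1.2 * (z ^+ M.1.2 / z ^+ M.2)).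

Lemma closed_root_exp (K : closedFieldType) (x : K) n : exists y, y ^+ n.+1 = x.
Proof.
pose p : {poly K} := 'X^(n.+1) - x%:P.
have /closed_rootP[y] : size p != 1%N by rewrite /p size_XnsubC.
by rewrite /root /p hornerD hornerN hornerXn hornerC subr_eq0 => /eqP; exists y.
Qed.

(** * Monomial inequalities in one unknown *)

Section Monomials.
Variables (K Om : closedFieldType) (O : K -> Prop) (W : Om -> Prop).
Variables (vO : valring O) (vW : valring W).

(* Fourier-Motzkin elimination of the value of z. *)
Lemma monomial_solution (A : comNzRingType) (up dn : seq (A * A * nat)) (f : A -> K) :
  (forall M, M \in up ++ dn -> f M.1.2 != 0) ->
  (forall M M', M \in up -> M' \in dn ->
     O ((f M.1.1 / f M.1.2) ^+ M'.2.+1 * (f M'.1.1 / f M'.1.2) ^+ M.2.+1)) ->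
  exists z, [/\ z != 0,
    forall M, M \in up -> O (f M.1.1 / f M.1.2 * z ^+ M.2.+1) &
    forall M, M \in dn -> O (f M.1.1 / f M.1.2 / z ^+ M.2.+1)].
Proof.
move=> den0 updn; pose q (M : A * A * nat) := f M.1.1 / f M.1.2.
have O0 : O 0 := valring0 vO.
(* Taking roots in K turns bounds on multiples of v(z) into bounds on v(z), among which the tightest
   can be chosen. *)
have /choice[r Hr] (M : A * A * nat) : exists y, y ^+ M.2.+1 = q M by exact: closed_root_exp.
have r0 M : (r M == 0) = (q M == 0) by rewrite -Hr expf_eq0.
have [|up0] := pselect (exists2 x, x \in map r up & x != 0).
  move/(valring_min vO) => [_ [/mapP[M Mup ->] rM Hmin]].
  exists (r M)^-1; split; first by rewrite invr_eq0.
    move=> M' M'up; rewrite -[_ / _]/(q M') -Hr -exprMn; apply: valringX => //.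
    by apply: Hmin; rewrite map_f.
  move=> M' M'dn; rewrite -[f _ / _]/(q M') exprVn invrK.
  apply: (@valring_root _ _ vO _ M.2); rewrite exprMn exprAC Hr mulrC.
  exact: updn.
have q_up M : M \in up -> q M = 0.
  move=> Mup; apply/eqP; rewrite -r0; apply: contra_notT up0 => rM.
  by exists (r M) => //; rewrite map_f.
have [|dn0] := pselect (exists2 x, x \in map r dn & x != 0).
  move/(valring_min vO) => [_ [/mapP[M Mdn ->] rM Hmin]].
  exists (r M); split=> // M' M'in; first by rewrite -[_ / _]/(q M') q_up ?mul0r.
  rewrite -[f _ / _]/(q M') -Hr -exprVn -exprMn; apply: valringX => //.
  by apply: Hmin; rewrite map_f.
exists 1; split=> [|M Mup|M Mdn]; first exact: oner_neq0.
  by rewrite -[_ / _]/(q M) q_up ?mul0r.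
suff qM : q M = 0 by rewrite -[f _ / _]/(q M) qM mul0r.
apply/eqP; rewrite -r0; apply: contra_notT dn0 => rM.
by exists (r M) => //; rewrite map_f.
Qed.

(** A monomial with positive and one with negative exponent contribute the product of powers in
    which z cancels; monomials of exponent 0 contribute their coefficient. *)
Lemma monomials_eliminable (A : comNzRingType) (psi : {rmorphism A -> Om}) z
    (Ms : seq (A * A * nat * nat)) : z != 0 ->
  (forall M, M \in Ms -> integral_at W psi z M) ->
  exists2 D, sat W psi D & forall phi : {rmorphism A -> K}, sat O phi D ->
    exists2 z', z' != 0 & forall M, M \in Ms -> integral_at O phi z' M.
Proof.
move=> z0 HMs.
(* Exponents are stored minus one, so that every stored number stands for a positive exponent. *)
pose up := [seq (M.1.1, (M.1.2 - M.2).-1) | M <- Ms & (M.2 < M.1.2)%N].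
pose dn := [seq (M.1.1, (M.2 - M.1.2).-1) | M <- Ms & (M.1.2 < M.2)%N].
pose pair (M M' : A * A * nat) := (M.1.1 ^+ M'.2.+1 * M'.1.1 ^+ M.2.+1,
  M.1.2 ^+ M'.2.+1 * M'.1.2 ^+ M.2.+1).
have expE (F : fieldType) (x : F) m n : x != 0 -> (n < m)%N ->
    x ^+ m / x ^+ n = x ^+ (m - n).-1.+1.
  move=> x0 nm; rewrite prednK ?subn_gt0 // -[in x ^+ m](subnK (ltnW nm)) exprD.
  by rewrite mulfK // expf_neq0.
exists ([::], [seq (0, M.1.1.2) | M <- Ms] ++
    [seq M.1.1 | M <- Ms & M.1.2 == M.2] ++
    [seq pair M M' | M <- up, M' <- dn]).
  split=> //= q; rewrite !mem_cat => /or3P[/mapP[M MMs ->]|/mapP[M]|].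
  - by have [M0 _] := HMs M MMs; split=> //=; rewrite rmorph0 mul0r; exact: valring0.
  - rewrite mem_filter => /andP[/eqP ME MMs] ->; have [M0 /=] := HMs M MMs.
    by rewrite ME divff ?expf_neq0 // mulr1; split.
  - case/allpairsP => -[_ _] [/mapP[M MMs ->] /mapP[M' M'Ms ->] ->] /=.
    move: MMs M'Ms; rewrite !mem_filter => /andP[Mlt /HMs[/= M0 WM]] /andP[M'lt /HMs[/= M'0 WM']].
    split; first by rewrite !rmorphM !rmorphXn mulf_neq0 ?expf_neq0.
    move: WM; rewrite expE // => /(valringX vW (M'.2 - M'.1.2).-1.+1) WM.
    move: WM'; rewrite -[_ / _ ^+ M'.2]invf_div expE // => /(valringX vW (M.1.2 - M.2).-1.+1) WM'.
    have := valringM vW WM WM'; move: (_.-1) (_.-1) => a c.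
    rewrite [(_ * z ^+ _) ^+ _]exprMn [(_ / z ^+ _) ^+ _]exprMn.
    rewrite [(z ^+ _)^-1 ^+ _]exprVn [z ^+ _ ^+ a.+1]exprAC mulrACA divff ?expf_neq0 // mulr1.
    by rewrite !rmorphM !rmorphXn invfM mulrACA -!exprVn -!exprMn.
move=> phi [_ /= HD].
have D1 M : M \in Ms -> phi M.1.1.2 != 0.
  move=> MMs; have [] // := HD (0, M.1.1.2); rewrite !mem_cat; apply/orP; left.
  by apply/mapP; exists M.
have [||z' [z'0 Hup Hdn]] := @monomial_solution A up dn phi.
- move=> M; rewrite mem_cat => /orP[] /mapP[M']; rewrite mem_filter => /andP[_ M'Ms] -> /=;
  exact: D1.
- move=> M M' Mup M'dn; have [|/= _] := HD (pair M M').
    by rewrite !mem_cat; apply/or3P/Or33; rewrite allpairs_f.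
  by rewrite !rmorphM !rmorphXn /= invfM mulrACA -!exprVn -!exprMn.
exists z' => // M MMs; split; first exact: D1.
rewrite /=; case: (ltngtP M.1.2 M.2) => Mlt.
- rewrite -[X in _ * X]invf_div expE //; apply: (Hdn (M.1.1, (M.2 - M.1.2).-1)).
  by apply/mapP; exists M; rewrite // mem_filter Mlt.
- rewrite expE //; apply: (Hup (M.1.1, (M.1.2 - M.2).-1)).
  by apply/mapP; exists M; rewrite // mem_filter Mlt.
- rewrite Mlt divff ?expf_neq0 // mulr1; have [] // := HD M.1.1.
  rewrite !mem_cat; apply/or3P/Or32; apply/mapP; exists M => //.
  by rewrite mem_filter Mlt eqxx.
Qed.

End Monomials.

(* [center] is a point nearest to t among the roots, so that [t - a] has the value
   of [center - a] or of [z], according to [near]. *)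
Section SplitPolynomials.
Variables (A : comNzRingType) (F : fieldType) (W : F -> Prop) (vW : valring W).
Variables (f : {rmorphism A -> F}) (t z : F) (center : A) (near : pred A).

Definition dominant_monomial (c : A) (l : seq A) : A * nat :=
  (c * \prod_(a <- l | near a) (center - a), count (predC near) l).

(** Replacing each factor [t - f a] by its dominant term changes both polynomials by units only. *)
Lemma split_admissible (g h : {poly A}) cg ch lg lh : z != 0 ->
  (forall a, a \in lg ++ lh ->
     vunit W ((t - f a) / (if near a then f (center - a) else z))) ->
  map_poly f g = f cg *: \prod_(a <- lg) ('X - (f a)%:P) ->
  map_poly f h = f ch *: \prod_(a <- lh) ('X - (f a)%:P) ->
  admissible W (ev f t g) (ev f t h) <->
  integral_at W f z ((dominant_monomial cg lg).1, (dominant_monomial ch lh).1,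
    (dominant_monomial cg lg).2, (dominant_monomial ch lh).2).
Proof.
move=> z0 uni gE hE.
have dom p c l : {subset l <= lg ++ lh} ->
    map_poly f p = f c *: \prod_(a <- l) ('X - (f a)%:P) ->
    exists2 e, vunit W e & ev f t p =
      e * (f (dominant_monomial c l).1 * z ^+ (dominant_monomial c l).2).
  move=> sl pE; exists (\prod_(a <- l) ((t - f a) / (if near a then f (center - a) else z))).
    by rewrite big_seq; apply: vunit_prod => // a /sl; exact: uni.
  rewrite evE pE hornerZ horner_prod rmorphM rmorph_prod /=.
  have -> : z ^+ count (predC near) l = \prod_(a <- l | ~~ near a) z.
    by rewrite big_const_seq iter_mulr_1.
  rewrite -[f c * _ * _]mulrA mulrCA; congr (_ * _).
  rewrite (big_mkcond near) (big_mkcond (fun a => ~~ near a)) -!big_split /=.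
  rewrite [LHS]big_seq [RHS]big_seq; apply: eq_bigr => a /sl/uni.
  rewrite hornerD hornerN hornerX hornerC; case: (near a) => -[].
    by rewrite mulf_eq0 invr_eq0 negb_or => /andP[_ d0] _ _; rewrite mulr1 divfK.
  by rewrite mul1r divfK.
have [|e [e0 We WVe] ->] := dom g cg lg _ gE; first by move=> a; rewrite mem_cat => ->.
have [|e' [e'0 We' WVe'] ->] := dom h ch lh _ hE; first by move=> a; rewrite mem_cat => ->; rewrite orbT.
move: (dominant_monomial _ _) (dominant_monomial _ _) => [u m] [w n] /=.
rewrite /admissible /integral_at /= !mulf_eq0 (negPf e'0) /= expf_eq0 (negPf z0) andbF orbF.
have eW : W (e / e') by apply: valringM.
have eWV : W (e' / e) by apply: valringM.
rewrite -mulf_div -[X in _ * X]mulf_div; split=> -[w0 Wx]; split=> //.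
  rewrite -[X in W X]mul1r -(divff (_ : e / e' != 0)) ?mulf_neq0 ?invr_eq0 //.
  by rewrite -mulrA mulrCA invf_div; apply: valringM => //; rewrite mulrC mulrCA.
exact: valringM.
Qed.

End SplitPolynomials.

(** * Elimination of an element when all roots are available *)

Section Lifting.
Variables (K Om : closedFieldType) (O : K -> Prop) (W : Om -> Prop).
Variables (vO : valring O) (vW : valring W) (iota : {rmorphism K -> Om}).
Hypothesis iotaW : forall x, O x -> W (iota x).

Lemma split_eliminable (A : comNzRingType) (psi : {rmorphism A -> Om}) b D :
  let P := [seq q.1 | q <- D.2] ++ [seq q.2 | q <- D.2] in
  b != 0 -> (forall e, e \in D.1 -> map_poly psi e = 0) ->
  (forall p, p \in P -> exists (c : A) (l : seq A),
     map_poly psi p = psi c *: \prod_(a <- l) ('X - (psi a)%:P) /\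
     forall a, a \in l -> b != psi a) ->
  sat W (ev psi b) D ->
  exists2 D', sat W psi D' & forall phi : {rmorphism A -> K},
    sat O phi D' -> exists tau, sat O (ev phi tau) D.
Proof.
case: D => E Q /=; set P := _ ++ _ => b0 E0 Psplit [/= _ Qb].
have /choice[cl0 Hcl] (p : {poly A}) : exists cl : A * seq A, p \in P ->
    map_poly psi p = psi cl.1 *: \prod_(a <- cl.2) ('X - (psi a)%:P) /\
    forall a, a \in cl.2 -> b != psi a.
  have [/Psplit[c [l H]]|nP] := boolP (p \in P); first by exists (c, l).
  by exists (0, [::]).
pose c p := (cl0 p).1; pose l p := (cl0 p).2.
have cl p : p \in P -> map_poly psi p = psi (c p) *: \prod_(a <- l p) ('X - (psi a)%:P).
  by case/Hcl.
have bl p : p \in P -> forall a, a \in l p -> b != psi a by case/Hcl.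
(* The added 0 makes the list nonempty; b - 0 is nonzero by [b0]. *)
pose L := 0 :: flatten (map l P).
have bL a : a \in L -> b - psi a != 0.
  rewrite inE => /orP[/eqP ->|/flatten_mapP[p pP ap]]; first by rewrite rmorph0 subr0.
  by rewrite subr_eq0; exact: bl ap.
have lL p a : p \in P -> a \in l p -> a \in L.
  by move=> pP ap; rewrite inE; apply/orP; right; apply/flatten_mapP; exists p.
(* The inverse of least value belongs to a root [a0] for which the value of b - a is greatest. *)
have [|_ [/mapP[a0 oL ->] bo oP]] := @valring_min _ _ vW [seq (b - psi a)^-1 | a <- L].
  by exists (b - psi 0)^-1; rewrite ?invr_eq0 ?bL ?mem_head //= mem_head.
pose z := b - psi a0; have z0 : z != 0 by rewrite bL.
have {}oP a : a \in L -> W (z / (z + psi (a0 - a))).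
  move=> aL; have := oP _ (map_f (fun a => (b - psi a)^-1) aL); rewrite invrK mulrC.
  by rewrite rmorphB /= (_ : z + _ = b - psi a); [exact | rewrite /z; ring].
(* [near a] says v(a0 - a) <= v(z), so that a0 - a dominates in b - a = z + (a0 - a). In case of
   equality nothing cancels, because v(b - a) <= v(z) by the choice of [a0]. *)
pose near a := `[< psi (a0 - a) != 0 /\ W (z / psi (a0 - a)) >].
have psiU a : a \in L -> vunit W ((b - psi a) / (if near a then psi (a0 - a) else z)).
  move=> aL; have zd0 := bL a aL.
  have zdE : b - psi a = z + psi (a0 - a) by rewrite rmorphB /= /z; ring.
  rewrite zdE in zd0 *; have Wz := oP a aL.
  rewrite /near; move: (psi (a0 - a)) zd0 Wz => d zd0 Wz; case: asboolP => [[d0 Wd]|].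
    split; first by rewrite mulf_neq0 ?invr_eq0.
      by rewrite mulrDl divff //; apply: valringD => //; exact: valring1.
    rewrite invf_div (_ : _ / _ = 1 - z / (z + d)); last by field.
    by apply: valringB => //; exact: valring1.
  move/not_andP => d0; have Wd : W (d / z).
    case: d0 => [/negP/negPn/eqP ->|nW]; first by rewrite mul0r; exact: valring0.
    by have [//|] := valringV vW (z / d); rewrite invf_div.
  split; first by rewrite mulf_neq0 ?invr_eq0.
    by rewrite mulrDl divff //; apply: valringD => //; exact: valring1.
  by rewrite invf_div.
pose dm := dominant_monomial a0 near.
pose mon (q : {poly A} * {poly A}) : A * A * nat * nat :=
  ((dm (c q.1) (l q.1)).1, (dm (c q.2) (l q.2)).1, (dm (c q.1) (l q.1)).2, (dm (c q.2) (l q.2)).2).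
(* The last two lists record on which side of v(z) each v(a0 - a) lies, so that the dominant terms
   stay dominant after specialization. *)
pose Ms := map mon Q ++ [seq (1, a0 - a, 1%N, 0%N) | a <- L & near a]
  ++ [seq (a0 - a, 1, 0%N, 1%N) | a <- L & ~~ near a].
have QP q : q \in Q -> q.1 \in P /\ q.2 \in P.
  by move=> qQ; rewrite !mem_cat !map_f ?orbT.
have [|Dm Dm_psi HDm] := @monomials_eliminable _ _ _ _ vO vW A psi z Ms z0.
  move=> M; rewrite !mem_cat => /or3P[/mapP[q qQ ->]|/mapP[a]|/mapP[a]].
  - have [q1 q2] := QP q qQ.
    apply/(split_admissible vW z0 _ (cl _ q1) (cl _ q2)); last exact: Qb.
    by move=> a; rewrite mem_cat => /orP[]; move/lL => aL; apply: psiU; exact: aL.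
  - rewrite mem_filter => /andP[/asboolP[d0 Wd] _] -> ; split=> //=.
    by rewrite rmorph1 mul1r expr0 divr1 expr1 mulrC.
  - rewrite mem_filter => /andP[/asboolPn nd aL] ->; split=> /=.
      by rewrite rmorph1 oner_neq0.
    rewrite rmorph1 divr1 expr0 expr1 mul1r.
    have [->|d0] := eqVneq (psi (a0 - a)) 0; first by rewrite mul0r; exact: valring0.
    have [Wd|] := valringV vW (z / psi (a0 - a)); last by rewrite invf_div.
    by case: nd.
pose coefs (p : {poly A}) : seq A := p.
(* These coefficients force the equations and the factorizations of the terms to persist under
   [phi]. *)
exists (join_conditions Dm (flatten (map coefs E) ++
    flatten [seq coefs (p - c p *: \prod_(a <- l p) ('X - a%:P)) | p <- P], [::])).
  apply/sat_join; split=> //; split=> //= a; rewrite mem_cat => /orP[]/flatten_mapP[p pP ap].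
    move: (E0 p pP) => /(congr1 (fun q : {poly Om} => q`_(index a p))).
    by rewrite coef_map coef0 nth_index.
  move: ap; rewrite /coefs; set q := _ - _ => aq.
  have /(congr1 (fun r : {poly Om} => r`_(index a q))) : map_poly psi q = 0.
    rewrite /q rmorphB /= map_polyZ rmorph_prod /= cl //.
    by under [X in _ - _ *: X]eq_bigr do rewrite rmorphB /= map_polyX map_polyC; rewrite subrr.
  by rewrite coef_map coef0 nth_index.
move=> phi /sat_join[/HDm[y y0 Hy] [/= Ez _]].
have map0 (q : {poly A}) : (forall a, a \in coefs q -> phi a = 0) -> map_poly phi q = 0.
  move=> q0; apply/polyP => i; rewrite coef_map coef0 /=.
  have [iq|qi] := ltnP i (size q); last by rewrite nth_default // raddf0.
  by apply: q0; rewrite mem_nth.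
have phiE e : e \in E -> map_poly phi e = 0.
  move=> eE; apply: map0 => a ae; apply: Ez; rewrite mem_cat; apply/orP; left.
  by apply/flatten_mapP; exists e.
have phicl p : p \in P -> map_poly phi p = phi (c p) *: \prod_(a <- l p) ('X - (phi a)%:P).
  move=> pP; have /map0 : forall a, a \in coefs (p - c p *: \prod_(a <- l p) ('X - a%:P)) -> phi a = 0.
    move=> a ap; apply: Ez; rewrite mem_cat; apply/orP; right.
    by apply/flatten_mapP; exists p.
  rewrite rmorphB /= map_polyZ rmorph_prod /= => /eqP; rewrite subr_eq0 => /eqP ->.
  by under [X in _ *: X = _]eq_bigr do rewrite rmorphB /= map_polyX map_polyC.
(* The recorded inequalities are weak, so v(a0 - a) = v(y) may occur. The unit u avoids the residues
   of the -(a0 - a) / y, whence u y + (a0 - a) does not cancel. *)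
pose s := [seq - (phi (a0 - a) / y) | a <- L & `[< O (phi (a0 - a) / y) >]].
have [|u [[u0 Ou OVu] Hu]] := @valring_avoid K O vO s.
  by move=> x /mapP[a]; rewrite mem_filter => /andP[/asboolP Oa _] ->; exact: valringN.
have {}Hu a : a \in L -> O (phi (a0 - a) / y) -> vunit O (u + phi (a0 - a) / y).
  move=> aL Oa; rewrite -[_ / y]opprK; apply: Hu; apply/mapP; exists a => //.
  by rewrite mem_filter aL andbT; apply/asboolP.
exists (phi a0 + u * y); split=> /= [e eE|q qQ]; first by rewrite evE phiE // horner0.
have [q1 q2] := QP q qQ.
apply/(@split_admissible _ _ _ vO phi _ y a0 near _ _ (c q.1) (c q.2) (l q.1) (l q.2)) => //;
  try exact: phicl; last by apply: Hy; rewrite mem_cat map_f.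
have Ly a : a \in L -> vunit O ((phi a0 + u * y - phi a) / (if near a then phi (a0 - a) else y)).
  move=> aL; have -> : phi a0 + u * y - phi a = u * y + phi (a0 - a) by rewrite rmorphB; ring.
  have [na|na] := boolP (near a).
    have [|/= d0] := Hy (1, a0 - a, 1%N, 0%N).
      rewrite !mem_cat; apply/or3P/Or32/mapP; exists a => //.
      by rewrite mem_filter na.
    rewrite rmorph1 mul1r expr0 divr1 expr1 mulrC => Oyd.
    move: (phi (a0 - a)) (Hu a aL) d0 Oyd => d {}Hu d0 Oyd.
    have [Ody|nOdy] := pselect (O (d / y)).
      rewrite (_ : _ / _ = (u + d / y) * (y / d)); last by field; rewrite ?y0 ?d0.
      apply: vunitM => //; first exact: Hu.
      by split; rewrite ?mulf_neq0 ?invr_eq0 // invf_div.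
    apply: vunit_dominant => //; rewrite ?mulf_neq0 //; first by rewrite -mulrA; exact: valringM.
    move=> Oduy; apply: nOdy; rewrite (_ : _ / y = u * (d / (u * y))); first exact: valringM.
    by field; rewrite ?y0 ?u0.
  have [|/= _] := Hy (a0 - a, 1, 0%N, 1%N).
    rewrite !mem_cat; apply/or3P/Or33/mapP; exists a => //.
    by rewrite mem_filter na.
  rewrite rmorph1 divr1 expr0 expr1 mul1r => Ody.
  by rewrite mulrDl mulfK //; exact: Hu.
by move=> a; rewrite mem_cat => /orP[]; move/lL => aL; apply: Ly; exact: aL.
Qed.

End Lifting.

(** * Transcendental elements and the lifting theorem *)

Section Lifting.
Variables (K Om : closedFieldType) (O : K -> Prop) (W : Om -> Prop).
Variables (vO : valring O) (vW : valring W) (iota : {rmorphism K -> Om}).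
Hypothesis iotaW : forall x, O x -> W (iota x).

(** Transcendence makes the equations in b vanish identically and keeps b away from all roots of the
    terms. The roots are variables of [mvpoly n A]: b is eliminated over this ring, and the roots,
    being algebraic over [A], afterwards. *)
Lemma transcendental_eliminable (A : comNzRingType) (k : {rmorphism K -> A})
    (psi : {rmorphism A -> Om}) b : (forall x, psi (k x) = iota x) ->
  ~ algebraic psi b -> eliminable O W k psi b.
Proof.
move=> psik nalg D Db.
have trans q : ev psi b q = 0 -> map_poly psi q = 0.
  by move=> qb; apply: contra_notP nalg => /eqP q0; exists q.
pose P := [seq q.1 | q <- D.2] ++ [seq q.2 | q <- D.2].
have /choice[rt Hrt] (p : {poly A}) : exists r : seq Om,
    map_poly psi p = lead_coef (map_poly psi p) *: \prod_(y <- r) ('X - y%:P) /\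
    (forall y, y \in r -> root (map_poly psi p) y /\ map_poly psi p != 0).
  have [p0|p0] := eqVneq (map_poly psi p) 0.
    by exists [::]; rewrite p0 lead_coef0 scale0r; split.
  have [r rE] := closed_field_poly_normal (map_poly psi p).
  exists r; split=> // y yr; split=> //.
  by rewrite rE rootZ ?lead_coef_eq0 // root_prod_XsubC.
pose rs := undup (flatten (map rt P)); pose n := size rs.
pose psi' := mvev n psi (nth 0 rs).
pose inj := mvconst n A.
pose k' : {rmorphism K -> mvpoly n A} := inj \o k.
have k'E x : psi' (k' x) = iota x by rewrite /psi' /= mvev_const.
have rs_alg (B : comNzRingType) (j : {rmorphism A -> B}) (psiB : {rmorphism B -> Om}) :
    (forall x, psiB (j x) = psi x) -> forall i, (i < n)%N -> algebraic psiB rs`_i.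
  move=> jE i ilt; have : rs`_i \in rs by rewrite mem_nth.
  rewrite mem_undup => /flatten_mapP[p pP]; have [_ H] := Hrt p; move/H => [/rootP py p0].
  exists (map_poly j p); rewrite evE -map_poly_comp.
  by rewrite (eq_map_poly jE).
pose D1 := map_conditions (map_poly inj) D.
have evinj (F : fieldType) (f : {rmorphism A -> F}) c t p :
    ev (mvev n f c) t (map_poly inj p) = ev f t p.
  rewrite !evE -map_poly_comp; congr (_.[_]); apply: eq_map_poly => a /=.
  exact: mvev_const.
have satD1 (F : fieldType) V (f : {rmorphism A -> F}) c t :
    sat V (ev (mvev n f c) t) D1 <-> sat V (ev f t) D.
  apply: (@sat_map _ _ _ V (map_poly inj) (ev f t) _ 1); first exact: oner_neq0.
  by move=> x _; rewrite mul1r evinj.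
have mapinj p : map_poly psi' (map_poly inj p) = map_poly psi p.
  by rewrite -map_poly_comp; apply: eq_map_poly => a; exact: mvev_const.
have b0 : b != 0.
  apply/eqP => b0; have := trans 'X; rewrite evE map_polyX hornerX => /(_ b0) /eqP.
  by rewrite polyX_eq0.
have [|||D2 D2psi HD2] := @split_eliminable _ _ _ _ vO vW _ psi' b D1 b0.
- by move=> _ /mapP[e eE ->]; rewrite mapinj; apply: trans; exact: (proj1 Db).
- move=> p pP1; have [q qP ->] : exists2 q, q \in P & p = map_poly inj q.
    move: pP1; rewrite /D1 /= -!map_comp mem_cat => /orP[] /mapP[x xD ->].
      by exists x.1; rewrite // mem_cat map_f.
    by exists x.2; rewrite // mem_cat map_f ?orbT.
  have [qE Hq] := Hrt q.
  have psi'var y : y \in rt q -> psi' (mvvar n A (index y rs)) = y.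
    move=> yq; have yrs : y \in rs by rewrite mem_undup; apply/flatten_mapP; exists q.
    by rewrite /psi' mvev_var ?index_mem // nth_index.
  exists (inj q`_(size (map_poly psi q)).-1), [seq mvvar n A (index y rs) | y <- rt q].
  split=> [|_ /mapP[y yq ->]].
    rewrite mapinj [LHS]qE big_map /psi' mvev_const lead_coefE coef_map.
    congr (_ *: _); rewrite [LHS]big_seq [RHS]big_seq; apply: eq_bigr => y yq.
    by rewrite -/psi' psi'var.
  rewrite psi'var //; apply/eqP => by_; have [/rootP qy q0] := Hq y yq.
  by case/eqP: q0; apply: trans; rewrite evE by_.
- exact/satD1.
have [|D3 D3psi HD3] := @mv_eliminable _ _ O W iota n A k psi (nth 0 rs) psik _ D2 D2psi.
  move=> B j kB psiB jE kE i ilt.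
  by apply: (algebraic_eliminable vO vW iotaW kE); exact: rs_alg jE _ ilt.
exists D3 => // phi phik /HD3[//|c /HD2[tau tauP]].
by exists tau; apply/satD1; exact: tauP.
Qed.

(* Existential closedness of an algebraically closed valued field in its
   algebraically closed valued extensions. *)
Theorem valued_lifting n (b : nat -> Om) (D : conditions (mvpoly n K)) :
  (forall x, W (iota x) -> O x) ->
  sat W (mvev n iota b) D -> exists c : nat -> K, sat O (mvev n idfun c) D.
Proof.
move=> Wiota Db; pose k : {rmorphism K -> K} := idfun.
have [||D' [/= E0 Q0] HD'] := @mv_eliminable _ _ O W iota n K k iota b _ _ D Db => //.
  move=> B j kB psiB jE kE i _.
  have [alg|nalg] := pselect (algebraic psiB (b i)).
    exact: (algebraic_eliminable vO vW iotaW kE).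
  exact: (transcendental_eliminable kE).
apply: (HD' k) => //; split=> /= [e /E0 /eqP|q /Q0[]].
  by rewrite fmorph_eq0 => /eqP.
by rewrite fmorph_eq0 -fmorph_div => q0 /Wiota.
Qed.

End Lifting.

(** * Limits of points of a valued field *)

Section ValuationTheory.
Variables (R : realType) (K : fieldType) (v : valuation R K).
Implicit Types x y : K.

Lemma valuation0 : v 0 = +oo%E.
Proof. by apply/eqP; rewrite valuation_eqy. Qed.

Lemma valuation_fin x : x != 0 -> v x \is a fin_num.
Proof. by move=> x0; rewrite fin_numE valuation_neqNy valuation_eqy. Qed.

Lemma valuation1 : v 1 = 0%E.
Proof.
have := valuation_fin (oner_neq0 K); have := valuationM v 1 1; rewrite mul1r.
case: (v 1) => // a /eqP; rewrite -EFinD eqe => /eqP aE _.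
by congr (_%:E); apply: (addrI a); rewrite -aE addr0.
Qed.

Lemma valuationN1 : v (- 1) = 0%E.
Proof.
have N10 : - 1 != 0 :> K by rewrite oppr_eq0 oner_eq0.
have := valuation_fin N10; have := valuationM v (- 1) (- 1); rewrite mulrNN mulr1 valuation1.
case: (v (- 1)) => // a /eqP; rewrite -EFinD eqe => /eqP aE _; congr (_%:E); lra.
Qed.

Lemma valuationN x : v (- x) = v x.
Proof. by rewrite -mulN1r valuationM valuationN1 add0e. Qed.

Lemma valuationV x : x != 0 -> v x^-1 = (- v x)%E.
Proof.
move=> x0; have := valuationM v x x^-1; rewrite divff // valuation1.
have := valuation_fin x0; have := valuation_fin (_ : x^-1 != 0); rewrite invr_eq0 => /(_ x0).
case: (v x) => // a; case: (v x^-1) => // b _ _ /eqP; rewrite -EFinD eqe => /eqP ab.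
by congr (_%:E); lra.
Qed.

Lemma valuationB_ge x y (a : \bar R) : (a <= v x)%E -> (a <= v y)%E -> (a <= v (x - y)%R)%E.
Proof.
move=> ax ay; apply: le_trans (valuationD v x (- y)).
by rewrite le_min valuationN ax.
Qed.

Lemma valuationD_ge x y (a : \bar R) : (a <= v x)%E -> (a <= v y)%E -> (a <= v (x + y)%R)%E.
Proof. by move=> ax ay; rewrite -[y]opprK; apply: valuationB_ge; rewrite ?valuationN. Qed.

Lemma valuation_sum_ge (I : Type) (s : seq I) (P : pred I) (F : I -> K) (a : \bar R) :
  (forall i, P i -> (a <= v (F i))%E) -> (a <= v (\sum_(i <- s | P i) F i)%R)%E.
Proof.
move=> aF; elim/big_ind: _ => //; first by rewrite valuation0 leey.
by move=> x y; exact: valuationD_ge.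
Qed.

Lemma valuationX x (a : R) n : v x = a%:E -> v (x ^+ n) = (a *+ n)%:E.
Proof.
move=> xa; elim: n => [|n IHn]; first by rewrite expr0 valuation1.
by rewrite exprS valuationM xa IHn mulrS EFinD.
Qed.

Definition valuation_ring x : Prop := (0 <= v x)%E.

Lemma valuation_ring_valring : valring valuation_ring.
Proof.
split=> [|x y|x y|x]; rewrite /valuation_ring; first by rewrite valuation1.
- exact: valuationB_ge.
- by rewrite valuationM; exact: adde_ge0.
- have [->|x0] := eqVneq x 0; first by left; rewrite valuation0 leey.
  rewrite valuationV // oppe_ge0; case: (leP 0%E (v x)) => [|/ltW]; by [left|right].
Qed.

End ValuationTheory.

(* K-valued functions that are bounded along an ultrafilter, modulo those tending
   to 0: an algebraically closed extension of K, whose valuation has no infinitely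
   large or infinitesimal values. *)
Section BoundedUltrapower.
Variables (R : realType) (K : closedFieldType) (v : valuation R K).
Variables (I : pointedType) (U : set_system I) (UU : UltraFilter U).

Definition eventually_ge (M : R) (x : I -> K) : Prop :=
  U [set i | (M%:E <= v (x i))%E]%classic.

Lemma eventually_geW M N x : N <= M -> eventually_ge M x -> eventually_ge N x.
Proof.
move=> NM; apply: filterS => i; apply: le_trans; by rewrite lee_fin.
Qed.

Lemma eventually_geB M x y :
  eventually_ge M x -> eventually_ge M y -> eventually_ge M (x - y).
Proof. by apply: filterS2 => i /=; exact: valuationB_ge. Qed.

Lemma eventually_geM M N x y :
  eventually_ge M x -> eventually_ge N y -> eventually_ge (M + N) (x * y).
Proof. by apply: filterS2 => i /= Mx Ny; rewrite valuationM EFinD; exact: leeD. Qed.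

Lemma eventually_ge_cst M c : (M%:E <= v c)%E -> eventually_ge M (fun=> c).
Proof. by move=> Mc; apply: filterE. Qed.

Definition bounded_fun (x : I -> K) : bool := `[< exists M, eventually_ge M x >].

Lemma bounded_fun_subring : subring_closed bounded_fun.
Proof.
split=> [|x y /asboolP[M xM] /asboolP[N yN]|x y /asboolP[M xM] /asboolP[N yN]]; apply/asboolP.
- by exists 0; apply: eventually_ge_cst; rewrite valuation1.
- exists (Num.min M N); apply: eventually_geB.
    by apply: eventually_geW xM; rewrite ge_min lexx.
  by apply: eventually_geW yN; rewrite ge_min lexx orbT.
- by exists (M + N); exact: eventually_geM.
Qed.

HB.instance Definition _ := GRing.isSubringClosed.Build (I -> K) bounded_fun bounded_fun_subring.

Definition bfun : Type := {x : I -> K | bounded_fun x}.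

HB.instance Definition _ := SubType.on bfun.
HB.instance Definition _ := [Choice of bfun by <:].
HB.instance Definition _ := [SubChoice_isSubComNzRing of bfun by <:].

Definition null_fun (x : bfun) : bool := `[< forall M, eventually_ge M (val x) >].

Lemma null_fun_ideal : idealr_closed null_fun.
Proof.
split.
- by apply/asboolP => M; apply: filterE => i; rewrite /= valuation0 leey.
- apply/asboolP => /(_ 1); case/filter_ex => i /=.
  by rewrite valuation1 lee_fin ler10.
- move=> a x y /asboolP xN /asboolP yN; apply/asboolP => M.
  have /asboolP[N aN] := valP a.
  rewrite -[y]opprK; apply: eventually_geB; last first.
    by move: (yN M); apply: filterS => i /=; rewrite valuationN.
  by rewrite -(subrKC N M); apply: eventually_geM.
Qed.

HB.instance Definition _ := isIdealr.Build bfun null_fun null_fun_ideal.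

(** The filter is maximal, so if v(x) >= M fails to hold along it then v(x) < M holds along it, and
    the pointwise inverse is bounded there. *)
Lemma bounded_inverse (x : bfun) : ~~ null_fun x ->
  exists y : bfun, null_fun (y * x - 1) /\ forall i, val y i = (val x i)^-1.
Proof.
move=> /asboolPn/existsNP[M nMx].
have Ux : U [set i | (v (val x i) < M%:E)%E]%classic.
  have [//|] := in_ultra_setVsetC [set i | (M%:E <= v (val x i))%E]%classic UU.
  by apply: filterS => i /=; rewrite ltNge => /negP.
have xb : bounded_fun (fun i => (val x i)^-1).
  apply/asboolP; exists (- M); apply: filterS Ux => i /= xM.
  have x0 : val x i != 0 by apply: contraTneq xM => ->; rewrite valuation0 -leNgt leey.
  by rewrite valuationV // EFinN leeN2 ltW.
exists (Sub _ xb); split=> //; apply/asboolP => N; apply: filterS Ux => i /= xM.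
have x0 : val x i != 0 by apply: contraTneq xM => ->; rewrite valuation0 -leNgt leey.
rewrite [X in v X](_ : _ = (val x i)^-1 * val x i - 1) //.
by rewrite mulVf // subrr valuation0 leey.
Qed.

(** Roots are chosen pointwise. If v(y) were below 0 and below all coefficient bounds, y^n would
    have smaller value than every term on the right. *)
Lemma bounded_root n (P : nat -> bfun) : (0 < n)%N ->
  exists y : bfun, y ^+ n = \sum_(j < n) P j * y ^+ j.
Proof.
move=> n0.
have /choice[y yE] (i : I) : exists y : K, y ^+ n = \sum_(j < n) val (P j) i * y ^+ j.
  exact: (solve_monicpoly (fun j => val (P j) i)).
have /choice[M PM] (j : nat) : exists M, eventually_ge M (val (P j)).
  by apply/asboolP; exact: valP (P j).
pose N := \big[Num.min/0]_(j < n) M j.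
have yb : bounded_fun y.
  apply/asboolP; exists N.
  have : \forall i \near U, forall j : 'I_n, ((M j)%:E <= v (val (P j) i))%E.
    by apply: filter_forall => j; exact: PM.
  apply: filterS => i Pi /=; rewrite leNgt; apply/negP => yN.
  have N0 : N <= 0 by rewrite /N bigmin_le_id.
  have y0 : y i != 0 by apply: contraTneq yN => ->; rewrite valuation0 -leNgt leey.
  have [a ya] : exists a, v (y i) = a%:E.
    by exists (fine (v (y i))); rewrite fineK // valuation_fin.
  move: yN; rewrite ya lte_fin => aN.
  have : ((N + a *+ n.-1)%:E <= v (y i ^+ n)%R)%E.
    rewrite yE; apply: valuation_sum_ge => j _.
    rewrite valuationM (valuationX _ ya) EFinD; apply: leeD.
      by apply: le_trans (Pi j); rewrite lee_fin; exact: bigmin_le.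
    rewrite lee_fin -(subnK (_ : j <= n.-1)%N) ?mulrnDr; last by rewrite -ltnS prednK.
    by rewrite gerDr mulrn_wle0 // ltW // (lt_le_trans aN).
  by rewrite (valuationX _ ya) lee_fin -[in X in _ <= X](prednK n0) mulrS lerD2r leNgt aN.
exists (Sub _ yb); apply/val_inj/funext => i.
have expE (z : I -> K) m : (z ^+ m) i = z i ^+ m.
  by elim: m => // m IHm; rewrite !exprS -IHm.
rewrite rmorphXn rmorph_sum /= fct_sumE expE yE; apply: eq_bigr => j _.
have valE : val ((Sub y yb : bfun) ^+ j) = y ^+ j by rewrite rmorphXn.
transitivity (val (P j) i * val ((Sub y yb : bfun) ^+ j) i); last by [].
by rewrite valE expE.
Qed.

Lemma bounded_ultrapower : exists (Om : closedFieldType) (lim : {rmorphism bfun -> Om}),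
  (forall x, lim x = 0 <-> null_fun x) /\ (forall z, exists x, lim x = z).
Proof.
pose null_ideal : idealr bfun := null_fun.
pose E : comNzRingType := {ideal_quot null_ideal}.
pose lim : {rmorphism bfun -> E} := \pi_E%qT.
have lim0 x : lim x = 0 <-> null_fun x.
  rewrite -(rmorph0 lim); split=> [/eqP|x0]; last apply/eqP.
    by rewrite -Quotient.idealrBE subr0.
  by rewrite -Quotient.idealrBE subr0.
have limS z : exists x, lim x = z by exists (generic_quotient.repr z); rewrite /lim /= reprK.
have /choice[inv inv_spec] (z : E) : exists w : E, (z = 0 -> w = 0) /\ (z != 0 -> w * z = 1).
  have [->|z0] := eqVneq z 0; first by exists 0.
  have [x xz] := limS z; have [|y [yx _]] := @bounded_inverse x.
    by apply: contra_neqN z0 => /lim0; rewrite xz.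
  exists (lim y); split=> [z00|_]; first by rewrite z00 eqxx in z0.
  rewrite -xz -rmorphM; apply/eqP.
  by rewrite -subr_eq0 -(rmorph1 lim) -rmorphB; apply/eqP/lim0.
have invf z : z != 0 -> inv z * z = 1 by case: (inv_spec z).
have inv0 : inv 0 = 0 by case: (inv_spec 0) => ->.
pose EfieldMixin := GRing.ComNzRing_isField.Build E invf inv0.
pose Efield : fieldType := HB.pack E EfieldMixin.
have Eclosed : GRing.closed_field_axiom Efield.
  move=> n P n0; have /choice[x xP] j : exists x, lim x = P j by exact: limS.
  have [y yE] := bounded_root x n0; exists (lim y).
  transitivity (lim (y ^+ n)); first by rewrite rmorphXn.
  rewrite yE rmorph_sum; apply: eq_bigr => j _.
  by rewrite rmorphM rmorphXn /= -xP.
pose Om : closedFieldType := HB.pack Efield (Field_isAlgClosed.Build Efield Eclosed).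
by exists Om, lim.
Qed.
Lemma bounded_cst (c : K) : bounded_fun (fun=> c).
Proof.
have [->|c0] := eqVneq c 0; apply/asboolP.
  by exists 0; apply: eventually_ge_cst; rewrite valuation0 leey.
by exists (fine (v c)); apply: eventually_ge_cst; rewrite fineK // valuation_fin.
Qed.

Definition bcst (c : K) : bfun := Sub (fun=> c) (bounded_cst c).

Lemma bcst_zmod : zmod_morphism bcst.
Proof. by move=> x y; apply/val_inj/funext => i. Qed.

Lemma bcst_monoid : monoid_morphism bcst.
Proof. by split=> [|x y]; apply/val_inj/funext => i. Qed.

HB.instance Definition _ := GRing.isZmodMorphism.Build K bfun bcst bcst_zmod.
HB.instance Definition _ := GRing.isMonoidMorphism.Build K bfun bcst bcst_monoid.

Definition bval (i : I) (x : bfun) : K := val x i.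

Lemma bval_zmod i : zmod_morphism (bval i).
Proof. by []. Qed.

Lemma bval_monoid i : monoid_morphism (bval i).
Proof. by []. Qed.

HB.instance Definition _ i := GRing.isZmodMorphism.Build bfun K (bval i) (bval_zmod i).
HB.instance Definition _ i := GRing.isMonoidMorphism.Build bfun K (bval i) (bval_monoid i).

Lemma bval_mvev n (x : nat -> bfun) p i :
  val (mvev n bcst x p) i = mvev n idfun (fun j => val (x j) i) p.
Proof. by rewrite -[LHS]/(bval i _) rmorph_mvev; exact: mvev_ext. Qed.

Lemma not_null_lim (Om : closedFieldType) (lim : {rmorphism bfun -> Om}) x y :
  (forall x, lim x = 0 <-> null_fun x) -> null_fun (y * x - 1) -> lim y = (lim x)^-1.
Proof.
move=> lim0 /lim0/eqP; rewrite rmorphB rmorphM rmorph1 subr_eq0 => /eqP yx.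
have x0 : lim x != 0 by apply: contra_eq_neq yx => ->; rewrite mulr0 eq_sym oner_eq0.
by apply: (mulIf x0); rewrite yx mulVf.
Qed.

Lemma ultralimit_specialization n (x : nat -> bfun) (D : conditions (mvpoly n K)) :
  (forall e, e \in D.1 -> null_fun (mvev n bcst x e)) ->
  (forall q, q \in D.2 -> ~~ null_fun (mvev n bcst x q.2) /\
     forall e : R, 0 < e -> \forall i \near U,
       (v (val (mvev n bcst x q.2) i) - e%:E <= v (val (mvev n bcst x q.1) i))%E) ->
  exists c : nat -> K, sat (valuation_ring v) (mvev n idfun c) D.
Proof.
move=> E0 Q0; have [Om [lim [lim0 limS]]] := bounded_ultrapower.
(* The slack e turns inequalities that hold up to every e > 0 into integrality. A function outside
   has v < -e along the ultrafilter for some e > 0, so its inverse is inside. *)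
pose W z := exists2 x : bfun, lim x = z &
  forall e : R, 0 < e -> eventually_ge (- e) (val x).
have vW : valring W.
  split.
  - exists 1; first exact: rmorph1.
    by move=> e e0; apply: eventually_ge_cst; rewrite valuation1 lee_fin oppr_le0 ltW.
  - move=> _ _ [a <- aW] [b <- bW]; exists (a - b); first exact: rmorphB.
    by move=> e e0; apply: eventually_geB; [exact: aW | exact: bW].
  - move=> _ _ [a <- aW] [b <- bW]; exists (a * b); first exact: rmorphM.
    move=> e e0; have e20 : 0 < e / 2 by rewrite divr_gt0.
    rewrite (splitr e) opprD; apply: eventually_geM; [exact: aW | exact: bW].
  - move=> z; have [x' <-] := limS z.
    have [aW|] := pselect (forall e : R, 0 < e -> eventually_ge (- e) (val x')).
      by left; exists x'.
    move/existsNP => [e /not_implyP[e0 nx]]; right.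
    have Ux : \forall i \near U, (v (val x' i) < (- e)%:E)%E.
      have [//|] := in_ultra_setVsetC [set i | ((- e)%:E <= v (val x' i))%E]%classic UU.
      by apply: filterS => i /=; rewrite ltNge => /negP.
    have nn : ~~ null_fun x'.
      apply/negP => /asboolP nul; have [i []] := filter_ex (filterI (nul 0) Ux).
      by move=> i0 ie; have := le_lt_trans i0 ie; rewrite lte_fin oppr_gt0 ltNge ltW.
    have [y [yx yE]] := bounded_inverse nn.
    exists y; first exact: not_null_lim.
    move=> d d0; apply: filterS Ux => i /= xe; rewrite yE.
    have x0 : val x' i != 0 by apply: contraTneq xe => ->; rewrite valuation0 -leNgt leey.
    rewrite valuationV // -leeN2 oppeK; apply: le_trans (ltW xe) _.
    by rewrite -EFinN lee_fin opprK; apply: le_trans (ltW d0); rewrite oppr_le0 ltW.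
pose iota : {rmorphism K -> Om} := lim \o bcst.
have iotaW c : valuation_ring v c -> W (iota c).
  move=> Oc; exists (bcst c) => // e e0; apply: eventually_ge_cst.
  by apply: le_trans Oc; rewrite lee_fin oppr_le0 ltW.
have Wiota c : W (iota c) -> valuation_ring v c.
  move=> [x' xc xW]; apply/lee_addgt0Pr => e e0.
  have /asboolP nul : null_fun (x' - bcst c) by apply/lim0; rewrite rmorphB xc subrr.
  have [i [xi ci]] := filter_ex (filterI (xW e e0) (nul 0)).
  rewrite -leeBlDr // sub0e -EFinN (_ : c = val x' i - (val x' i - c)); last by ring.
  apply: valuationB_ge => //; apply: le_trans ci; by rewrite lee_fin oppr_le0 ltW.
have limE p : mvev n iota (lim \o x) p = lim (mvev n bcst x p).
  by rewrite rmorph_mvev; exact: mvev_ext.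
apply: (valued_lifting (valuation_ring_valring v) vW iotaW (b := lim \o x)) => //.
split=> [e eD|q qD]; rewrite ?limE; first by apply/lim0; exact: E0.
have [q0 qv] := Q0 q qD; split.
  by apply: contraNneq q0 => /lim0.
have [y [yx yE]] := bounded_inverse q0.
exists (mvev n bcst x q.1 * y).
  by rewrite rmorphM; congr (_ * _); exact: not_null_lim.
move=> e e0; apply: filterS (qv e e0) => i /=.
set g := mvev n bcst x q.1; set h := mvev n bcst x q.2 in yE *.
rewrite -[(_ * _) i]/(val g i * val y i) yE => gh.
have [h0|h0] := eqVneq (val h i) 0; first by rewrite h0 invr0 mulr0 valuation0 leey.
rewrite valuationM valuationV //; move: gh; have := valuation_fin v h0.
case: (v (val h i)) => // a _; case: (v (val g i)) => [b| |] //=; first by rewrite !lee_fin; lra.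
by rewrite addye ?leey.
Qed.

Theorem ultralimit_lifting n (x : nat -> I -> K) (D : conditions (mvpoly n K)) :
  (forall j, exists M, eventually_ge M (x j)) ->
  (forall e, e \in D.1 -> forall M : R, \forall i \near U,
     (M%:E <= v (mvev n idfun (x^~ i) e))%E) ->
  (forall q, q \in D.2 ->
     (exists M : R, \forall i \near U, (v (mvev n idfun (x^~ i) q.2) < M%:E)%E) /\
     forall e : R, 0 < e -> \forall i \near U,
       (v (mvev n idfun (x^~ i) q.2) - e%:E <= v (mvev n idfun (x^~ i) q.1))%E) ->
  exists c : nat -> K, sat (valuation_ring v) (mvev n idfun c) D.
Proof.
move=> xb E0 Q0.
have {}xb j : bounded_fun (x j) by apply/asboolP.
pose y j : bfun := Sub (x j) (xb j).
have yE p i : val (mvev n bcst y p) i = mvev n idfun (x^~ i) p by rewrite bval_mvev.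
apply: (@ultralimit_specialization n y) => [e eD|q qD].
  by apply/asboolP => M; apply: filterS (E0 e eD M) => i; rewrite -yE.
have [[M qM] qe] := Q0 q qD; split=> [|e e0].
  apply/negP => /asboolP /(_ M) nul; have [i [nui qi]] := filter_ex (filterI nul qM).
  have : (M%:E <= v (mvev n idfun (x^~ i) q.2))%E by rewrite -yE.
  by move=> /le_lt_trans /(_ qi); rewrite ltxx.
by apply: filterS (qe e e0) => i; rewrite -!yE.
Qed.

End BoundedUltrapower.

(** * Minors and their exchange properties *)

Section Coordinates.
Variables (K : fieldType) (E : finType).
Local Notation V := (coord_space K E).

Definition coord_mx r s (a : 'I_r -> V) (x : 'I_s -> E) : 'M[K]_(r, s) :=
  \matrix_(i, j) a i (x j).

(** Columns are listed by a function, so that replacing one of them is [upd] and involves no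
    reordering. Minors on sets differ from these by signs, which the valuation ignores. *)
Definition pl r (a : 'I_r -> V) (x : 'I_r -> E) : K := \det (coord_mx a x).

Definition upd r (x : 'I_r -> E) (k : 'I_r) (e : E) : 'I_r -> E :=
  fun j => if j == k then e else x j.

Lemma pl_expand r (a : 'I_r -> V) (x : 'I_r -> E) k e :
  pl a (upd x k e) = \sum_i a i e * cofactor (coord_mx a x) i k.
Proof.
rewrite /pl (expand_det_col _ k); apply: eq_bigr => i _; rewrite mxE /upd eqxx.
congr (_ * (_ * \det _)); apply/matrixP => i' j'.
by rewrite !mxE eq_sym (negPf (neq_lift _ _)).
Qed.

Lemma pl_upd r (x : 'I_r -> E) k : upd x k (x k) = x.
Proof. by apply/funext => j; rewrite /upd; case: eqP => [->|]. Qed.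

Lemma pl_not_inj r (a : 'I_r -> V) (x : 'I_r -> E) : pl a x != 0 -> injective x.
Proof.
move=> plx i j xij; apply/eqP; apply: contraNT plx => ij; apply/eqP.
rewrite /pl -det_tr; apply: (determinant_alternate ij) => k.
by rewrite !mxE xij.
Qed.

Lemma pl_perm r (a : 'I_r -> V) (x : 'I_r -> E) (s : 'S_r) :
  pl a (x \o s) = (-1) ^+ s * pl a x.
Proof.
rewrite /pl; have -> : coord_mx a (x \o s) = col_perm s (coord_mx a x).
  by apply/matrixP => i j; rewrite !mxE.
by rewrite col_permE det_mulmx det_perm odd_permV mulrC.
Qed.

Lemma pl_image r (a : 'I_r -> V) (x y : 'I_r -> E) : injective x -> injective y ->
  x @: finset.setT = y @: finset.setT -> exists b : bool, pl a x = (-1) ^+ b * pl a y.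
Proof.
move=> xI yI xy; have /choice[s sE] (j : 'I_r) : exists k, x j = y k.
  by have : x j \in y @: finset.setT by [rewrite -xy imset_f]; case/imsetP => k _ ->; exists k.
have sI : injective s by move=> i j sij; apply: xI; rewrite !sE sij.
exists (perm sI); rewrite -pl_perm; congr pl; apply/funext => j /=.
by rewrite permE.
Qed.

Definition enum_fun (I : {set E}) r (cI : #|I| = r) (j : 'I_r) : E :=
  enum_val (cast_ord (esym cI) j).

Lemma enum_fun_inj (I : {set E}) r (cI : #|I| = r) : injective (enum_fun cI).
Proof. by move=> i j /enum_val_inj /cast_ord_inj. Qed.

Lemma enum_fun_image (I : {set E}) r (cI : #|I| = r) : enum_fun cI @: finset.setT = I.
Proof.
apply/setP => e; apply/imsetP/idP => [[j _ ->]|eI]; first exact: enum_valP.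
exists (cast_ord cI (enum_rank_in eI e)) => //.
by rewrite /enum_fun cast_ordK enum_rankK_in.
Qed.

Lemma enum_fun_nth (I : {set E}) r (cI : #|I| = r) e j : enum_fun cI j = nth e (enum I) j.
Proof.
by rewrite /enum_fun /enum_val /=; apply: set_nth_default; rewrite -cardE cI.
Qed.

Lemma minor_enum r (A : r.-tuple V) (I : {set E}) (cI : #|I| = r) :
  minor A I = pl (tnth A) (enum_fun cI).
Proof.
congr (\det _); apply/matrixP => i j; rewrite !mxE.
by rewrite (nth_map (enum_fun cI j)) -?enum_fun_nth // -cardE cI.
Qed.

Lemma minor_pl r (A : r.-tuple V) (I : {set E}) (x : 'I_r -> E) : injective x ->
  x @: finset.setT = I -> exists b : bool, minor A I = (-1) ^+ b * pl (tnth A) x.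
Proof.
move=> xI xE; have cI : #|I| = r by rewrite -xE card_imset // cardsT card_ord.
rewrite (minor_enum A cI); apply: pl_image => //; first exact: enum_fun_inj.
by rewrite enum_fun_image.
Qed.

Lemma exists_enum (I : {set E}) r : #|I| = r ->
  exists2 x : 'I_r -> E, injective x & x @: finset.setT = I.
Proof.
move=> cI; exists (enum_fun cI); [exact: enum_fun_inj | exact: enum_fun_image].
Qed.

Lemma free_pl r (A : r.-tuple V) (x : 'I_r -> E) : pl (tnth A) x != 0 -> free A.
Proof.
move=> plx; apply/freeP => k k0 i.
have: (\row_j k j) *m coord_mx (tnth A) x = 0.
  apply/rowP => j; rewrite !mxE; have := congr1 (fun u : V => u (x j)) k0.
  rewrite sum_ffunE [RHS]ffunE => kx; rewrite -[RHS]kx; apply: eq_bigr => i' _.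
  by rewrite !mxE !ffunE (tnth_nth 0).
move/(congr1 (mulmx^~ (invmx (coord_mx (tnth A) x)))).
rewrite mulmxK ?mul0mx ?unitmxE ?unitfE // => /rowP/(_ i).
by rewrite !mxE.
Qed.

End Coordinates.

Section Quotients.
Variables (R : realType) (K : fieldType) (v : valuation R K).

Lemma valuation_sign (b : bool) x : v ((-1) ^+ b * x) = v x.
Proof. by rewrite mulr_sign; case: b; rewrite // valuationN. Qed.

Lemma valuation_sum_gt (I : finType) (P : pred I) (F : I -> K) (a : R) :
  (forall i, P i -> (a%:E < v (F i))%E) -> (a%:E < v (\sum_(i | P i) F i)%R)%E.
Proof.
move=> aF; elim/big_ind: _ => //; first by rewrite valuation0 ltry.
move=> x y ax ay; apply: lt_le_trans (valuationD v x y).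
by rewrite lt_min ax.
Qed.

Variable E : finType.
Local Notation V := (coord_space K E).

Lemma valuation_minor r (A : r.-tuple V) (I : {set E}) (x : 'I_r -> E) : injective x ->
  x @: finset.setT = I -> v (minor A I) = v (pl (tnth A) x).
Proof. by move=> xI /(minor_pl A xI)[b ->]; rewrite valuation_sign. Qed.

Lemma span_eval s (A : s.-tuple V) u e : u \in <<A>>%VS ->
  u e = \sum_i coord A i u * tnth A i e.
Proof.
move=> uA; rewrite {1}(coord_span uA) sum_ffunE.
by apply: eq_bigr => i _; rewrite ffunE -tnth_nth.
Qed.

(** Cramer's rule expresses column e through the columns y, and a linear relation between columns
    holds for every vector of the row space. *)
Lemma cramer_column s (A : s.-tuple V) (y : 'I_s -> E) u e : pl (tnth A) y != 0 ->
  u \in <<A>>%VS ->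
  u e = \sum_l u (y l) * (pl (tnth A) (upd y l e) / pl (tnth A) y).
Proof.
move=> ply uA.
have AE k : (tnth A k) e = \sum_l (tnth A k) (y l) * (pl (tnth A) (upd y l e) / pl (tnth A) y).
  under eq_bigr do rewrite mulrA pl_expand.
  rewrite -mulr_suml; apply: (mulIf ply); rewrite divfK //.
  set M := coord_mx (tnth A) y.
  transitivity (\sum_i (tnth A i) e * (M *m \adj M) k i).
    rewrite mul_mx_adj (bigD1 k) //= !mxE eqxx mulr1n big1 ?addr0 // => i ik.
    by rewrite !mxE eq_sym (negPf ik) mulr0n mulr0.
  under [RHS]eq_bigr do rewrite mulr_sumr.
  rewrite exchange_big /=; apply: eq_bigr => i _; rewrite !mxE mulr_sumr.
  by apply: eq_bigr => l _; rewrite !mxE; ring.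
suff solve q : (forall k, (tnth A k) e = \sum_l (tnth A k) (y l) * q l) ->
    u e = \sum_l u (y l) * q l by exact: solve.
move=> {}AE; rewrite (span_eval _ uA).
under eq_bigr do rewrite AE mulr_sumr.
rewrite exchange_big; apply: eq_bigr => l _ /=; rewrite (span_eval _ uA) mulr_suml.
by apply: eq_bigr => i _; rewrite mulrA.
Qed.

Lemma upd_image r (x : 'I_r -> E) k e (I : {set E}) : injective x ->
  x @: finset.setT = I -> e \notin I ->
  injective (upd x k e) /\ upd x k e @: finset.setT = e |: I :\ x k.
Proof.
move=> xI xE eI; have xe j : x j != e.
  by apply: contraNneq eI => <-; rewrite -xE imset_f.
split=> [i j|].
  rewrite /upd; case: eqP => [->|_]; case: eqP => [->|_] //.
  - by move/esym/eqP; rewrite (negPf (xe j)).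
  - by move/eqP; rewrite (negPf (xe i)).
  - exact: xI.
apply/setP => f; rewrite !inE; apply/imsetP/orP => [[j _ ->]|[/eqP ->|/andP[fk fI]]].
- rewrite /upd; case: (j =P k) => [_|jk]; first by left; rewrite eqxx.
  by right; apply/andP; split; [apply/eqP => /xI | rewrite -xE imset_f].
- by exists k; rewrite // /upd eqxx.
- move: fI; rewrite -xE => /imsetP[j _ fj]; exists j => //; rewrite /upd; case: eqP => // jk.
  by rewrite fj jk eqxx in fk.
Qed.

(** The product of the two minors is a sum of products with i and y_l exchanged, and some summand
    has at most the value of the sum. Summands with y_l in I have a repeated column and vanish. *)
Lemma valuated_exchange r s (A : r.-tuple V) (A' : s.-tuple V) : (r <= s)%N ->
  (<<A>> <= <<A'>>)%VS -> vquotient r s (minor_valuation v A) (minor_valuation v A').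
Proof.
move=> rs AA'; split=> // I J i cI cJ; rewrite inE => /andP[iJ iI].
rewrite /minor_valuation cI cJ !eqxx.
(* If the right-hand side is infinite, any j will do; one exists because J has at least as many
   elements as I and misses i. *)
have [Ifin|] := boolP ((v (minor A I) + v (minor A' J))%E != +oo%E); last first.
  rewrite negbK => /eqP ->; have [j jJI] : exists j, j \in J :\: I.
    apply/set0Pn; rewrite -card_gt0 cardsD cJ.
    have : J :&: I \proper I.
      rewrite properE finset.subsetIr; apply/fintype.subsetPn; exists i => //.
      by rewrite inE (negPf iJ).
    by move/proper_card; rewrite cI; lia.
  by exists j => //; rewrite leey.
have AI0 : minor A I != 0.
  by apply: contraNneq Ifin => ->; rewrite valuation0 addye // valuation_neqNy.
have AJ0 : minor A' J != 0.
  by apply: contraNneq Ifin => ->; rewrite valuation0 addey // valuation_neqNy.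
have [x xI xE] := exists_enum cI; have [y yI yE] := exists_enum cJ.
have [k xk] : exists k, x k = i by move: iI; rewrite -xE => /imsetP[k _ ->]; exists k.
have ply : pl (tnth A') y != 0.
  by have [b bE] := minor_pl A' yI yE; move: AJ0; rewrite bE mulf_eq0 negb_or => /andP[].
pose c l := pl (tnth A') (upd y l i) / pl (tnth A') y.
have plE : pl (tnth A) x = \sum_l c l * pl (tnth A) (upd x k (y l)).
  rewrite -[in LHS](pl_upd x k) xk pl_expand.
  under [RHS]eq_bigr do rewrite pl_expand mulr_sumr.
  rewrite exchange_big /=; apply: eq_bigr => m _.
  rewrite (cramer_column i ply) ?mulr_suml; last first.
    by apply: (subvP AA'); apply: memv_span; exact: mem_tnth.
  by apply: eq_bigr => l _; rewrite /c; ring.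
have [l [yl le_l]] : exists l, y l \notin I /\
    (v (c l * pl (tnth A) (upd x k (y l)))%R <= v (minor A I))%E.
  apply: contrapT => nl; have := valuation_fin v AI0.
  rewrite (valuation_minor A xI xE); case vE : (v (pl (tnth A) x)) => [a| |] // _.
  suff : (a%:E < v (pl (tnth A) x))%E by rewrite vE ltxx.
  rewrite plE; apply: valuation_sum_gt => l _; rewrite ltNge; apply/negP => le_l.
  have [ylI|ylI] := boolP (y l \in I); last first.
    by apply: nl; exists l; rewrite (valuation_minor A xI xE) vE.
  move: le_l; apply/negP; rewrite -ltNge.
  have -> : pl (tnth A) (upd x k (y l)) = 0.
    apply/eqP; apply: contraTT ylI => /pl_not_inj updI; apply/negP.
    rewrite -xE => /imsetP[j _ ylj].
    have /updI jk : upd x k (y l) j = upd x k (y l) k.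
      by rewrite /upd eqxx; case: eqP => // _; rewrite ylj.
    by case/negP: iJ; rewrite -xk -jk -ylj -yE imset_f.
  by rewrite mulr0 valuation0 ltry.
exists (y l); first by rewrite inE yl -yE imset_f.
have [uxI uxE] := upd_image k xI xE yl.
have [uyI uyE] := upd_image l yI yE iJ.
rewrite xk in uxE.
have cIx : #|y l |: I :\ i| = r by rewrite -uxE card_imset // cardsT card_ord.
have cJy : #|i |: J :\ y l| = s by rewrite -uyE card_imset // cardsT card_ord.
rewrite cIx cJy !eqxx (valuation_minor A uxI uxE) (valuation_minor A' uyI uyE).
move: le_l; rewrite /c !valuationM valuationV // (valuation_minor A' yI yE).
have := valuation_fin v ply; have := valuation_fin v AI0.
have := valuation_neqNy v (pl (tnth A') (upd y l i)).
have := valuation_neqNy v (pl (tnth A) (upd x k (y l))).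
case: (v (minor A I)) => // a; case: (v (pl (tnth A') y)) => // b.
case: (v (pl _ _)) => [c1| |] //; case: (v (pl _ _)) => [c2| |] //= _ _ _ _.
by rewrite -!EFinD !lee_fin; lra.
Qed.

Lemma vquotient_equiv r s (mu mu' nu nu' : {set E} -> \bar R) :
  vequiv mu mu' -> vequiv nu nu' -> vquotient r s mu nu -> vquotient r s mu' nu'.
Proof.
move=> [c cE] [d dE] [rs ex]; split=> // I J i cI cJ iIJ.
have [j jJI le_j] := ex I J i cI cJ iIJ; exists j => //.
by rewrite !cE !dE addeACA [leRHS]addeACA leeD2r.
Qed.

Lemma realizes_vquotient r s (L L' : {vspace V}) (mu nu : {set E} -> \bar R) :
  realizes v r L mu -> realizes v s L' nu -> (L <= L')%VS -> vquotient r s mu nu.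
Proof.
move=> [dL [A AL muA]] [dL' [A' AL' nuA']] LL'.
apply: vquotient_equiv muA nuA' _; apply: valuated_exchange; last by rewrite AL AL'.
by rewrite -dL -dL'; exact: dimvS.
Qed.

End Quotients.

Section Concatenation.
Variables (E : finType) (k m : nat).

Definition catf (y : 'I_k -> E) (z : 'I_m -> E) (j : 'I_(k + m)) : E :=
  match fintype.split j with inl a => y a | inr b => z b end.

Lemma catfl y z i : catf y z (lshift m i) = y i.
Proof. by rewrite /catf (unsplitK (inl i)). Qed.

Lemma catfr y z i : catf y z (rshift k i) = z i.
Proof. by rewrite /catf (unsplitK (inr i)). Qed.

Lemma catf_image y z (B D : {set E}) : injective y -> injective z ->
  y @: finset.setT = B -> z @: finset.setT = D -> [disjoint B & D] ->
  injective (catf y z) /\ catf y z @: finset.setT = B :|: D.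
Proof.
move=> yI zI yB zD BD.
have yz a b : y a != z b.
  apply/eqP => ab; move/pred0P: BD => /(_ (y a)) /=.
  by rewrite -yB imset_f //= ab -zD imset_f.
split.
  move=> i j; rewrite -[i]splitK -[j]splitK.
  case: (fintype.split i) => a; case: (fintype.split j) => b; rewrite /unsplit ?catfl ?catfr.
  - by move=> /yI ->.
  - by move/eqP; rewrite (negPf (yz _ _)).
  - by move/eqP; rewrite eq_sym (negPf (yz _ _)).
  - by move=> /zI ->.
apply/setP => e; rewrite inE -yB -zD; apply/imsetP/orP => [[j _ ->]|[]/imsetP[j _ ->]].
- by rewrite /catf; case: (fintype.split j) => a; [left|right]; rewrite imset_f.
- by exists (lshift m j); rewrite // catfl.
- by exists (rshift k j); rewrite // catfr.
Qed.

End Concatenation.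

(** * Coordinate projections realize deletions *)

Section Deletion.
Variables (R : realType) (K : fieldType) (v : valuation R K) (E : finType).
Local Notation V := (coord_space K E).

(** If the minor on x is nonzero, this is the basis of the row space that is the identity matrix on
    the columns x. *)
Definition normal_form r (a : 'I_r -> V) (x : 'I_r -> E) (i : 'I_r) : V :=
  \sum_j (invmx (coord_mx a x)) i j *: a j.

Lemma normal_form_mx r (a : 'I_r -> V) (x : 'I_r -> E) s (y : 'I_s -> E) :
  coord_mx (normal_form a x) y = invmx (coord_mx a x) *m coord_mx a y.
Proof.
apply/matrixP => i j; rewrite !mxE sum_ffunE; apply: eq_bigr => l _.
by rewrite ffunE mxE.
Qed.

Lemma pl_normal_form r (a : 'I_r -> V) (x y : 'I_r -> E) :
  pl (normal_form a x) y = (pl a x)^-1 * pl a y.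
Proof. by rewrite /pl normal_form_mx det_mulmx det_inv. Qed.

Lemma normal_formK r (a : 'I_r -> V) (x : 'I_r -> E) i : pl a x != 0 ->
  a i = \sum_j coord_mx a x i j *: normal_form a x j.
Proof.
move=> ax; apply/ffunP => e; rewrite sum_ffunE.
have Mu : coord_mx a x \in unitmx by rewrite unitmxE unitfE.
have := normal_form_mx a x (fun _ : 'I_1 => e).
move=> /(congr1 (mulmx (coord_mx a x))); rewrite mulKVmx // => /matrixP/(_ i 0).
rewrite !mxE => <-; apply: eq_bigr => j _.
by rewrite [RHS]ffunE !mxE.
Qed.

Lemma normal_form_delta r (a : 'I_r -> V) (x : 'I_r -> E) i j : pl a x != 0 ->
  normal_form a x i (x j) = (i == j)%:R.
Proof.
move=> ax; have Mu : coord_mx a x \in unitmx by rewrite unitmxE unitfE.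
have /matrixP/(_ i j) := normal_form_mx a x x.
by rewrite mulVmx // !mxE.
Qed.

Lemma pl_upd_normal_form r (a : 'I_r -> V) (x : 'I_r -> E) i e : pl a x != 0 ->
  pl (normal_form a x) (upd x i e) = normal_form a x i e.
Proof.
move=> ax; rewrite pl_expand (bigD1 i) //= big1 ?addr0.
  rewrite /cofactor -signr_odd addnn odd_double mul1r.
  rewrite (_ : row' _ _ = 1%:M) ?det1 ?mulr1 //.
  by apply/matrixP => i' j'; rewrite !mxE normal_form_delta // (inj_eq lift_inj).
move=> i' ii'; have [s si] : exists s, lift i' s = i.
  by case: (unliftP i' i) => [s ->|ii]; [exists s | rewrite ii eqxx in ii'].
rewrite /cofactor (expand_det_row _ s) big1 ?mulr0 // => j _.
by rewrite !mxE si normal_form_delta // (negPf (neq_lift _ _)) mul0r.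
Qed.

Lemma pr_space_span r (A : r.-tuple V) (S : {set E}) :
  pr_space S <<A>> = <<[seq pr_fun S u | u <- A]>>%VS.
Proof.
by rewrite /pr_space limg_span; congr <<_>>%VS; apply: eq_map => u; rewrite lfunE.
Qed.


Lemma vrank_ge (mu : {set E} -> \bar R) (B X : {set E}) :
  mu B != +oo%E -> (#|B :&: X| <= vrank mu X)%N.
Proof. exact: (@leq_bigmax_cond _ (fun B => mu B != +oo%E) (fun B => #|B :&: X|)). Qed.

Lemma vrank_attained (mu : {set E} -> \bar R) (X : {set E}) :
  (exists I, mu I != +oo%E) -> exists2 B, mu B != +oo%E & #|B :&: X| = vrank mu X.
Proof.
move=> [I If]; have [|B Bfin BE] := @bigop.eq_bigmax_cond _ (fun B => mu B != +oo%E) (fun B => #|B :&: X|).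
  by apply/card_gt0P; exists I.
by exists B; rewrite // -BE.
Qed.

Section DeletionSet.
Variables (r : nat) (mu : {set E} -> \bar R) (S : {set E}).
Hypotheses (mu_fin : exists I, mu I != +oo%E)
  (mu_card : forall I, mu I != +oo%E -> #|I| = r).

(** A basis with the most elements outside S makes the choice succeed, and any set chosen is the
    trace on S of such a basis. *)
Lemma deletion_set_spec (D := deletion_set r mu S) :
  exists B, [/\ mu B != +oo%E, B :&: S = D, D \subset S,
    #|D| = (r - vrank mu (~: S))%N & #|B :\: S| = vrank mu (~: S)].
Proof.
have vrank_le X : (vrank mu X <= r)%N.
  by have [B /mu_card <- <-] := vrank_attained X mu_fin; exact: subset_leq_card (finset.subsetIl _ _).
rewrite /D /deletion_set; case: pickP => [I /and3P[IS /eqP cI /eqP rI] /=|none].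
  have [B Bfin] := vrank_attained (~: S :|: I) mu_fin; rewrite rI => cB.
  have BSI : B \subset ~: S :|: I.
    apply/finset.setIidPl/eqP; rewrite eqEcard finset.subsetIl cB.
    by rewrite (mu_card Bfin) /=.
  have BSsub : B :&: S \subset I.
    apply/fintype.subsetP => e; rewrite inE => /andP[/(fintype.subsetP BSI)].
    by rewrite !inE => /orP[/negPf ->|].
  have cBD : (#|B :\: S| <= vrank mu (~: S))%N.
    by rewrite finset.setDE; apply: vrank_ge.
  have cBr : (#|B :&: S| + #|B :\: S| = r)%N by rewrite cardsID mu_card.
  have cBS := subset_leq_card BSsub.
  exists B; split=> //; last by have := vrank_le (~: S); lia.
  by apply/eqP; rewrite eqEcard BSsub /=; lia.
have [B Bfin cB] := vrank_attained (~: S) mu_fin.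
have cBr : (#|B :&: S| + #|B :\: S| = r)%N by rewrite cardsID mu_card.
have rB : vrank mu (~: S :|: B :&: S) = r.
  apply/eqP; rewrite eqn_leq vrank_le -[X in (X <= _)%N](mu_card Bfin).
  rewrite (leq_trans _ (vrank_ge _ Bfin)) // subset_leq_card //.
  by apply/fintype.subsetP => e eB; rewrite !inE eB orbC; case: (e \in S).
have cBS : #|B :&: S| = (r - vrank mu (~: S))%N.
  by rewrite -finset.setDE in cB; lia.
by have := none (B :&: S); rewrite finset.subsetIr cBS rB !eqxx.
Qed.

End DeletionSet.

End Deletion.

Section DeletionRealization.
Variables (R : realType) (K : fieldType) (v : valuation R K) (E : finType).
Local Notation V := (coord_space K E).

Lemma minor_valuation_fin r (A : r.-tuple V) B :
  (minor_valuation v A B != +oo%E) = (#|B| == r) && (minor A B != 0).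
Proof.
by rewrite /minor_valuation; case: ifP; rewrite ?eqxx // valuation_eqy.
Qed.

Lemma vequiv_fin (mu nu : {set E} -> \bar R) B : vequiv mu nu ->
  (nu B != +oo%E) = (mu B != +oo%E).
Proof. by move=> [c ->]; case: (mu B). Qed.

Lemma normal_form_in r (A : r.-tuple V) x i : normal_form (tnth A) x i \in <<A>>%VS.
Proof.
by apply: memv_suml => j _; apply: memvZ; apply: memv_span; exact: mem_tnth.
Qed.

Lemma minor_neq0 r (A : r.-tuple V) (x : 'I_r -> E) : injective x ->
  (minor A (x @: finset.setT) != 0) = (pl (tnth A) x != 0).
Proof. by move=> xI; have [b ->] := minor_pl A xI erefl; rewrite mulf_eq0 signr_eq0. Qed.

(** Normalize a basis of L at a matroid basis B1 with the most elements outside S, and let D be its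
    trace on S. The rows of D vanish outside S, so pr_S kills them and the other rows give a basis
    of pr_S L. On the columns B and D the matrix is block triangular, which compares the minors. *)
Lemma realizes_vdelete r (L : {vspace V}) (mu : {set E} -> \bar R) (S : {set E}) :
  (exists I, mu I != +oo%E) -> realizes v r L mu ->
  realizes v (vrank mu (~: S)) (pr_space S L) (vdelete r mu S).
Proof.
move=> mu_fin [_ [A AL muA]].
have muE B : (mu B != +oo%E) = (#|B| == r) && (minor A B != 0).
  by rewrite (vequiv_fin B muA) minor_valuation_fin.
have mu_card B : mu B != +oo%E -> #|B| = r by rewrite muE => /andP[/eqP].
have [B1 [B1fin B1S DS cD cB']] := deletion_set_spec S mu_fin mu_card.
rewrite /vdelete; set D := deletion_set r mu S in B1S DS cD *.
have rk_ub B : mu B != +oo%E -> (#|B :\: S| <= vrank mu (~: S))%N.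
  by rewrite finset.setDE; exact: vrank_ge.
set k := vrank mu (~: S) in cD cB' rk_ub *.
have [m rE] : exists m, r = (k + m)%N.
  exists (r - k)%N; have := cardsID S B1; rewrite B1S cD cB' (mu_card _ B1fin); lia.
have {}cD : #|D| = m by rewrite cD rE addKn.
clearbody D k; subst r.
have [x1 x1I x1E] := exists_enum cB'; have [x2 x2I x2E] := exists_enum cD.
have B'D : [disjoint B1 :\: S & D].
  rewrite -setI_eq0; apply/eqP/setP => e; rewrite !inE.
  by case: (boolP (e \in D)) => [/(fintype.subsetP DS) ->|]; rewrite ?andbF.
have [xI xE] := catf_image x1I x2I x1E x2E B'D.
pose x := catf x1 x2; rewrite -/x in xI xE.
have {}xE : x @: finset.setT = B1.
  by rewrite xE -B1S finset.setUC finset.setID.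
have plx : pl (tnth A) x != 0.
  by rewrite -minor_neq0 // xE; move: B1fin; rewrite muE => /andP[].
pose a := normal_form (tnth A) x.
have aplE y : pl a y = (pl (tnth A) x)^-1 * pl (tnth A) y by exact: pl_normal_form.
have ax i j : a i (x j) = (i == j)%:R by exact: normal_form_delta.
have x1S j : x1 j \notin S.
  by have : x1 j \in B1 :\: S by [rewrite -x1E imset_f]; rewrite inE => /andP[].
(* A nonzero entry would let e replace an element of D, giving a basis with [k.+1] elements outside
   S. *)
have a0 i e : e \notin S -> a (rshift k i) e = 0.
  move=> eS; apply/eqP; apply: contraT => ae0.
  have eB1 : e \notin B1.
    apply: contraNN ae0; rewrite -xE => /imsetP[j _ ej].
    rewrite ej ax; apply/eqP; case: eqP => // ij.
    case/negP: eS; apply: (fintype.subsetP DS).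
    by rewrite ej -ij /x catfr -x2E imset_f.
  have [uI uE] := upd_image (rshift k i) xI xE eB1.
  have := rk_ub (e |: B1 :\ x (rshift k i)).
  rewrite muE -uE card_imset // cardsT card_ord eqxx minor_neq0 //.
  have -> : pl (tnth A) (upd x (rshift k i) e) != 0.
    apply: contraNneq ae0 => pl0.
    by rewrite /a -(pl_upd_normal_form _ _ plx) aplE pl0 mulr0.
  move/(_ isT); rewrite uE leqNgt => /negP; case.
  have <- : #|e |: B1 :\: S| = k.+1.
    by rewrite cardsU1 cB' inE eS (negPf eB1).
  apply: subset_leq_card; apply/fintype.subsetP => f; rewrite !inE.
  case/orP => [/eqP ->|/andP[fS fB1]]; first by rewrite eqxx eS.
  rewrite fS fB1 andbT /=; apply/orP; right; apply: contraNneq fS => ->.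
  by apply: (fintype.subsetP DS); rewrite /x catfr -x2E imset_f.
pose w := [tuple pr_fun S (a (lshift m i)) | i < k].
have wE i e : tnth w i e = if e \in S then 0 else a (lshift m i) e.
  by rewrite tnth_mktuple ffunE.
have plw : pl (tnth w) x1 != 0.
  rewrite /pl (_ : coord_mx _ _ = 1%:M) ?det1 ?oner_eq0 //.
  apply/matrixP => i j; rewrite !mxE wE (negPf (x1S j)).
  by rewrite -(catfl x1 x2) ax (inj_eq (@lshift_inj _ _)).
have wL : <<w>>%VS = pr_space S L.
  rewrite -AL; apply/eqP; rewrite eqEsubv; apply/andP; split.
    apply/span_subvP => _ /tnthP[i ->]; rewrite tnth_mktuple -[pr_fun S _]lfunE.
    by apply: memv_img; exact: normal_form_in.
  rewrite pr_space_span; apply/span_subvP => _ /mapP[_ /tnthP[j ->] ->].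
  rewrite (normal_formK j plx) linear_sum; apply: memv_suml => i _.
  rewrite linearZ; apply: memvZ => /=.
  rewrite -[i]splitK; case: (fintype.split i) => i' /=.
    by apply: memv_span; rewrite -(tnth_mktuple (fun i => pr_fun S (a (lshift m i))) i') mem_tnth.
  rewrite (_ : pr_fun S _ = 0) ?mem0v //; apply/ffunP => e; rewrite !ffunE.
  by case: ifPn => // eS; exact: a0.
split; first by have := free_pl plw; rewrite -wL /free size_tuple => /eqP.
exists w => //; have [c muc] := muA.
exists (fine (v (pl (tnth A) x)) + c) => B.
rewrite /minor_valuation; have [cB|] /= := eqVneq #|B| k; last by [].
have [y yI yE] := exists_enum cB; rewrite (valuation_minor v w yI yE).
case: ifPn => [BS|].
  have yS j : y j \notin S.
    move/pred0P: BS => /(_ (y j)) /=; rewrite -yE imset_f // => /negbT.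
    by rewrite negb_and.
  have BD : [disjoint B & D] by apply: fintype.disjointWr DS BS.
  have [zI zE] := catf_image yI x2I yE x2E BD.
  rewrite muc /minor_valuation -zE card_imset // cardsT card_ord eqxx.
  rewrite (valuation_minor v A zI erefl).
  have -> : pl (tnth A) (catf y x2) = pl (tnth A) x * pl (tnth w) y.
    apply: (mulfI (_ : (pl (tnth A) x)^-1 != 0)); first by rewrite invr_eq0.
    rewrite -aplE mulKf // /pl -[coord_mx a _]submxK.
    have -> : dlsubmx (coord_mx a (catf y x2)) = 0.
      by apply/matrixP => i j; rewrite !mxE catfl a0.
    have -> : drsubmx (coord_mx a (catf y x2)) = 1%:M.
      apply/matrixP => i j; rewrite !mxE catfr -(catfr x1 x2) ax.
      by rewrite (inj_eq (@rshift_inj _ _)).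
    rewrite det_ublock det1 mulr1; congr (\det _); apply/matrixP => i j.
    by rewrite !mxE catfl wE (negPf (yS j)).
  rewrite valuationM EFinD fineK ?valuation_fin // addeA; congr (_ + _)%E.
  exact: addeC.
move=> nBS; have [e eB eS] : exists2 e, e \in B & e \in S.
  by move: nBS; rewrite -setI_eq0 => /set0Pn[e]; rewrite inE => /andP[]; exists e.
have -> : pl (tnth w) y = 0.
  move: eB; rewrite -yE => /imsetP[j _ ej].
  rewrite /pl (expand_det_col _ j) big1 // => i _.
  by rewrite mxE wE -ej eS mul0r.
by rewrite valuation0.
Qed.

End DeletionRealization.

Lemma realizes_pr_quotient (R : realType) (K : fieldType) (v : valuation R K) (E : finType)
    r s (S : {set E}) (L L' : {vspace coord_space K E}) (mu nu : {set E} -> \bar R) :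
  (exists I, mu I != +oo%E) -> realizes v r L mu -> realizes v s L' nu ->
  (pr_space S L <= L')%VS ->
  realizes_quotient v (vrank mu (~: S)) s (pr_space S L) L' (vdelete r mu S) nu.
Proof.
move=> mu_fin Lmu L'nu LL'; have pLmu := realizes_vdelete S mu_fin Lmu.
by split=> //; exact: realizes_vquotient pLmu L'nu LL'.
Qed.

(** * Subspaces with an additional zero coordinate *)

Section Loop.
Variables (R : realType) (K : fieldType) (v : valuation R K) (E : finType).
Local Notation V := (coord_space K E).

Lemma ext0_fun_inj : injective (@ext0_fun K E).
Proof.
move=> u w /ffunP uw; apply/ffunP => e.
by have := uw (Some e); rewrite !ffunE.
Qed.

Lemma ext0_space_sub (L L' : {vspace V}) :
  (ext0_space L <= ext0_space L')%VS = (L <= L')%VS.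
Proof.
apply/idP/idP => [/subvP LL'|]; last exact: limgS.
apply/subvP => u uL; have /LL' : linfun (@ext0_fun K E) u \in ext0_space L.
  exact: memv_img.
by case/memv_imgP => w wL'; rewrite !lfunE => /ext0_fun_inj ->.
Qed.

Lemma pr_ext0_space (S : {set E}) (L : {vspace V}) :
  pr_space (Some @: S)%SET (ext0_space L) = ext0_space (pr_space S L).
Proof.
rewrite /pr_space /ext0_space -!limg_comp; congr (_ @: L)%VS.
apply/lfunP => u; rewrite !comp_lfunE !lfunE; apply/ffunP => -[e|]; rewrite !ffunE.
  by rewrite mem_imset //; exact: Some_inj.
by case: ifP.
Qed.

Lemma realizes_add_loop r (L : {vspace V}) (mu : {set E} -> \bar R) :
  realizes v r L mu -> realizes v r (ext0_space L) (add_loop mu).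
Proof.
move=> [dL [A AL [c muc]]]; split.
  rewrite limg_dim_eq //; apply/eqP; rewrite -subv0; apply/subvP => u.
  rewrite memv_cap memv_ker memv0 lfunE => /andP[_ /eqP u0]; apply/eqP/ext0_fun_inj.
  by rewrite [ext0_fun u]u0 linear0.
exists (map_tuple (@ext0_fun K E) A).
  rewrite -AL /ext0_space limg_span; congr <<_>>%VS.
  by apply: eq_map => u; rewrite lfunE.
exists c => B; rewrite /add_loop /minor_valuation.
have [NB|NB] := boolP (None \in B).
  case: eqP => // cB; have [x xI xE] := exists_enum cB.
  rewrite (valuation_minor v _ xI xE); suff -> : pl (tnth (map_tuple (@ext0_fun K E) A)) x = 0.
    by rewrite valuation0.
  move: NB; rewrite -xE => /imsetP[j _ jN].
  rewrite /pl (expand_det_col _ j) big1 // => i _.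
  by rewrite mxE -jN tnth_map ffunE mul0r.
set B' := [set x | Some x \in B]; have BE : B = Some @: B'.
  apply/setP => -[e|]; last by rewrite (negPf NB); apply/esym/imsetP => -[].
  by rewrite mem_imset ?inE //; exact: Some_inj.
have cBB' : #|B| = #|B'| by rewrite BE card_imset //; exact: Some_inj.
rewrite muc /minor_valuation -cBB'; case: eqP => // cB; congr (_ + _)%E.
have [x xI xE] := exists_enum (etrans (esym cBB') cB).
rewrite (valuation_minor v _ xI xE) (@valuation_minor _ _ v _ _ _ _ (Some \o x)).
- congr (v (\det _)); apply/matrixP => i j.
  by rewrite !mxE tnth_map ffunE.
- by move=> i j [/xI].
- by rewrite BE -xE -imset_comp.
Qed.

Lemma add_loop_fin (mu : {set E} -> \bar R) :
  (exists I, mu I != +oo%E) -> exists I, add_loop mu I != +oo%E.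
Proof.
move=> [I muI]; exists (Some @: I)%SET; rewrite /add_loop.
have -> : (None \in (Some @: I)%SET) = false by apply/imsetP => -[].
rewrite (_ : [set x | Some x \in _] = I) //; apply/setP => e.
by rewrite inE mem_imset //; exact: Some_inj.
Qed.

Lemma pr_map_image (S : {set E}) :
  (pr_map S @: finset.setT)%SET = ~: (Some @: S)%SET.
Proof.
apply/setP => -[e|]; rewrite inE.
  rewrite mem_imset; last exact: Some_inj.
  apply/imsetP/idP => [[[f|] _ /=]|eS]; last by exists (Some e); rewrite //= (negPf eS).
    by case: ifPn => // fS [->].
  by [].
have -> : (None \in (Some @: S)%SET) = false by apply/imsetP => -[].
by apply/imsetP; exists None.
Qed.

Lemma pr_pullback_rankE (S : {set E}) (mu : {set E} -> \bar R) :
  pr_pullback_rank S mu = vrank (add_loop mu) (~: (Some @: S)%SET).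
Proof. by rewrite /pr_pullback_rank pr_map_image. Qed.

(* pr_S maps the elements of S to the loop o, so that the preimage of mu_o under
   pr_S is the deletion of S from mu_o, the elements of S becoming loops. *)
Lemma pr_pullbackE (S : {set E}) r (mu : {set E} -> \bar R) :
  pr_pullback S r mu = vdelete r (add_loop mu) (Some @: S)%SET.
Proof.
apply/funext => B; rewrite /pr_pullback /vpreimage /vpreimage_onto pr_map_image finset.setCK.
set nu := vdelete _ _ _; have nuN (C : {set option E}) : None \in C -> nu C = +oo%E.
  by move=> NC; rewrite /nu /vdelete /add_loop inE NC; case: ifP.
have [NB|NB] := boolP (None \in B).
  rewrite (nuN B NB) nuN ?eqxx //; apply/imsetP; exists None => //.
have [BS|BS] := boolP [disjoint B & Some @: S].
  have -> : pr_map S @: B = B.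
    rewrite -[RHS]imset_id; apply: eq_in_imset => -[e|] eB //=.
    case: ifPn => // eS; move/pred0P: BS => /(_ (Some e)) /=.
    by rewrite eB mem_imset ?eS //; exact: Some_inj.
  by rewrite eqxx andbT; case: (nu B =P +oo%E) => [->|].
have -> : nu B = +oo%E by rewrite /nu /vdelete (negPf BS) andbF.
rewrite nuN ?eqxx //; move: BS; rewrite -setI_eq0 => /set0Pn[e].
rewrite inE => /andP[eB /imsetP[f fS ef]]; apply/imsetP; exists e => //.
by rewrite ef /= fS.
Qed.

End Loop.

(** * Pluecker relations *)

Section OrderedEnumeration.
Variable n : nat.
Implicit Types (J I : {set 'I_n}) (j : 'I_n).

Definition rank_in J j : nat := #|[set i in J | (i < j)%N]|.

Lemma enum_set_sorted J : sorted (fun i j : 'I_n => (i < j)%N) (enum J).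
Proof.
have -> : enum J = seq.filter (mem J) (enum 'I_n) by rewrite [enum 'I_n]enumT.
apply: sorted_filter; first by move=> y x z; exact: ltn_trans.
by rewrite -[sorted _ _]/(sorted (relpre val ltn) (enum 'I_n)) -sorted_map val_enum_ord iota_ltn_sorted.
Qed.

Lemma index_rank J j : j \in J -> index j (enum J) = rank_in J j.
Proof.
move=> jJ; have jE : j \in enum J by rewrite mem_enum.
have -> : rank_in J j = count (fun i : 'I_n => (i < j)%N) (enum J).
  rewrite /rank_in cardE -size_filter; congr size.
  rewrite /enum_mem -filter_predI.
  by apply: eq_filter => i; rewrite /= !inE andbC.
have ltT : transitive (fun i j : 'I_n => (i < j)%N) by move=> y x z; exact: ltn_trans.
have := enum_set_sorted J; rewrite (sorted_pairwise ltT).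
have jsz : (index j (enum J) < size (enum J))%N by rewrite index_mem.
rewrite -{1 3}(cat_take_drop (index j (enum J)) (enum J)) (drop_nth j jsz) nth_index //.
rewrite pairwise_cat count_cat /= ltnn add0n => /and3P[/allrelP pre _ /andP[/allP post _]].
have -> : count (fun i : 'I_n => (i < j)%N) (drop (index j (enum J)).+1 (enum J)) = 0%N.
  apply/eqP; rewrite eqn0Ngt -has_count; apply/hasPn => i /post /=.
  by rewrite -leqNgt => /ltnW.
rewrite addn0; have : all (fun i : 'I_n => (i < j)%N) (take (index j (enum J)) (enum J)).
  by apply/allP => i iT; apply: pre; rewrite ?inE ?eqxx.
by rewrite all_count => /eqP ->; rewrite size_takel // ltnW.
Qed.

Lemma enum_setD1 J j : j \in J -> enum (J :\ j) = rem j (enum J).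
Proof.
move=> jJ; rewrite rem_filter ?enum_uniq // {1}/enum_mem -filter_predI.
by apply: eq_filter => i; rewrite /= !inE.
Qed.

Lemma enum_fun_setD1 J c (cJ : #|J| = c.+1) (b : 'I_c.+1)
    (cJb : #|J :\ enum_fun cJ b| = c) l :
  enum_fun cJb l = enum_fun cJ (lift b l).
Proof.
set j := enum_fun cJ b; have jJ : j \in J by exact: enum_valP.
have bsz : (b < size (enum J))%N by rewrite -cardE cJ.
have jn : j = nth j (enum J) b by exact: enum_fun_nth.
have ib : index j (enum J) = b by rewrite jn index_uniq // enum_uniq.
rewrite !(enum_fun_nth _ j) enum_setD1 // remE ib nth_cat size_takel ?(ltnW bsz) //.
rewrite /= /bump; case: (ltnP l b) => lb; first by rewrite nth_take // leqNgt lb.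
by rewrite nth_drop addSn subnKC.
Qed.

Lemma rank_enum_fun J c (cJ : #|J| = c) b : rank_in J (enum_fun cJ b) = b.
Proof.
rewrite -index_rank ?enum_valP // (enum_fun_nth _ (enum_fun cJ b)).
by rewrite index_uniq ?enum_uniq // -cardE cJ.
Qed.

Lemma sum_enum_fun (K : nmodType) J c (cJ : #|J| = c) (F : 'I_n -> K) :
  \sum_(j in J) F j = \sum_b F (enum_fun cJ b).
Proof.
rewrite -{1}(enum_fun_image cJ) big_imset /=; last by move=> i j _ _ /enum_fun_inj.
by apply: eq_bigl => b; rewrite inE.
Qed.

End OrderedEnumeration.

Section PluckerMinors.
Variables (K : fieldType) (n : nat).
Local Notation V := (coord_space K 'I_n).

(** With u as an additional row the determinant on the columns J is 0; expand it along that row. *)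
Lemma minor_linear_relation s (A : s.-tuple V) u (J : {set 'I_n}) :
  u \in <<A>>%VS -> #|J| = s.+1 ->
  \sum_(j in J) (-1) ^+ rank_in J j * u j * minor A (J :\ j) = 0.
Proof.
move=> uA cJ; pose x := enum_fun cJ.
pose a (i : 'I_s.+1) : V := if unlift ord0 i is Some i' then tnth A i' else u.
have a0 : a ord0 = u by rewrite /a unlift_none.
have aS i : a (lift ord0 i) = tnth A i by rewrite /a liftK.
have det0 : pl a x = 0.
  apply/eqP; apply: contraT => pl0.
  have Mu : coord_mx a x \in unitmx by rewrite unitmxE unitfE.
  pose c : 'rV[K]_s.+1 := \row_i (if unlift ord0 i is Some i' then - coord A i' u else 1).
  have /(congr1 (mulmx^~ (invmx (coord_mx a x)))) : c *m coord_mx a x = 0.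
    apply/rowP => b; rewrite !mxE big_ord_recl !mxE unlift_none a0 mul1r.
    rewrite (span_eval _ uA); apply/eqP; rewrite addr_eq0 -sumrN; apply/eqP.
    by apply: eq_bigr => i _; rewrite !mxE liftK aS mulNr opprK.
  rewrite mulmxK // mul0mx => /rowP/(_ ord0); rewrite !mxE unlift_none => /eqP.
  by rewrite oner_eq0.
rewrite (sum_enum_fun cJ) -[RHS]det0 /pl (expand_det_row _ ord0).
apply: eq_bigr => b _; rewrite rank_enum_fun mxE a0 /cofactor add0n.
have cJb : #|J :\ x b| = s.
  by apply: succn_inj; rewrite -cJ (cardsD1 (x b) J) enum_valP.
rewrite (minor_enum A cJb) -mulrA mulrCA; congr (_ * (_ * \det _)).
apply/matrixP => i l; rewrite !mxE aS; congr (tnth A i _).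
exact: enum_fun_setD1.
Qed.

(** Combine the rows with the signed minors on the columns I as coefficients: entry j is the
    determinant on the columns j and I, expanded along column j. This is the cocircuit vector of
    I. *)
Lemma circuit_vector r (A : r.+1.-tuple V) (I : {set 'I_n}) : #|I| = r ->
  exists2 u, u \in <<A>>%VS & forall j,
    u j = if j \in I then 0 else (-1) ^+ rank_in I j * minor A (j |: I).
Proof.
move=> cI; pose y := enum_fun cI.
pose u : V := \sum_(i < r.+1) ((-1) ^+ i * \det (row' i (coord_mx (tnth A) y))) *: tnth A i.
exists u; first by apply: memv_suml => i _; apply/memvZ/memv_span/mem_tnth.
have expand (z : 'I_r.+1 -> 'I_n) t : z \o lift t =1 y ->
    pl (tnth A) z = (-1) ^+ t * u (z t).
  move=> zt; rewrite /pl (expand_det_col _ t) sum_ffunE mulr_sumr.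
  apply: eq_bigr => i _; rewrite !mxE !ffunE /cofactor exprD.
  rewrite (_ : row' i (col' t _) = row' i (coord_mx (tnth A) y)); first by rewrite /GRing.scale /=; ring.
  by apply/matrixP => i' l; rewrite !mxE -zt.
move=> j; have [jI|jI] := boolP (j \in I).
  pose z (b : 'I_r.+1) := if unlift ord0 b is Some b' then y b' else j.
  have := @expand z ord0; rewrite expr0 mul1r /z unlift_none => <-; last first.
    by move=> b; rewrite /= liftK.
  apply/eqP; apply: contraT => /pl_not_inj zI.
  have [b yb] : exists b, y b = j.
    by move: jI; rewrite -(enum_fun_image cI) => /imsetP[b _ ->]; exists b.
  have := zI ord0 (lift ord0 b); rewrite unlift_none liftK yb => /(_ erefl)/eqP.
  by rewrite (negPf (neq_lift _ _)).
have cJ : #|j |: I| = r.+1 by rewrite cardsU1 jI cI.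
pose x := enum_fun cJ.
have [t xt] : exists t, x t = j.
  have : j \in j |: I by rewrite setU11.
  by rewrite -{1}(enum_fun_image cJ) => /imsetP[b _ ->]; exists b.
have tE : rank_in I j = t.
  rewrite -(rank_enum_fun cJ t) -/x xt /rank_in; congr #|pred_of_set _|.
  apply/setP => i; rewrite !inE; case: eqP => // ->; by rewrite ltnn andbF.
have JI : (j |: I) :\ enum_fun cJ t = I by rewrite -/x xt setU1K.
have cIt : #|(j |: I) :\ enum_fun cJ t| = r by rewrite JI.
have xE : pl (tnth A) x = (-1) ^+ t * u j.
  rewrite -xt; apply: expand => b; rewrite /= /x -(enum_fun_setD1 cIt).
  by rewrite (enum_fun_nth cIt j) JI /y (enum_fun_nth cI j).
rewrite (minor_enum A cJ) -/x xE tE mulrA -exprD addnn -signr_odd odd_double.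
by rewrite expr0 mul1r.
Qed.

End PluckerMinors.

Section PluckerRelations.
Variables (K : fieldType) (n : nat).
Local Notation V := (coord_space K 'I_n).
Implicit Types (I J S : {set 'I_n}).

Definition pluck r (A : r.-tuple V) I : K := if #|I| == r then minor A I else 0.

Lemma card_rank J j :
  #|J| = (rank_in J j + (j \in J) + #|[set i in J | (j < i)%N]|)%N.
Proof.
rewrite -(cardsID [set i : 'I_n | (i < j)%N] J) -addnA; congr (_ + _)%N.
  by congr #|pred_of_set _|; apply/setP => i; rewrite !inE.
rewrite (cardsD1 j) !inE ltnn andTb; congr (_ + _)%N.
congr #|pred_of_set _|; apply/setP => i; rewrite !inE -leqNgt.
rewrite ltn_neqAle -val_eqE /= [(i : nat) == j]eq_sym.
by case: (_ == _); case: (_ <= _)%N; case: (_ \in _).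
Qed.

(** The exponent counts elements above j; counting those below j instead costs a sign that does not
    depend on j and leaves the sum. *)
Lemma sgn_rank I J j : j \in J -> j \notin I ->
  (-1) ^+ sgn_exponent j I J =
  (-1) ^+ (#|J|.-1 + #|I|) * ((-1) ^+ rank_in J j * (-1) ^+ rank_in I j) :> K.
Proof.
move=> jJ jI; rewrite (card_rank J j) (card_rank I j) jJ (negPf jI) addn1 addSn /= addn0.
rewrite /sgn_exponent -!exprD -signr_odd -[RHS]signr_odd; congr (_ ^+ nat_of_bool _).
by rewrite !oddD; do 4 case: (odd _).
Qed.

(** Up to sign, the Pluecker relation of I and J is the linear relation on J evaluated at pr_S of
    the cocircuit vector of I. This is the link between the relations and inclusions of
    subspaces. *)
Lemma plucker_relE S I J (p q : {set 'I_n} -> K) (u : V) :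
  (forall j, u j = if j \in I then 0 else (-1) ^+ rank_in I j * p (j |: I)) ->
  plucker_rel S I J p q = (-1) ^+ (#|J|.-1 + #|I|) *
    \sum_(j in J) (-1) ^+ rank_in J j * pr_fun S u j * q (J :\ j).
Proof.
move=> uE; rewrite /plucker_rel mulr_sumr [RHS]big_mkcond [LHS]big_mkcond.
apply: eq_bigr => j _; rewrite !inE negb_or ffunE uE.
have [jJ|//] := boolP (j \in J); rewrite ?andbF // andbT.
case: (boolP (j \in S)) => jS; first by rewrite andbF mulr0 mul0r mulr0.
have [jI|jI] /= := boolP (j \in I); first by rewrite mulr0 mul0r mulr0.
by rewrite sgn_rank //; ring.
Qed.

Lemma plucker_minors r s (A : r.-tuple V) (A' : s.-tuple V) S :
  (pr_space S <<A>> <= <<A'>>)%VS -> plucker_vanish r s S (pluck A) (pluck A').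
Proof.
move=> /subvP AA' I J; case: r A AA' => // r A AA' [cI] cJ.
have [u uA uE] := circuit_vector A cI.
rewrite (@plucker_relE _ _ _ _ _ u); last first.
  by move=> j; rewrite uE; case: ifPn => // jI; rewrite /pluck cardsU1 jI cI eqxx.
have uA' : pr_fun S u \in <<A'>>%VS.
  by apply: AA'; rewrite -[pr_fun S u]lfunE; exact: memv_img.
rewrite -[X in _ * X](_ : 0 = _) ?mulr0 // -[LHS](minor_linear_relation uA' cJ).
apply: eq_bigr => j jJ; rewrite /pluck; have := cJ; rewrite (cardsD1 j) jJ add1n => -[->].
by rewrite eqxx.
Qed.

(** For x outside J0, only the term of x survives in the relation on [x |: J0]. *)
Lemma vanish_on_basis s (A : s.-tuple V) (J0 : {set 'I_n}) (w : V) :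
  #|J0| = s -> minor A J0 != 0 -> (forall j, j \in J0 -> w j = 0) ->
  (forall J, #|J| = s.+1 -> \sum_(j in J) (-1) ^+ rank_in J j * w j * minor A (J :\ j) = 0) ->
  w = 0.
Proof.
move=> cJ0 AJ0 w0 rel; apply/ffunP => x; rewrite [RHS]ffunE.
have [/w0 //|xJ0] := boolP (x \in J0).
have := rel (x |: J0); rewrite cardsU1 xJ0 cJ0 => /(_ erefl).
rewrite (bigD1 x) ?setU11 //= setU1K // big1 ?addr0 => [/eqP|j].
  by rewrite !mulf_eq0 signr_eq0 (negPf AJ0) orbF => /eqP.
by rewrite !inE => /andP[/orP[/eqP ->|/w0 ->]]; [rewrite eqxx | rewrite mulr0 mul0r].
Qed.

(** The cocircuit vector of [J0 :\ j] vanishes on J0 except at j. It is kept unscaled as [u] because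
    the Pluecker relations are about this form. *)
Lemma dual_basis s (A : s.-tuple V) (J0 : {set 'I_n}) j :
  #|J0| = s -> minor A J0 != 0 -> j \in J0 ->
  exists (c : K) (I : {set 'I_n}) (u : V), [/\ #|I|.+1 = s, u \in <<A>>%VS,
    forall i, u i = if i \in I then 0 else (-1) ^+ rank_in I i * pluck A (i |: I) &
    forall i, i \in J0 -> (c *: u) i = (i == j)%:R].
Proof.
move=> cJ0 AJ0 jJ0; case: s A cJ0 AJ0 => [|s] A cJ0 AJ0.
  by move/eqP: cJ0; rewrite cards_eq0 => /eqP J00; rewrite J00 inE in jJ0.
have cI : #|J0 :\ j| = s by have := cJ0; rewrite (cardsD1 j) jJ0 add1n => -[].
have [u uA uE] := circuit_vector A cI.
have uj : u j != 0.
  by rewrite uE !inE eqxx /= finset.setD1K // mulf_neq0 ?signr_eq0.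
exists (u j)^-1, (J0 :\ j), u; split=> //.
- by rewrite cI.
- move=> i; rewrite uE; case: ifPn => // iI.
  by rewrite /pluck cardsU1 iI cI eqxx.
- move=> i iJ0; rewrite ffunE; have [->|ij] := eqVneq i j; first exact: mulVf.
  have iI : i \in J0 :\ j by rewrite !inE ij.
  by rewrite (uE i) iI [LHS]mulr0.
Qed.

Lemma span_of_relation s (A : s.-tuple V) (J0 : {set 'I_n}) (w : V) :
  #|J0| = s -> minor A J0 != 0 ->
  (forall J, #|J| = s.+1 -> \sum_(j in J) (-1) ^+ rank_in J j * w j * minor A (J :\ j) = 0) ->
  w \in <<A>>%VS.
Proof.
move=> cJ0 AJ0 rel.
have /choice[e eP] (j : 'I_n) : exists e : V, e \in <<A>>%VS /\
    (j \in J0 -> forall i, i \in J0 -> e i = (i == j)%:R).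
  have [jJ0|jJ0] := boolP (j \in J0); last by exists 0; rewrite mem0v.
  have [c [I [u [_ uA _ ue]]]] := dual_basis cJ0 AJ0 jJ0.
  by exists (c *: u); rewrite memvZ.
pose w' := \sum_(j in J0) w j *: e j.
have w'A : w' \in <<A>>%VS by apply: memv_suml => j _; apply: memvZ; case: (eP j).
suff /eqP : w - w' = 0 by rewrite subr_eq0 => /eqP ->.
apply: (vanish_on_basis cJ0 AJ0) => [j jJ0|J cJ].
  rewrite !ffunE sum_ffunE (bigD1 j) //= big1 ?addr0 => [|i /andP[iJ0 ij]].
    by rewrite !ffunE (proj2 (eP j)) // eqxx [X in _ - X]mulr1 subrr.
  by rewrite ffunE (proj2 (eP i)) // eq_sym (negPf ij) [LHS]mulr0.
have := congr2 (fun x y => x - y) (rel J cJ) (minor_linear_relation w'A cJ).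
rewrite /= subrr -sumrB => relB; rewrite -[RHS]relB.
by apply: eq_bigr => j _; rewrite !ffunE mulrBr mulrBl.
Qed.

(** The dual basis at I0 spans the first space and consists of multiples of cocircuit vectors, for
    which the relations say that the projection lies in the second space. *)
Lemma plucker_incidence r s (A : r.-tuple V) (A' : s.-tuple V) S I0 J0 :
  #|I0| = r -> minor A I0 != 0 -> #|J0| = s -> minor A' J0 != 0 ->
  plucker_vanish r s S (pluck A) (pluck A') -> (pr_space S <<A>> <= <<A'>>)%VS.
Proof.
move=> cI0 AI0 cJ0 AJ0 van; rewrite pr_space_span; apply/span_subvP => _ /mapP[w wA ->].
have {wA} : w \in <<A>>%VS by exact: memv_span.
have /choice[e eP] (j : 'I_n) : exists e : V, e \in <<A>>%VS /\
    (j \in I0 -> pr_fun S e \in <<A'>>%VS /\ forall i, i \in I0 -> e i = (i == j)%:R).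
  have [jI0|jI0] := boolP (j \in I0); last by exists 0; rewrite mem0v.
  have [c [I [u [cI uA uE ue]]]] := dual_basis cI0 AI0 jI0.
  exists (c *: u); rewrite memvZ //; split=> // _; split=> //.
  rewrite linearZ; apply/memvZ/(span_of_relation cJ0 AJ0) => J cJ.
  have /eqP := van I J cI cJ; rewrite (plucker_relE _ _ _ uE) mulf_eq0 signr_eq0 /= => /eqP rel0.
  rewrite -[RHS]rel0; apply: eq_bigr => j' jJ; rewrite /pluck; have := cJ; rewrite (cardsD1 j') jJ add1n => -[->].
  by rewrite eqxx.
move=> wA; pose w' := \sum_(j in I0) w j *: e j.
have w'A : w' \in <<A>>%VS by apply: memv_suml => j _; apply: memvZ; case: (eP j).
have -> : w = w'.
  apply/eqP; rewrite -subr_eq0; apply/eqP; apply: (vanish_on_basis cI0 AI0) => [j jI0|J cJ].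
    rewrite !ffunE sum_ffunE (bigD1 j) //= big1 ?addr0 => [|i /andP[iI0 ij]].
      have [_ /(_ jI0)[_ ej]] := eP j.
      by rewrite !ffunE ej // eqxx [X in _ - X]mulr1 subrr.
    have [_ /(_ iI0)[_ ei]] := eP i.
    by rewrite ffunE ei // eq_sym (negPf ij) [LHS]mulr0.
  by rewrite (minor_linear_relation _ cJ) //; exact: memvB.
rewrite linear_sum; apply: memv_suml => j jI0; rewrite linearZ; apply: memvZ.
by have [_ /(_ jI0)[]] := eP j.
Qed.

End PluckerRelations.

(** * Subspaces from solutions of the Pluecker relations *)

Section Reconstruction.
Variables (K : fieldType) (n : nat).
Local Notation V := (coord_space K 'I_n).
Implicit Types (I J S : {set 'I_n}).

Lemma pr_space0 (L : {vspace V}) : pr_space finset.set0 L = L.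
Proof.
rewrite -[RHS]lim1g; congr (_ @: L)%VS; apply/lfunP => u.
by rewrite lfunE id_lfunE; apply/ffunP => e; rewrite !ffunE inE.
Qed.

(* The relation for [J :\ j] and [j |: I0] expresses [p J * p I0] through sets that
   are nearer to [I0] than [J]. *)
Lemma plucker_determined r (p q : {set 'I_n} -> K) I0 (c : K) :
  plucker_vanish r r finset.set0 p p -> plucker_vanish r r finset.set0 q q ->
  #|I0| = r -> p I0 != 0 -> c != 0 -> q I0 = c * p I0 ->
  (forall i x, i \in I0 -> q (x |: I0 :\ i) = c * p (x |: I0 :\ i)) ->
  forall J, #|J| = r -> q J = c * p J.
Proof.
move=> pvan qvan cI0 pI0 c0 qI0 near J; move mE: #|J :\: I0| => m.
elim: m J mE => [|[|m] IHm] J mE cJ.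
- have JI0 : J \subset I0 by rewrite -finset.setD_eq0 -cards_eq0 mE.
  suff -> : J = I0 by [].
  by apply/eqP; rewrite eqEcard JI0 cI0 cJ /=.
- have [x xE] := cards1P (introT eqP mE).
  have cDI : #|I0 :\: J| = 1%N.
    have := cardsID J I0; have := cardsID I0 J; rewrite mE finset.setIC; lia.
  have [i iE] := cards1P (introT eqP cDI).
  suff -> : J = x |: I0 :\ i.
    by apply: near; have : i \in I0 :\: J by [rewrite iE set11]; rewrite inE => /andP[].
  apply/setP => y; move/setP/(_ y): xE; move/setP/(_ y): iE; rewrite !inE.
  by case: (y \in J); case: (y \in I0) => /= <- <-.
have [j] : exists j, j \in J :\: I0 by apply/set0Pn; rewrite -cards_eq0 mE.
rewrite inE => /andP[jI0 jJ].
pose I := J :\ j; pose J' := j |: I0.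
have cI : #|I|.+1 = r by rewrite -cJ (cardsD1 j J) jJ.
have cJ' : #|J'| = r.+1 by rewrite cardsU1 jI0 cI0.
have jJ' : j \in J' by rewrite setU11.
have := congr2 (fun x y => x - c ^+ 2 * y) (qvan I J' cI cJ') (pvan I J' cI cJ').
rewrite /plucker_rel mulr0 subrr mulr_sumr -sumrB (bigD1 j); last first.
  by rewrite !inE eqxx.
rewrite /= big1 ?addr0 => [|x /andP[]].
  rewrite [j |: I]finset.setD1K // [J' :\ j]finset.setU1K // qI0.
  move/eqP; rewrite (_ : _ - _ = (-1) ^+ sgn_exponent j I J' * (c * p I0) * (q J - c * p J)).
    rewrite !mulf_eq0 signr_eq0 (negPf c0) (negPf pI0) /= subr_eq0.
    by move/eqP.
  by ring.
rewrite !inE orbF => /andP[xI /orP[/eqP ->|xI0]]; rewrite ?eqxx // => xj.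
have xJ : x \notin J by apply: contra xI => xJ; rewrite xj.
have -> : J' :\ x = j |: I0 :\ x.
  by apply/setP => y; rewrite !inE; case: eqP => // ->; rewrite (negPf xj).
rewrite (near x j) // IHm; first by ring.
- have := mE; rewrite (cardsD1 j) !inE jI0 jJ add1n => -[<-].
  congr #|pred_of_set _|; apply/setP => y; rewrite !inE.
  by case: (eqVneq y x) => [->|_]; rewrite ?xI0 ?andbF //= andbCA.
- by rewrite cardsU1 !inE xj (negPf xJ).
Qed.

Lemma ffun_combE (c d : K) (f g : V) x :
  (c *: f - d *: g) x = c * f x - d * g x :> K.
Proof. by rewrite !ffunE. Qed.

(** The rows are the cocircuit vectors of the [I0 :\ i], written with p in place of minors; they are
    diagonal on the columns I0. This settles the coordinates one exchange away from I0, and the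
    relations force the others. *)
Lemma plucker_reconstruct r (p : {set 'I_n} -> K) :
  (forall I, #|I| != r -> p I = 0) -> (exists I, p I != 0) ->
  plucker_vanish r r finset.set0 p p ->
  exists (A : r.-tuple V) (c : K), c != 0 /\ forall I, pluck A I = c * p I.
Proof.
move=> pr [I0 pI0] van.
have cI0 : #|I0| = r by apply/eqP; apply: contraNT pI0 => /pr ->.
suff [A [c [c0 qI0 near]]] : exists (A : r.-tuple V) (c : K), [/\ c != 0,
    pluck A I0 = c * p I0 &
    forall i x, i \in I0 -> pluck A (x |: I0 :\ i) = c * p (x |: I0 :\ i)].
  exists A, c; split=> // I; have [cI|cI] := eqVneq #|I| r.
    apply: (plucker_determined van _ cI0 pI0 c0 qI0 near cI).
    by apply: plucker_minors; rewrite pr_space0.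
  by rewrite pr // mulr0 /pluck (negPf cI).
case: r pr van cI0 => [|r] pr van cI0.
  (* In rank 0 the only coordinate is that of the empty set, and the empty minor is 1. *)
  exists [tuple], (p I0)^-1; rewrite invr_eq0 pI0 mulVf //; split=> //.
    by rewrite /pluck cI0 /= /minor det_mx00.
  by move=> i x; move/eqP: cI0; rewrite cards_eq0 => /eqP ->; rewrite inE.
pose x0 := enum_fun cI0.
pose a i : V := [ffun x => if x \in I0 :\ i then 0 else
  (-1) ^+ rank_in (I0 :\ i) x * p (x |: I0 :\ i)].
pose A := [tuple a (x0 k) | k < r.+1].
have aI0 i : i \in I0 -> a i i = (-1) ^+ rank_in (I0 :\ i) i * p I0.
  by move=> iI0; rewrite ffunE !inE eqxx /= finset.setD1K.
have aA i : i \in I0 -> a i \in <<A>>%VS.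
  rewrite -(enum_fun_image cI0) => /imsetP[k _ ->]; apply: memv_span.
  by rewrite -(tnth_mktuple (fun k => a (x0 k)) k) mem_tnth.
have AI0 : minor A I0 != 0.
  rewrite (minor_enum A cI0) /pl.
  have -> : coord_mx (tnth A) x0 = diag_mx (\row_k (a (x0 k) (x0 k))).
    apply/matrixP => k l; rewrite !mxE tnth_mktuple; have [->|kl] := eqVneq k l.
      by rewrite mulr1n.
    rewrite mulr0n ffunE !inE (inj_eq (@enum_fun_inj _ _ _ _)) eq_sym kl /=.
    by rewrite enum_valP.
  rewrite det_diag; apply/prodf_neq0 => k _; rewrite mxE aI0 ?enum_valP //.
  by rewrite mulf_neq0 ?signr_eq0.
have qI0 : pluck A I0 = minor A I0 by rewrite /pluck cI0 eqxx.
exists A, (minor A I0 / p I0); split; first by rewrite mulf_neq0 ?invr_eq0.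
  by rewrite qI0 divfK.
move=> i x iI0; have cI : #|I0 :\ i| = r by have := cI0; rewrite (cardsD1 i) iI0 add1n => -[].
have [xI|xI] := boolP (x \in I0 :\ i).
  have c2 : #|x |: I0 :\ i| == r.+1 = false.
    by rewrite cardsU1 xI cI; apply/eqP; lia.
  by rewrite /pluck c2 (pr _ (negbT c2)) mulr0.
have [u uA uE] := circuit_vector A cI.
(* Both vectors vanish on I0 except at i, so this combination vanishes on I0, hence everywhere. *)
pose w := a i i *: u - u i *: a i.
have wA : w \in <<A>>%VS by apply: memvB; apply: memvZ => //; exact: aA.
have w0 : w = 0.
  apply: (vanish_on_basis cI0 AI0) => [j jI0|J cJ]; last exact: minor_linear_relation.
  rewrite ffun_combE; have [->|ji] := eqVneq j i; first by rewrite mulrC subrr.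
  have jI : j \in I0 :\ i by rewrite !inE ji.
  by rewrite (uE j) (ffunE _ j) jI !mulr0 subrr.
have := congr1 (fun f : V => f x) w0; rewrite ffun_combE [RHS]ffunE aI0 // (uE x) (negPf xI) (uE i).
rewrite !inE eqxx /= finset.setD1K // (ffunE _ x) (negPf xI).
rewrite /pluck cardsU1 xI cI eqxx => /eqP; rewrite subr_eq0 => /eqP eqx.
apply: (mulfI pI0); rewrite mulrA [p I0 * (_ / _)]mulrC divfK //.
have s0 : (-1) ^+ rank_in (I0 :\ i) i * (-1) ^+ rank_in (I0 :\ i) x != 0 :> K.
  by rewrite mulf_neq0 ?signr_eq0.
apply: (mulfI s0); move: eqx; move: (_ ^+ _) (_ ^+ _) => e e' eqx.
by rewrite mulrACA eqx; ring.
Qed.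

End Reconstruction.

(** * Closures in tropical projective spaces *)

Section TropicalOpenSets.
Variables (R : realType) (N : eqType).

(* [f J - f J0 > a] with [f J0] finite, in a form invariant under adding constants
   to f and visibly open. *)
Definition exceeds (f : N -> \bar R) (J J0 : N) (a : R) : Prop :=
  exists q : R, (f J0 < (q - a)%:E)%E /\ (q%:E < f J)%E.

Lemma exceeds_shift (f g : N -> \bar R) J J0 a (c : R) :
  (forall x, g x = (f x + c%:E)%E) -> exceeds f J J0 a -> exceeds g J J0 a.
Proof.
move=> gE [q [q1 q2]]; exists (q + c); rewrite !gE; split.
  rewrite -lteBrDr // -EFinB; by rewrite (_ : q + c - a - c = q - a) //; ring.
by rewrite EFinD lteD2rE.
Qed.

Definition exceeds_class J J0 a : set (trop_proj R N) :=
  [set q | exists2 w : trop_vec R N, \pi_(trop_proj R N)%qT w = q & exceeds (val w) J J0 a]%classic.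

Lemma exceeds_classE J J0 a (w : trop_vec R N) :
  exceeds_class J J0 a (\pi_(trop_proj R N)%qT w) <-> exceeds (val w) J J0 a.
Proof.
split=> [[w' /eqquotP/asboolP[c cE]]|]; last by exists w.
exact: exceeds_shift cE.
Qed.

Lemma open_exceeds_class J J0 a : open (exceeds_class J J0 a).
Proof.
rewrite /open /= /quotient_open.
rewrite (_ : _ @^-1` _ = \bigcup_(q in [set: R])
    ((fun w : trop_vec R N => val w J0) @^-1` [set x | x < (q - a)%:E]%E `&`
     (fun w : trop_vec R N => val w J) @^-1` [set x | q%:E < x]%E))%classic; last first.
  apply/seteqP; split=> w.
    by move/exceeds_classE => -[q [q1 q2]]; exists q.
  by move=> [q _ [q1 q2]]; apply/exceeds_classE; exists q.
have cont (x : N) : continuous (fun w : trop_vec R N => val w x).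
  move=> w; apply: (@continuous_comp _ _ _ (fun w : trop_vec R N => val w) (@proj N (fun=> \bar R) x)).
    exact: initial_continuous.
  exact: proj_continuous.
apply: bigcup_open => q _; apply: openI.
  by apply: open_comp => [w _|]; [exact: cont | exact: open_ereal_lt_ereal].
by apply: open_comp => [w _|]; [exact: cont | exact: open_ereal_gt_ereal].
Qed.

End TropicalOpenSets.

Section TropicalClosure.
Variables (R : realType) (K : fieldType) (v : valuation R K) (n k : nat).
Variables (r : 'I_k.+1 -> nat) (X : (forall i, proj_point K n (r i)) -> Prop).

(** The traces on X of the neighbourhoods of a point of the closure generate a proper filter; the
    ultrafilter refines it. *)
Lemma closure_ultrafilter (mu : forall i, valuated_matroid R 'I_n (r i)) :
  trop_closure v X (fun i => valmat_class (mu i)) ->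
  exists U : set_system (forall i, proj_point K n (r i)),
    [/\ UltraFilter U, \forall p \near U, X p &
      forall i (J J0 : {set 'I_n}) a, #|J| = r i -> #|J0| = r i ->
        exceeds (mu i) J J0 a -> U [set p : forall i, proj_point K n (r i) | exceeds (fun I => v (p i I)) J J0 a]%classic].
Proof.
move=> clmu; pose m : trop_proj_prod R n r := fun i => valmat_class (mu i).
pose B (V : set (trop_proj_prod R n r)) : set (forall i, proj_point K n (r i)) :=
  [set p | X p /\ V (fun i => trop_point v (p i))]%classic.
have FB : ProperFilter (filter_from (nbhs m) B).
  apply: filter_from_proper.
    apply: filter_from_filter; first by exists setT; exact: filterT.
    move=> V V' mV mV'; exists (V `&` V')%classic; first exact: filterI.
    by move=> p [Xp [Vp V'p]].
  move=> V mV; have [_ [[p Xp ->] Vp]] := clmu V mV.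
  by exists p.
have [U [UU FU]] := ultraFilterLemma FB.
exists U; split=> //.
  by apply: FU; exists setT; [exact: filterT | move=> p []].
move=> i J J0 a cJ cJ0 muJ; apply: FU.
have hJ : #|J| == r i by apply/eqP.
have hJ0 : #|J0| == r i by apply/eqP.
pose N := {I : {set 'I_n} | #|I| == r i}.
pose jJ : N := exist _ J hJ; pose jJ0 : N := exist _ J0 hJ0.
exists (@proj _ (fun i => trop_proj R (subsets_of_card n (r i))) i @^-1`
  (exceeds_class jJ jJ0 a : set (trop_proj R (subsets_of_card n (r i)))))%classic.
  apply: open_nbhs_nbhs; split.
    by apply: open_comp => [w _|]; [exact: proj_continuous | exact: open_exceeds_class].
  exact/exceeds_classE.
by move=> p [Xp /exceeds_classE].
Qed.

End TropicalClosure.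

(** * Degenerate flags *)

(** The same sum as [plucker_rel] over any commutative ring, so that the relations become
    polynomials in unknown coordinates. *)
Definition plucker_poly (A : comNzRingType) n (S I J : {set 'I_n})
    (p q : {set 'I_n} -> A) : A :=
  \sum_(j in J :\: (I :|: S))
    (-1) ^+ sgn_exponent j I J * p (j |: I) * q (J :\ j).

Lemma rmorph_plucker_poly (A B : comNzRingType) (f : {rmorphism A -> B}) n
    (S I J : {set 'I_n}) p q :
  f (plucker_poly S I J p q) = plucker_poly S I J (f \o p) (f \o q).
Proof.
by rewrite rmorph_sum; apply: eq_bigr => j _; rewrite !rmorphM rmorph_sign.
Qed.

Lemma plucker_relZ (K : fieldType) n (S I J : {set 'I_n}) (a b : K) (p q p' q' : {set 'I_n} -> K) :
  (forall I, p' I = a * p I) -> (forall I, q' I = b * q I) ->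
  plucker_rel S I J p' q' = a * b * plucker_rel S I J p q.
Proof.
move=> pE qE; rewrite /plucker_rel mulr_sumr; apply: eq_bigr => j _.
by rewrite pE qE; ring.
Qed.

Section Degenerations.
Variables (K : fieldType) (n k : nat) (S : 'I_k -> {set 'I_n}).

Lemma degeneration_union_diag (i : 'I_k.+1) : degeneration_union S i i = finset.set0.
Proof.
by apply: big_pred0 => l; apply/negbTE/negP => /andP[/leq_ltn_trans H /H]; rewrite ltnn.
Qed.

Lemma degeneration_union_tgt (i : 'I_k.+1) (l : 'I_k) : (i <= l)%N ->
  degeneration_union S i (tgt l) = degeneration_union S i (src l) :|: S l.
Proof.
move=> il; rewrite /degeneration_union (bigD1 l) /=; last by rewrite il /bump /= add1n.
rewrite finset.setUC; congr (_ :|: _); apply: eq_bigl => l'.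
by rewrite /bump /= add1n ltnS -(inj_eq val_inj) /= -andbA [(l' <= l)%N && _]andbC -ltn_neqAle.
Qed.

Lemma pr_spaceU (X Y : {set 'I_n}) (L : {vspace coord_space K 'I_n}) :
  pr_space (X :|: Y) L = pr_space Y (pr_space X L).
Proof.
rewrite /pr_space -limg_comp; congr (_ @: L)%VS; apply/lfunP => u.
rewrite comp_lfunE !lfunE; apply/ffunP => e; rewrite !ffunE inE.
by case: (e \in X); case: (e \in Y).
Qed.

Lemma degeneration_inclusion (L : 'I_k.+1 -> {vspace coord_space K 'I_n}) :
  (forall i, pr_space (S i) (L (src i)) <= L (tgt i))%VS ->
  forall i j : 'I_k.+1, (i <= j)%N -> (pr_space (degeneration_union S i j) (L i) <= L j)%VS.
Proof.
move=> LS i j; move dE: (j - i)%N => d; elim: d j dE => [|d IHd] j dE ij.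
  have -> : j = i by apply/val_inj/eqP; rewrite eqn_leq ij -subn_eq0 dE.
  by rewrite degeneration_union_diag pr_space0.
have [l jl] : exists l, j = tgt l.
  have j0 : (0 < j)%N by lia.
  have jk : (j.-1 < k)%N by have := ltn_ord j; lia.
  by exists (Ordinal jk); apply/val_inj; rewrite /= /bump /= add1n prednK.
have il : (i <= l)%N by move: dE; rewrite jl /= /bump /= add1n; lia.
rewrite jl degeneration_union_tgt // pr_spaceU.
apply: subv_trans (LS l); apply: limgS; apply: IHd => //.
by move: dE; rewrite jl /= /bump /= add1n; lia.
Qed.

End Degenerations.

Section FlagsToPoints.
Variables (R : realType) (K : fieldType) (v : valuation R K) (n k : nat).
Variables (r : 'I_k.+1 -> nat) (S : 'I_k -> {set 'I_n}).
Variable mu : forall i, valuated_matroid R 'I_n (r i).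

(** The inclusions of consecutive projections compose to those for all i < j, so the point lies in
    the tropicalization itself. *)
Lemma flags_in_trop (L : 'I_k.+1 -> {vspace coord_space K 'I_n}) :
  realizations v mu L -> (forall i, pr_space (S i) (L (src i)) <= L (tgt i))%VS ->
  trop v (@LFl K n k r S) (fun i => valmat_class (mu i)).
Proof.
move=> Lmu LS.
pose A i := s2val (cid2 (Lmu i).2).
have AL i : <<A i>>%VS = L i by exact: (s2valP (cid2 (Lmu i).2)).
have Amu i : vequiv (minor_valuation v (A i)) (mu i) by exact: (s2valP' (cid2 (Lmu i).2)).
have pE i (I : {set 'I_n}) : #|I| != r i -> pluck (A i) I = 0.
  by rewrite /pluck => /negPf ->.
have p0 i : exists I, pluck (A i) I != 0.
  have [I] := valmat_finite (mu i); rewrite (vequiv_fin I (Amu i)) minor_valuation_fin.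
  by case/andP => /eqP cI AI; exists I; rewrite /pluck cI eqxx.
exists (fun i => ProjPoint (pE i) (p0 i)).
  split=> [i|i j ij]; apply: plucker_minors; rewrite ?pr_space0 // !AL.
  exact: degeneration_inclusion LS i j (ltnW ij).
apply: functional_extensionality_dep => i; apply/esym/eqquotP/asboolP.
have [c cE] := Amu i; exists c => -[I cI] /=.
by rewrite cE /minor_valuation /pluck cI.
Qed.

End FlagsToPoints.

Lemma exceeds_ratio (R : realType) (K : fieldType) (v : valuation R K) (N : eqType)
    (p : N -> K) J J0 a : exceeds (fun I => v (p I)) J J0 a ->
  p J0 != 0 /\ (a%:E < v (p J / p J0)%R)%E.
Proof.
move=> [q [q1 q2]]; have p0 : p J0 != 0.
  by apply: contraTneq q1 => ->; rewrite valuation0 -leNgt leey.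
split=> //; rewrite valuationM valuationV //.
move: q1 q2; have := valuation_fin v p0; have := valuation_neqNy v (p J).
case: (v (p J0)) => // b; case: (v (p J)) => [c| |] // _ _.
  by rewrite -EFinN -EFinD !lte_fin; lra.
by move=> _ _; rewrite addye ?ltry.
Qed.

(** * From a point of the closure to a flag *)

Section PointsToFlags.
Variables (R : realType) (K : closedFieldType) (v : valuation R K) (n k : nat).
Variables (r : 'I_k.+1 -> nat) (S : 'I_k -> {set 'I_n}).
Variable mu : forall i, valuated_matroid R 'I_n (r i).
Hypothesis mu_realizable : forall i : 'I_k.+1,
  exists L : {vspace coord_space K 'I_n}, realizes v (r i) L (mu i).

Lemma closure_lift (J0 : 'I_k.+1 -> {set 'I_n}) :
  (forall i, mu i (J0 i) != +oo%E) ->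
  trop_closure v (@LFl K n k r S) (fun i => valmat_class (mu i)) ->
  exists y : 'I_k.+1 -> {set 'I_n} -> K,
    (forall i J, mu i J = mu i (J0 i) + v (y i J))%E /\
    (forall i j : 'I_k.+1, (i <= j)%N ->
       plucker_vanish (r i) (r j) (degeneration_union S i j) (y i) (y j)).
Proof.
move=> J0fin clmu; have [U [UU Ufl Uex]] := closure_ultrafilter clmu.
have J0card i : #|J0 i| = r i.
  by apply/eqP; apply: contraTT (J0fin i) => /valmat_card ->.
pose T : finType := ('I_k.+1 * {set 'I_n})%type.
(* Realizability enters here: quotients of minors are elements of K with the values mu_i(J) -
   mu_i(J0), whereas an arbitrary real number need not be a value. *)
have /choice[c Hc] (t : T) : exists c : K, mu t.1 t.2 != +oo%E ->
    c != 0 /\ mu t.1 t.2 = (mu t.1 (J0 t.1) + v c)%E.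
  case: t => i J /=; have [->|Jfin] := eqVneq (mu i J) +oo%E; first by exists 0.
  have [L [_ [A _ [d dE]]]] := mu_realizable i.
  have mE I : mu i I != +oo%E -> minor A I != 0 /\ mu i I = (v (minor A I) + d%:E)%E.
    move=> If; have := If; rewrite dE {1}/minor_valuation; case: ifP => // cI.
    rewrite /minor_valuation cI => vI; split=> //.
    by apply: contraNneq vI => ->; rewrite valuation0.
  have [AJ ->] := mE J Jfin; have [AJ0 ->] := mE (J0 i) (J0fin i).
  exists (minor A J / minor A (J0 i)) => _; rewrite mulf_neq0 ?invr_eq0 //; split=> //.
  rewrite valuationM valuationV //; have := valuation_fin v AJ; have := valuation_fin v AJ0.
  case: (v (minor A J)) => // a; case: (v (minor A (J0 i))) => // b _ _.
  by rewrite -!EFinN -!EFinD; congr (_%:E); ring.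
pose X := forall i, proj_point K n (r i).
have [p0 _] := filter_ex Ufl.
pose I : pointedType := HB.pack X (gen_eqMixin X) (gen_choiceMixin X) (isPointed.Build X p0).
pose x (t : T) (p : I) : K := (p : X) t.1 t.2 / (p : X) t.1 (J0 t.1).
have UI : UltraFilter (U : set_system I) by [].
have mu_real i J : mu i J != +oo%E -> exists a : R, mu i J = a%:E.
  move=> Jf; exists (fine (mu i J)); rewrite fineK // fin_numE Jf andbT.
  exact: valmat_neqNy.
have cardJ i J : mu i J != +oo%E -> #|J| = r i.
  by move=> Jf; apply/eqP; apply: contraTT Jf => /valmat_card ->.
have v_c (t : T) : mu t.1 t.2 != +oo%E -> exists a b : R,
    [/\ mu t.1 t.2 = b%:E, mu t.1 (J0 t.1) = a%:E & v (c t) = (b - a)%:E].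
  move=> tf; have [c0 cE] := Hc t tf.
  have [b bE] := mu_real _ _ tf; have [a aE] := mu_real _ _ (J0fin t.1).
  exists a, b; split=> //; move: cE; rewrite bE aE; have := valuation_fin v c0.
  by case: (v (c t)) => // d _ /eqP; rewrite -EFinD eqe => /eqP ->; congr (_%:E); ring.
have xlo (t : T) (e : R) : mu t.1 t.2 != +oo%E -> 0 < e ->
    U [set p : X | (v (c t) - e%:E < v (x t p))%E]%classic.
  move=> tf e0; have [a [b [bE aE ->]]] := v_c t tf.
  have ex : exceeds (mu t.1) t.2 (J0 t.1) (b - a - e).
    by exists (b - e / 2); rewrite bE aE !lte_fin; split; lra.
  apply: filterS (Uex _ _ _ _ (cardJ _ _ tf) (J0card t.1) ex) => p /exceeds_ratio[_].
  by rewrite EFinB.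
have xhi (t : T) (e : R) : mu t.1 t.2 != +oo%E -> 0 < e ->
    U [set p : X | (v (x t p) < v (c t) + e%:E)%E]%classic.
  move=> tf e0; have [a [b [bE aE ->]]] := v_c t tf.
  have ex : exceeds (mu t.1) (J0 t.1) t.2 (a - b - e).
    by exists (a - e / 2); rewrite bE aE !lte_fin; split; lra.
  (* Comparing J0 with itself says that the coordinate at J0 is nonzero along the ultrafilter. *)
  have ex0 : exceeds (mu t.1) (J0 t.1) (J0 t.1) (-1).
    by exists (a - 1 / 2); rewrite aE !lte_fin; split; lra.
  have := Uex _ _ _ _ (J0card t.1) (cardJ _ _ tf) ex.
  apply: filterS2 (Uex _ _ _ _ (J0card t.1) (J0card t.1) ex0) => p.
  move=> /exceeds_ratio[p00 _] /exceeds_ratio[pt0].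
  rewrite /mkset /x !valuationM !valuationV //.
  have := valuation_fin v p00; have := valuation_fin v pt0.
  case: (v (p t.1 t.2)) => // b' _; case: (v (p t.1 (J0 t.1))) => // a' _.
  by rewrite -!EFinN -!EFinD !lte_fin; lra.
have xoo (t : T) (M : R) : mu t.1 t.2 = +oo%E ->
    U [set p : X | (M%:E <= v (x t p))%E]%classic.
  move=> toy; have [ct|ct] := eqVneq #|t.2| (r t.1); last first.
    by apply: filterE => p; rewrite /mkset /x (@coord_card _ _ _ ((p : X) t.1) t.2 ct) mul0r valuation0 leey.
  have [a aE] := mu_real _ _ (J0fin t.1).
  have ex : exceeds (mu t.1) t.2 (J0 t.1) M.
    by exists (a + M + 1); rewrite aE toy ltry lte_fin; split=> //; lra.
  by apply: filterS (Uex _ _ _ _ ct (J0card t.1) ex) => p /exceeds_ratio[_ /ltW].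
pose N := #|T|; pose var (t : T) : mvpoly N K := mvvar N K (enum_rank t).
pose cst : {rmorphism K -> mvpoly N K} := mvconst N K.
pose xs (m : nat) (p : I) : K :=
  if insub m is Some a then x (enum_val (a : 'I_N)) p else 0.
have xsE p t : mvev N idfun (xs^~ p) (var t) = x t p.
  by rewrite mvev_var ?ltn_ord // /xs valK enum_rankK.
have cstE b d : mvev N idfun b (cst d) = d by rewrite mvev_const.
pose P (i j : 'I_k.+1) (I0 J : {set 'I_n}) := plucker_poly (degeneration_union S i j) I0 J
   (fun I => var (i, I)) (fun J => var (j, J)).
have PE b (i j : 'I_k.+1) (I0 J : {set 'I_n}) : mvev N idfun b (P i j I0 J) =
    plucker_rel (degeneration_union S i j) I0 J
      (fun I => mvev N idfun b (var (i, I))) (fun J => mvev N idfun b (var (j, J))).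
  by rewrite rmorph_plucker_poly.
pose T2 : finType := (('I_k.+1 * 'I_k.+1) * ({set 'I_n} * {set 'I_n}))%type.
(* The equations are the Pluecker relations, the case i = j included, and the vanishing of the
   coordinates of infinite value. The two lists of pairs express that a coordinate and its constant
   divide each other. *)
pose D : conditions (mvpoly N K) :=
  ([seq P q.1.1 q.1.2 q.2.1 q.2.2 |
      q : T2 <- enum T2 &
      [&& (q.1.1 <= q.1.2)%N, #|q.2.1|.+1 == r q.1.1 & #|q.2.2| == (r q.1.2).+1]] ++
   [seq var t | t <- enum T & mu t.1 t.2 == +oo%E],
   [seq (var t, cst (c t)) | t <- enum T & mu t.1 t.2 != +oo%E] ++
   [seq (cst (c t), var t) | t <- enum T & mu t.1 t.2 != +oo%E]).
have [|e|q|y [yE yQ]] := @ultralimit_lifting R K v I U UI N xs D.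
- move=> m; rewrite /xs; case: insub => [a|]; last first.
    by exists 0; apply: eventually_ge_cst; rewrite valuation0 leey.
  have [toy|tf] := eqVneq (mu (enum_val a).1 (enum_val a).2) +oo%E.
    by exists 0; exact: xoo.
  have [a' [b' [_ _ vc]]] := v_c _ tf; exists (b' - a' - 1).
  apply: filterS (xlo _ 1 tf ltr01) => p /= /ltW; by rewrite vc -EFinB.
- rewrite mem_cat => /orP[] /mapP[q]; rewrite mem_filter => /andP[].
    move=> /and3P[ij /eqP cI /eqP cJ] _ -> M; apply: filterS Ufl => p [p1 p2].
    rewrite PE (_ : plucker_rel _ _ _ _ _ = 0) ?valuation0 ?leey //.
    rewrite (@plucker_relZ _ _ _ _ _ ((p : X) q.1.1 (J0 q.1.1))^-1
       ((p : X) q.1.2 (J0 q.1.2))^-1 (p q.1.1) (p q.1.2)); last 2 first.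
    - by move=> I1; rewrite xsE mulrC.
    - by move=> I1; rewrite xsE mulrC.
    rewrite [X in _ * X](_ : _ = 0) ?mulr0 //; case: (ltngtP q.1.1 q.1.2) ij => // ij _.
      exact: p2.
    move/val_inj: ij cJ => <- cJ; rewrite degeneration_union_diag; exact: p1.
  move=> /eqP toy _ -> M; apply: filterS (xoo q M toy) => p /=.
  by rewrite xsE.
- rewrite mem_cat => /orP[] /mapP[t]; rewrite mem_filter => /andP[tf _] -> /=;
    have [a [b [_ _ vc]]] := v_c t tf; split.
  + by exists (b - a + 1); apply: filterE => p; rewrite cstE vc lte_fin; lra.
  + by move=> e e0; apply: filterS (xlo t e tf e0) => p /ltW; rewrite cstE xsE.
  + exists (b - a + 1); apply: filterS (xhi t 1 tf ltr01) => p /=.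
    by rewrite xsE vc -EFinD.
  + move=> e e0; apply: filterS (xhi t e tf e0) => p /= /ltW.
    by rewrite cstE xsE EFinN leeBlDr.
pose Y i J := mvev N idfun y (var (i, J)); exists Y; split.
- move=> i J; have tT : (i, J) \in enum T by rewrite mem_enum.
  have [toy|tf] := eqVneq (mu i J) +oo%E.
    have -> : Y i J = 0.
      apply: yE; rewrite mem_cat; apply/orP; right; apply/mapP; exists (i, J) => //.
      by rewrite mem_filter tT toy eqxx.
    by rewrite valuation0 toy addey // valmat_neqNy.
  have [c0 ->] := Hc (i, J) tf; congr (_ + _)%E.
  have tft : (i, J) \in [seq t <- enum T | mu t.1 t.2 != +oo%E] by rewrite mem_filter tT tf.
  have [|_] := yQ (var (i, J), cst (c (i, J))).
    by rewrite mem_cat (map_f (fun t => (var t, cst (c t))) tft).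
  have [|Y0] := yQ (cst (c (i, J)), var (i, J)).
    by rewrite mem_cat (map_f (fun t => (cst (c t), var t)) tft) orbT.
  rewrite /= !cstE -/(Y i J) in Y0 *; rewrite /valuation_ring !valuationM !valuationV //.
  have := valuation_fin v c0; have := valuation_fin v Y0.
  case: (v (c _)) => // a; case: (v (Y i J)) => // b _ _.
  rewrite -!EFinN -!EFinD !lee_fin => ab ba; congr (_%:E); apply/eqP; rewrite eq_le; lra.
- move=> i j ij I0 J cI cJ; have <- := PE y i j I0 J.
  apply: yE; rewrite mem_cat; apply/orP; left; apply/mapP.
  by exists ((i, j), (I0, J)); rewrite // mem_filter mem_enum ij cI cJ !eqxx.
Qed.

End PointsToFlags.

Lemma degeneration_union_step n k (S : 'I_k -> {set 'I_n}) (i : 'I_k) :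
  degeneration_union S (src i) (tgt i) = S i.
Proof. by rewrite degeneration_union_tgt // degeneration_union_diag finset.set0U. Qed.

Lemma flags_of_closure (R : realType) (K : closedFieldType) (v : valuation R K)
    (n k : nat) (r : 'I_k.+1 -> nat) (S : 'I_k -> {set 'I_n})
    (mu : forall i, valuated_matroid R 'I_n (r i)) :
  (forall i, exists L : {vspace coord_space K 'I_n}, realizes v (r i) L (mu i)) ->
  trop_closure v (@LFl K n k r S) (fun i => valmat_class (mu i)) ->
  exists2 L, realizations v mu L &
    forall i : 'I_k, (pr_space (S i) (L (src i)) <= L (tgt i))%VS.
Proof.
move=> mu_realizable clmu.
have /choice[J0 J0fin] (i : 'I_k.+1) : exists J, mu i J != +oo%E by exact: valmat_finite.
have [y [yv yvan]] := closure_lift mu_realizable J0fin clmu.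
have yfin i J : (mu i J != +oo%E) = (y i J != 0).
  rewrite yv -(valuation_eqy v); have := J0fin i; have := valmat_neqNy (mu i) (J0 i).
  by case: (mu i (J0 i)) => // a; have := valuation_neqNy v (y i J); case: (v (y i J)).
have y0 i (J : {set 'I_n}) : #|J| != r i -> y i J = 0.
  by move/valmat_card => muJ; apply/eqP/negPn; rewrite -yfin muJ eqxx.
have AX (i : 'I_k.+1) : {A : (r i).-tuple (coord_space K 'I_n) |
    exists c, c != 0 /\ forall I, pluck A I = c * y i I}.
  apply: cid; apply: plucker_reconstruct; first exact: y0.
    by exists (J0 i); rewrite -yfin.
  by rewrite -(degeneration_union_diag S i); exact: yvan.
pose A i := sval (AX i).
have AP i : exists c, c != 0 /\ forall I, pluck (A i) I = c * y i I := svalP (AX i).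
have J0card i : #|J0 i| = r i.
  by apply/eqP; apply: contraTT (J0fin i) => /valmat_card ->.
have AJ0 i : minor (A i) (J0 i) != 0.
  have [c [c0 cE]] := AP i; have := cE (J0 i); rewrite /pluck J0card eqxx => ->.
  by rewrite mulf_neq0 // -yfin.
exists (fun i => <<A i>>%VS) => i.
  split.
    have : free (A i).
      apply: (@free_pl _ _ _ _ (enum_fun (J0card i))).
      by rewrite -minor_enum.
    by rewrite /free size_tuple => /eqP.
  exists (A i) => //; have [c [c0 cE]] := AP i.
  have [a aE] : exists a, mu i (J0 i) = a%:E.
    by exists (fine (mu i (J0 i))); rewrite fineK // fin_numE J0fin valmat_neqNy.
  exists (a - fine (v c)) => I; rewrite yv aE /minor_valuation; case: ifP => [cI|/negbT cI].
    have := cE I; rewrite /pluck cI => ->; rewrite valuationM EFinB fineK ?valuation_fin //.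
    have := valuation_fin v c0; case: (v c) => // b _; have := valuation_neqNy v (y i I).
    case: (v (y i I)) => [d| |] //= _.
    by rewrite -!EFinD; congr (_%:E); ring.
  by rewrite y0 // valuation0 addey // addye.
apply: plucker_incidence (J0card (src i)) (AJ0 (src i)) (J0card (tgt i)) (AJ0 (tgt i)) _.
have [a [_ aE]] := AP (src i); have [b [_ bE]] := AP (tgt i).
move=> I J cI cJ; rewrite (plucker_relZ _ _ _ aE bE) -degeneration_union_step.
by rewrite yvan ?mulr0 //= /bump /= add1n.
Qed.

Theorem theoremB (R : realType) (K : closedFieldType) (v : valuation R K)
    (v_nontrivial : nontrivial_valuation v)
    (n k : nat) (r : 'I_k.+1 -> nat)
    (r_mono : forall i j : 'I_k.+1, (i <= j)%N -> (r i <= r j)%N)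
    (r_le : forall i : 'I_k.+1, (r i <= n)%N)
    (S : 'I_k -> {set 'I_n})
    (mu : forall i : 'I_k.+1, valuated_matroid R 'I_n (r i))
    (mu_realizable : forall i : 'I_k.+1,
       exists L : {vspace coord_space K 'I_n}, realizes v (r i) L (mu i)) :
  [<-> (* (a) *)
       trop_closure v (@LFl K n k r S) (fun i => valmat_class (mu i));
       (* (b) *)
       realizable_ld_flag_matroid v S mu;
       (* (c) *)
       exists2 L, realizations v mu L &
         forall i : 'I_k, (pr_space (S i) (L (src i)) <= L (tgt i))%VS;
       (* (d) *)
       realizable_pr_morphisms v S mu].
Proof.
tfae.
- move=> /(flags_of_closure mu_realizable)[L Lmu LS].
  have quot i := realizes_pr_quotient (valmat_finite (mu (src i))) (Lmu (src i)) (Lmu (tgt i)) (LS i).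
  by split; [move=> i; case: (quot i) | exists L].
- by move=> [_ [L Lmu quot]]; exists L => // i; case: (quot i).
- move=> [L Lmu LS].
  have quot (i : 'I_k) : realizes_quotient v (pr_pullback_rank (S i) (mu (src i))) (r (tgt i))
      (ext0_space (pr_space (S i) (L (src i)))) (ext0_space (L (tgt i)))
      (pr_pullback (S i) (r (src i)) (mu (src i))) (add_loop (mu (tgt i))).
    rewrite pr_pullback_rankE pr_pullbackE -pr_ext0_space; apply: realizes_pr_quotient.
    - exact/add_loop_fin/valmat_finite.
    - exact: realizes_add_loop.
    - exact: realizes_add_loop.
    - by rewrite pr_ext0_space ext0_space_sub.
  split; last by exists L.
  by move=> i; split; [case: (quot i) | exists (ext0_space (pr_space (S i) (L (src i)))), (ext0_space (L (tgt i)))].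
- move=> [_ [L Lmu quot]]; apply/subset_closure/(flags_in_trop Lmu) => i.
  by have [_ _ _] := quot i; rewrite ext0_space_sub.
Qed.
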